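(* For $K$ a number field, take $b=b(X)=(1-X-X^2)/X\in K(X)$ and define the associated elliptic curve over $K(X)$ as $$E_{b}: y^2+xy+by=x^3-5bx-(1+7b)b.$$ Then for infinitely many $t\in K^*$, the specialization $E_{b(t)}$ of $E_b$ is an elliptic curve over $K$ for which $$\left(\frac{(t^2+t)(t^2-1)+1}{t^2},\ \frac{(1-t^2)\left(t^4+2 t^3+t-1\right)}{t^3}\right)\in E_{b(t)}(K)$$ is a non-trivial locally $3$-imprimitive point.
   Context: For $t\in K^*$, $E_{b(t)}$ is the curve over $K$ obtained by substituting $X=t$, i.e. replacing $b$ by $b(t)=(1-t-t^2)/t$. Let $E$ be an elliptic curve over a number field $K$. For a prime $\mathfrak p$ of $K$ of good reduction of $E$, $k_{\mathfrak p}$ is the residue class field and $\overline P\in E(k_{\mathfrak p})$ is the reduction of $P\in E(K)$. A point $P\in E(K)$ is locally $3$-imprimitive if $3$ divides the index $[E(k_{\mathfrak p}):\langle \overline P\rangle]$ for all but finitely many primes $\mathfrak p$ of $K$ (of good reduction). A locally $3$-imprimitive non-torsion point $P\in E(K)$ is called non-trivial if condition (C) below holds, but neither (A) nor (B) holds: (A) $E(K)$ contains a torsion point of order $3$ and $P\in 3\cdot E(K)$; (B) $E$ has complete rational $3$-torsion over $K$; (C) there exists an isogeny $\phi: E'\to E$ of elliptic curves defined over $K$ with kernel generated by a torsion point of $E'(K)$ of order $3$ and $P\in\phi[E'(K)]$. *)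

(* Defs.v *)
From mathcomp Require Import all_boot all_order all_algebra all_field.
From mathcomp Require Import boolp classical_sets cardinality.
From mathcomp Require Import mpoly.

Set Implicit Arguments.
Unset Strict Implicit.
Unset Printing Implicit Defensive.

Import GRing.Theory.
Local Open Scope classical_set_scope.
Local Open Scope ring_scope.

(* y^2 + a1 x y + a3 y = x^3 + a2 x^2 + a4 x + a6 *)
Record weierstrass (F : Type) := Weierstrass
  { wa1 : F; wa2 : F; wa3 : F; wa4 : F; wa6 : F }.

Definition map_weierstrass (F G : Type) (f : F -> G) (E : weierstrass F) :=
  Weierstrass (f (wa1 E)) (f (wa2 E)) (f (wa3 E)) (f (wa4 E)) (f (wa6 E)).

Definition wdisc (F : comNzRingType) (E : weierstrass F) : F :=
  let: Weierstrass a1 a2 a3 a4 a6 := E in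
  let b2 := a1 ^+ 2 + 4 * a2 in
  let b4 := 2 * a4 + a1 * a3 in
  let b6 := a3 ^+ 2 + 4 * a6 in
  let b8 := a1 ^+ 2 * a6 + 4 * a2 * a6 - a1 * a3 * a4 + a2 * a3 ^+ 2
            - a4 ^+ 2 in
  - b2 ^+ 2 * b8 - 8 * b4 ^+ 3 - 27 * b6 ^+ 2 + 9 * b2 * b4 * b6.

Definition elliptic (F : fieldType) (E : weierstrass F) : bool :=
  wdisc E != 0.

(* [None] is the point at infinity; [P \in points E] says P is in E(F). *)
Definition pt (F : Type) : Type := option (F * F).

Definition points (F : fieldType) (E : weierstrass F) : {pred option (F * F)} :=
  fun P => if P is Some (x, y) then
    y ^+ 2 + wa1 E * x * y + wa3 E * y
      == x ^+ 3 + wa2 E * x ^+ 2 + wa4 E * x + wa6 E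
  else true.

Definition map_pt (F G : Type) (f : F -> G) (P : pt F) : pt G :=
  if P is Some (x, y) then Some (f x, f y) else None.

(* Chord-and-tangent law; [l] is the slope of the line through P and Q. *)
Definition padd (F : fieldType) (E : weierstrass F) (P Q : pt F) : pt F :=
  let: Weierstrass a1 a2 a3 a4 a6 := E in
  match P, Q with
  | None, _ => Q
  | _, None => P
  | Some (x1, y1), Some (x2, y2) =>
    if (x1 == x2) && (y1 + y2 + a1 * x2 + a3 == 0) then None else
    let l := if x1 == x2
             then (3 * x1 ^+ 2 + 2 * a2 * x1 + a4 - a1 * y1)
                  / (2 * y1 + a1 * x1 + a3)
             else (y2 - y1) / (x2 - x1) in
    let x3 := l ^+ 2 + a1 * l - a2 - x1 - x2 in
    Some (x3, - (l + a1) * x3 - (y1 - l * x1) - a3)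
  end.

Definition pmul (F : fieldType) (E : weierstrass F) (n : nat) (P : pt F) :
  pt F := iter n (padd E P) None.

Definition torsion (F : fieldType) (E : weierstrass F) (P : pt F) : Prop :=
  exists2 n : nat, (0 < n)%N & pmul E n P = None.

Definition has_order (F : fieldType) (E : weierstrass F) (n : nat) (P : pt F) :
  Prop :=
  [/\ (0 < n)%N, pmul E n P = None
    & forall m : nat, (0 < m < n)%N -> pmul E m P <> None].

(* Over a finite field, <P> = {O, P, 2P, ...}, so the coset Q + <P> is the
   orbit of Q under translation by P, and the index is the number of cosets. *)
Definition point_index (k : finFieldType) (E : weierstrass k)
    (P : option (k * k)) : nat :=
  #|[set [set R in orbit (padd E P) Q]%SET | Q in points E]%SET|.

Definition hcoord (F : fieldType) (P : pt F) : 'I_3 -> F :=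
  fun i => if P is Some (x, y) then nth 0 [:: x; y; 1] i
           else nth 0 [:: 0; 1; 0] i.

Definition proportional (F : fieldType) (v w : 'I_3 -> F) : Prop :=
  exists2 c : F, c != 0 & forall i, v i = c * w i.

Definition ring_of_integers (K : fieldExtType rat) : set K :=
  [set x | integralOver (intr : int -> K) x].

(* A (finite) prime of K: a nonzero prime ideal of the ring of integers. *)
Record prime_of (K : fieldExtType rat) (p : set K) : Prop := PrimeOf {
  prime_sub : p `<=` @ring_of_integers K;
  prime_0 : p 0;
  prime_add : forall x y, p x -> p y -> p (x + y);
  prime_mul : forall a x, @ring_of_integers K a -> p x -> p (a * x);
  prime_proper : ~ p 1;
  prime_prime : forall x y, @ring_of_integers K x -> @ring_of_integers K y ->
    p (x * y) -> p x \/ p y;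
  prime_nonzero : exists2 x, p x & x != 0 }.

(* k together with rho is the residue field of p: rho restricts to a
   surjective ring morphism from the ring of integers onto k with kernel p.
   The values of rho outside the ring of integers are irrelevant. *)
Record residue_field (K : fieldExtType rat) (p : set K) (k : finFieldType)
    (rho : K -> k) : Prop := ResidueField {
  residue_1 : rho 1 = 1;
  residue_add : forall x y, @ring_of_integers K x -> @ring_of_integers K y ->
    rho (x + y) = rho x + rho y;
  residue_mul : forall x y, @ring_of_integers K x -> @ring_of_integers K y ->
    rho (x * y) = rho x * rho y;
  residue_ker : forall x, @ring_of_integers K x -> (rho x = 0 <-> p x);
  residue_surj : forall c : k, exists2 x, @ring_of_integers K x & rho x = c }.

(* The substitution x = u^2 x' + r, y = u^3 y' + u^2 s x' + t. *)
Record chvar (F : Type) := Chvar { cu : F; cr : F; cs : F; ct : F }.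

Definition chvar_curve (F : fieldType) (c : chvar F) (E : weierstrass F) :
  weierstrass F :=
  let: Chvar u r s t := c in
  let: Weierstrass a1 a2 a3 a4 a6 := E in
  Weierstrass
    ((a1 + 2 * s) / u)
    ((a2 - s * a1 + 3 * r - s ^+ 2) / u ^+ 2)
    ((a3 + r * a1 + 2 * t) / u ^+ 3)
    ((a4 - s * a3 + 2 * r * a2 - (t + r * s) * a1 + 3 * r ^+ 2 - 2 * s * t)
       / u ^+ 4)
    ((a6 + r * a4 + r ^+ 2 * a2 + r ^+ 3 - t * a3 - t ^+ 2 - r * t * a1)
       / u ^+ 6).

Definition chvar_pt (F : fieldType) (c : chvar F) (P : pt F) : pt F :=
  let: Chvar u r s t := c in
  if P is Some (x, y) then
    Some ((x - r) / u ^+ 2, (y - s * (x - r) - t) / u ^+ 3)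
  else None.

(* The change of variables c turns E into a model with integral coefficients
   and discriminant outside p. Asking for coefficients in the ring of integers
   rather than in its localization at p loses nothing: denominators prime to p
   are absorbed by u. *)
Definition good_model (K : fieldExtType rat) (p : set K) (E : weierstrass K)
    (c : chvar K) : Prop :=
  let W := chvar_curve c E in
  let OK := @ring_of_integers K in
  [/\ cu c != 0,
      [/\ OK (wa1 W), OK (wa2 W), OK (wa3 W), OK (wa4 W) & OK (wa6 W)]
    & ~ p (wdisc W)].

Definition good_reduction (K : fieldExtType rat) (E : weierstrass K)
    (p : set K) : Prop := exists c : chvar K, good_model p E c.

(* Q is the reduction of P modulo p: reduce homogeneous coordinates of P that
   are integral and not all in p. *)
Definition reduces_to (K : fieldExtType rat) (p : set K) (k : finFieldType)
    (rho : K -> k) (P : pt K) (Q : pt k) : Prop :=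
  exists v : 'I_3 -> K,
    [/\ proportional v (hcoord P),
        forall i, @ring_of_integers K (v i),
        exists i, ~ p (v i)
      & proportional (fun i => rho (v i)) (hcoord Q)].

(* q divides [E(k_p) : <reduction of P>]. Two good models at p differ by an
   isomorphism over the local ring at p, and two residue fields by a unique
   isomorphism compatible with rho, so the index depends on neither. *)
Definition divides_index_at (K : fieldExtType rat) (q : nat)
    (E : weierstrass K) (P : pt K) (p : set K) : Prop :=
  forall (k : finFieldType) (rho : K -> k), residue_field p rho ->
  exists (c : chvar K) (Pbar : pt k),
    [/\ good_model p E c,
        reduces_to p rho (chvar_pt c P) Pbar
      & (q %| point_index (map_weierstrass rho (chvar_curve c E)) Pbar)%N].

Definition locally_imprimitive (K : fieldExtType rat) (q : nat)
    (E : weierstrass K) (P : pt K) : Prop :=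
  finite_set [set p : set K |
    [/\ prime_of p, good_reduction E p & ~ divides_index_at q E P p]].

(* phi, seen on points over the algebraic closure Kbar (embedding iota), is an
   isogeny E' -> E defined over K: a non-constant map preserving the points at
   infinity which, around every point of E'(Kbar), is given by homogeneous
   forms of equal degree with coefficients in K. *)
Definition forms_at (K Kbar : fieldType) (iota : {rmorphism K -> Kbar})
    (f : 'I_3 -> {mpoly K[3]}) (Q : pt Kbar) : 'I_3 -> Kbar :=
  fun i => (map_mpoly iota (f i)).@[hcoord Q].

Record isogeny (K Kbar : fieldType) (iota : {rmorphism K -> Kbar})
    (E' E : weierstrass K) (phi : pt Kbar -> pt Kbar) : Prop := Isogeny {
  isogeny_codom : forall Q, Q \in points (map_weierstrass iota E') ->
    phi Q \in points (map_weierstrass iota E);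
  isogeny_0 : phi None = None;
  isogeny_nonconst :
    exists2 Q, Q \in points (map_weierstrass iota E') & phi Q <> None;
  isogeny_regular : forall Q, Q \in points (map_weierstrass iota E') ->
    exists (d : nat) (f : 'I_3 -> {mpoly K[3]}),
      [/\ forall i, f i \is d.-homog,
          exists i, forms_at iota f Q i != 0
        & forall R, R \in points (map_weierstrass iota E') ->
            (exists i, forms_at iota f R i != 0) ->
            proportional (forms_at iota f R) (hcoord (phi R))] }.

Definition condA (K : fieldType) (E : weierstrass K) (P : pt K) : Prop :=
  (exists2 T, T \in points E & has_order E 3 T) /\
  (exists2 Q, Q \in points E & P = pmul E 3 Q).

Definition condB (K Kbar : fieldType) (iota : {rmorphism K -> Kbar})
    (E : weierstrass K) : Prop :=
  forall Q : pt Kbar, Q \in points (map_weierstrass iota E) ->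
    pmul (map_weierstrass iota E) 3 Q = None ->
    exists2 T : pt K, T \in points E & Q = map_pt iota T.

Definition condC (K Kbar : fieldType) (iota : {rmorphism K -> Kbar})
    (E : weierstrass K) (P : pt K) : Prop :=
  exists (E' : weierstrass K) (phi : pt Kbar -> pt Kbar) (T : pt K),
    [/\ elliptic E',
        isogeny iota E' E phi,
        T \in points E' /\ has_order E' 3 T,
        forall Q, Q \in points (map_weierstrass iota E') ->
          (phi Q = None <-> exists n : nat, Q = map_pt iota (pmul E' n T))
      & exists2 Q : pt K, Q \in points E' &
          phi (map_pt iota Q) = map_pt iota P].

Definition nontrivial_locally_3_imprimitive (K : fieldExtType rat)
    (Kbar : fieldType) (iota : {rmorphism K -> Kbar})
    (E : weierstrass K) (P : pt K) : Prop :=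
  [/\ P \in points E /\ ~ torsion E P,
      locally_imprimitive 3 E P,
      condC iota E P,
      ~ condA E P
    & ~ condB iota E].

Definition bpar (F : fieldType) (x : F) : F := (1 - x - x ^+ 2) / x.

Definition Ecurve (F : fieldType) (b : F) : weierstrass F :=
  Weierstrass 1 0 b (- (5 * b)) (- ((1 + 7 * b) * b)).

Definition special_point (F : fieldType) (t : F) : pt F :=
  Some (((t ^+ 2 + t) * (t ^+ 2 - 1) + 1) / t ^+ 2,
        (1 - t ^+ 2) * (t ^+ 4 + 2 * t ^+ 3 + t - 1) / t ^+ 3).

(* Main.v *)
Require Import Defs.
From mathcomp Require Import all_boot all_order all_algebra all_field.
From mathcomp Require Import boolp classical_sets functions cardinality.
From HB Require Import structures.
From mathcomp Require Import mpoly ring zify.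

(** The curve [tri a c : y ^ 2 + a x y + c y = x ^ 3] has the 3-torsion point
    [T3 = (0, 0)], and Velu's formulas describe the quotient by the group that
    it generates: an isogeny [phi] onto
    [vel a c : y ^ 2 + a x y + c y = x ^ 3 - 5 a c x - (a ^ 3 c + 7 c ^ 2)].
    For [a = 1] and [c = b] the target is [E_b]; the relation
    [b = (1 - t - t ^ 2) / t] says that [(1, t)] lies on the source, and the
    special point is [phi (1, t)].  This is condition (C), and the reason why
    the index is divisible by 3 at almost every prime: over a finite field [k]
    the source and the target of an isogeny have equally many points and the
    kernel has order 3, so that the image of [phi], which contains the reduced
    point, has index 3.

    The index can be found without counting points. Over an algebraic closure, a
    point above a given point of [E(k)] is moved by the Frobenius map by some
    [j T3], and [S |-> j] is a homomorphism [E(k) -> Z/3] that vanishes on the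
    image of [phi]. It is onto as soon as some point satisfies [Frob R = R + T3]
    ([exists_frob_translate]). The abscissas of the [R] with
    [x(Frob R) = x(R + T3)] are the roots of a separable polynomial of degree
    [2 q + 1], while those with [Frob R = - (R + T3)] have slope [y / x] in [k],
    which leaves at most [2 q] abscissas; so [Frob R = R + T3] does occur. The
    homomorphism is constant on the cosets of the subgroup generated by [phi Q],
    which therefore fall into three classes of equal size
    ([three_dvd_velu_index]). The only primes not covered contain the non-zero
    integer [disc_int], and they are finite in number
    ([finite_primes_dividing]): that primes above [l] are at most [[K : Q]]
    follows from the linear independence of elements lying in all of them but one.

    The parameters are [t = (d ^ 3 + 1) / d] with [d] a positive multiple of
    [4 N], where [N] depends on [K] only.

    - The special point is not torsion: doubling lowers the 2-adic valuation of
      the abscissa by exactly 2 ([val2_nontorsion]).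
    - Only finitely many classes of rationals modulo cubes become cubes in [K],
      since cube roots from distinct classes are linearly independent by a trace
      argument ([cube_classes_finite]).  The numerators [d ^ 3 + 1] and
      [(d ^ 3 + 1) ^ 2 + (d ^ 3 + 1) d - d ^ 2] of [t] and [- b] lie strictly
      between consecutive cubes and are prime to [d], hence to [N]; so none of
      [t], [b], [b t] and [b / t] is a cube in [K] ([noncube_tpar]).
    - (A) fails: the ordinate of a triple [3 R'] on the source is the cube of a
      function of [phi R'] ([triple_y_cube]).  If [P = 3 R] and [phi R' = R],
      then [3 R'] is one of the three preimages [(1, t)], [(1, t) + T3],
      [(1, t) - T3] of [P]; their ordinates are [t], [- b ^ 2 t] and
      [- b / t ^ 2], so one of [t], [b / t], [b t] is a cube in [K]
      ([not_triple]).
    - (B) fails: for [u ^ 3 = b] the target has the 3-torsion point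
      [(u + 3 u ^ 2, 4 u ^ 3)], and [u] is a rational function of its abscissa
      ([not_condB]).

    The group law of a Weierstrass curve in any characteristic rests on two
    points: a single description of chords and tangents ([chord]), and the fact
    that associativity need only be checked for points in general position
    ([assoc_of_generic]), where it is one identity between rational functions
    ([generic_line_identity]). *)

Set Implicit Arguments.
Unset Strict Implicit.
Unset Printing Implicit Defensive.

Import Order.POrderTheory GRing.Theory Num.Theory.
Local Open Scope classical_set_scope.
Local Open Scope ring_scope.

(** * Associativity from its generic case *)

(** For an operation that already satisfies [(x + y) - y = x], associativity
    holds formally when a term vanishes, when two of the points involved cancel,
    or when [x = z].  The coincidences [z = y], [z = x + y] and [x = y + z] are
    instances of [assoc_double]. *)
Section GenericAssociativity.
Variables (G : eqType) (add : G -> G -> G) (opp : G -> G) (zero : G).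
Local Notation "x + y" := (add x y).
Local Notation "- x" := (opp x).
Local Notation "x - y" := (add x (opp y)).
Hypothesis addC : commutative add.
Hypothesis add0 : left_id zero add.
Hypothesis oppK : involutive opp.
Hypothesis subrr : forall x, x - x = zero.
Hypothesis oppD : forall x y, - (x + y) = - x - y.
Hypothesis addK : forall x y, (x + y) - y = x.
Hypothesis generic : forall x y z,
  [/\ x != zero, y != zero & z != zero] ->
  [/\ x != - y, z != x, z != y & z != - y] ->
  [/\ z != x + y, z != - (x + y), x != y + z & x != - (y + z)] ->
  (x + y) + z = x + (y + z).

Let add_r0 x : x + zero = x. Proof. by rewrite addC. Qed.
Let addKl x y : - x + (x + y) = y. Proof. by rewrite addC (addC x) addK. Qed.
Let subK x y : (x - y) + y = x. Proof. by rewrite -[X in _ + X]oppK addK. Qed.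

Let assoc_easy x y z :
  [|| x == zero, y == zero, z == zero, x == - y, z == x, z == - y,
   z == - (x + y) | x == - (y + z)] -> (x + y) + z = x + (y + z).
Proof.
case/orP=> [/eqP->|]; first by rewrite !add0.
case/orP=> [/eqP->|]; first by rewrite add0 add_r0.
case/orP=> [/eqP->|]; first by rewrite !add_r0.
case/orP=> [/eqP->|]; first by rewrite addKl (addC (- y)) subrr add0.
case/orP=> [/eqP->|]; first by rewrite addC (addC y).
case/orP=> [/eqP->|]; first by rewrite addK subrr add_r0.
case/orP=> [/eqP->|/eqP->]; first by rewrite subrr oppD (addC y) subK subrr.
by rewrite [RHS]addC subrr oppD (addC (- y)) subK addC subrr.
Qed.

Let assoc_double_generic x z : z != x + x -> (x + x) + z = x + (x + z).
Proof.
move=> hz; have [/assoc_easy //|] := boolP [|| x == zero, x == zero,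
  z == zero, x == - x, z == x, z == - x, z == - (x + x) | x == - (x + z)].
rewrite !negb_or => /and5P[x0 _ z0 xN /and4P[zx zN zS xU]].
apply: generic => //; split=> //.
apply: contra z0 => /eqP /(congr1 (fun t => t - x)).
by rewrite subrr (addC x z) addK => <-.
Qed.

(** The only case of [(x + x) + z] that the generic one misses is [z = x + x];
    it follows from the generic case applied to [x + x], [x + x] and [- x]. *)
Let assoc_double x z : (x + x) + z = x + (x + z).
Proof.
have [->|] := eqVneq z (x + x); last exact: assoc_double_generic.
set s := x + x; have [h|h] := eqVneq (- x) (s + s).
  have xs : x + s = - s by rewrite -[x]oppK h oppD subK.
  by rewrite -h xs -[in LHS](addK x x) -/s oppD oppK addC.
have := assoc_double_generic h.
rewrite addK => /(congr1 (add^~ x)); rewrite subK => ->.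
by rewrite addC (addC s).
Qed.

(** This is [assoc_double] read from right to left, the double point being
    [x + y]. *)
Let double_sum x y : (x + y) + (x + y) = ((x + y) + x) + y.
Proof. by have := assoc_double (x + y) (- y); rewrite addK => <-;
  rewrite subK. Qed.

Lemma assoc_of_generic : associative add.
Proof.
move=> x y z; symmetry.
have [/assoc_easy //|] := boolP [|| x == zero, y == zero,
  z == zero, x == - y, z == x, z == - y, z == - (x + y) | x == - (y + z)].
rewrite !negb_or => /and5P[x0 y0 z0 xN /and4P[zx zN zS xU]].
have [->|zy] := eqVneq z y;
  first by rewrite [RHS]addC assoc_double (addC y x) addC.
have [->|zS'] := eqVneq z (x + y).
  by rewrite [RHS]addC (addC y (x + y)) (addC x y) double_sum.
have [->|xU'] := eqVneq x (y + z); first by rewrite double_sum.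
by apply: generic.
Qed.
End GenericAssociativity.

(** * The chord-and-tangent law *)

(** Associativity in coordinates, with [P], [Q], [R] in general position, though
    [P = Q] is allowed.  The shear that makes the line [P Q] the axis and [P]
    the origin turns the cubic into [y ^ 2 + a x y + b y = x (x - p) (x - e)],
    where [p] and [e] are the abscissas of [Q] and [- (P + Q)], and [(r, s)] is
    [R].  The slopes [l2], [n] and [k] are those of the lines through [P + Q]
    and [R], through [Q] and [R], and through [P] and [Q + R]; the conclusion
    compares the third points of the first and the last.  As [s] is not zero,
    [b] can be eliminated. *)
Lemma generic_line_identity (F : fieldType) (a b p e r s l2 n k : F) :
  s != 0 -> r - e != 0 -> r - p != 0 ->
  s * (s + a * r + b) = r * (r - p) * (r - e) ->
  l2 * (r - e) = s + a * e + b ->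
  n * (r - p) = s ->
  let u := n ^+ 2 + a * n + e - r in
  let v := - n * (u - p) - a * u - b in
  u != 0 -> k * u = v ->
  let xA := l2 ^+ 2 + a * l2 + p - r in
  let xB := k ^+ 2 + a * k + p + e - u in
  xA = xB /\ s + l2 * (xA - r) = k * xB.
Proof.
move=> hs h1 h2 E hl hn u v hu hk.
have Eb : b = r * (r - p) * (r - e) / s - s - a * r.
  by apply: (mulfI hs); rewrite -E; field.
have En : n = s / (r - p) by rewrite -hn mulfK.
have El : l2 = (s + a * e + b) / (r - e) by rewrite -hl mulfK.
have Ek : k = v / u by rewrite -hk mulfK.
rewrite /= Ek El /v /u En Eb.
have hu' : s ^+ 2 + a * s * (r - p) + (e - r) * (r - p) ^+ 2 != 0.
  apply: contraNneq hu => hu0; rewrite /u En; apply/eqP.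
  apply: (mulIf (expf_neq0 2 h2)); rewrite mul0r -[RHS]hu0; field.
  by rewrite h2.
split; field; rewrite hs h1 h2 /= ?andbT.
  by apply: contraNneq hu' => <-; apply/eqP; ring.
by apply: contraNneq hu' => <-; apply/eqP; ring.
Qed.

Section WeierstrassLaw.
Variables (F : fieldType) (E : weierstrass F).
Hypothesis ellE : elliptic E.
Local Notation a1 := (wa1 E).
Local Notation a2 := (wa2 E).
Local Notation a3 := (wa3 E).
Local Notation a4 := (wa4 E).
Local Notation a6 := (wa6 E).

Definition oncurve (x y : F) :=
  y ^+ 2 + a1 * x * y + a3 * y = x ^+ 3 + a2 * x ^+ 2 + a4 * x + a6.

Lemma oncurveP x y : reflect (oncurve x y) (Some (x, y) \in points E).
Proof. exact: eqP. Qed.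

Definition pneg (P : pt F) : pt F :=
  if P is Some (x, y) then Some (x, - y - a1 * x - a3) else None.

(** [chord l x1 y1 x2 y2] : the line of slope [l] through [(x1, y1)] meets the
    curve again at [(x2, y2)], tangentially if the two points coincide.  The
    second equation is the first one times [(y1 + y2 + a1 x2 + a3) / (x2 - x1)],
    so that no case distinction between chords and tangents is needed. *)
Definition chord (l x1 y1 x2 y2 : F) :=
  y2 - y1 = l * (x2 - x1) /\
  l * (y1 + y2 + a1 * x2 + a3) =
    x1 ^+ 2 + x1 * x2 + x2 ^+ 2 + a2 * (x1 + x2) + a4 - a1 * y1.

Definition third_x (l x1 x2 : F) := l ^+ 2 + a1 * l - a2 - x1 - x2.

Definition chord_sum (l x1 y1 x2 : F) : pt F :=
  let x3 := third_x l x1 x2 in Some (x3, - (l + a1) * x3 - (y1 - l * x1) - a3).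

Lemma curve_diff x1 y1 x2 y2 : oncurve x1 y1 -> oncurve x2 y2 ->
  (y2 - y1) * (y1 + y2 + a1 * x2 + a3) =
  (x2 - x1) * (x1 ^+ 2 + x1 * x2 + x2 ^+ 2 + a2 * (x1 + x2) + a4 - a1 * y1).
Proof.
rewrite /oncurve => h1 h2.
apply/eqP; rewrite -subr_eq0; apply/eqP.
transitivity ((y2 ^+ 2 + a1 * x2 * y2 + a3 * y2
    - (x2 ^+ 3 + a2 * x2 ^+ 2 + a4 * x2 + a6))
  - (y1 ^+ 2 + a1 * x1 * y1 + a3 * y1
    - (x1 ^+ 3 + a2 * x1 ^+ 2 + a4 * x1 + a6))); first by ring.
by rewrite h1 h2 !subrr.
Qed.

Variant padd_spec x1 y1 x2 y2 : pt F -> Type :=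
| PaddOpp of x1 = x2 & y1 + y2 + a1 * x2 + a3 = 0 : padd_spec x1 y1 x2 y2 None
| PaddChord l of chord l x1 y1 x2 y2
    & (x1 != x2) || (y1 + y2 + a1 * x2 + a3 != 0) :
    padd_spec x1 y1 x2 y2 (chord_sum l x1 y1 x2).

Lemma padd_affine x1 y1 x2 y2 : padd E (Some (x1, y1)) (Some (x2, y2)) =
  if (x1 == x2) && (y1 + y2 + a1 * x2 + a3 == 0) then None else
  chord_sum (if x1 == x2
             then (3 * x1 ^+ 2 + 2 * a2 * x1 + a4 - a1 * y1)
                  / (2 * y1 + a1 * x1 + a3)
             else (y2 - y1) / (x2 - x1)) x1 y1 x2.
Proof. by rewrite /chord_sum /third_x; case: E. Qed.

Lemma paddP x1 y1 x2 y2 : oncurve x1 y1 -> oncurve x2 y2 ->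
  padd_spec x1 y1 x2 y2 (padd E (Some (x1, y1)) (Some (x2, y2))).
Proof.
move=> h1 h2; have hd := curve_diff h1 h2; rewrite padd_affine.
have [ex|nx] /= := eqVneq x1 x2; last first.
  have nx' : x2 - x1 != 0 by rewrite subr_eq0 eq_sym.
  apply: PaddChord; last by rewrite nx.
  split; first by rewrite divfK.
  by apply: (mulfI nx'); rewrite mulrA -hd; field.
have [hy|ny] := eqVneq; first exact: PaddOpp.
have ey : y1 = y2.
  apply/eqP; rewrite eq_sym -subr_eq0; apply/eqP/(mulIf ny).
  by rewrite hd ex subrr !mul0r.
subst x2 y2; apply: PaddChord; last by rewrite ny orbT.
have ny' : 2 * y1 + a1 * x1 + a3 != 0.
  by apply: contraNneq ny => <-; apply/eqP; ring.
split; first by ring.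
by field.
Qed.

(** Any slope that satisfies [chord] computes the sum, so later proofs need not
    know which formula defines it. *)
Lemma padd_chord l x1 y1 x2 y2 : oncurve x1 y1 -> oncurve x2 y2 ->
  chord l x1 y1 x2 y2 -> (x1 != x2) || (y1 + y2 + a1 * x2 + a3 != 0) ->
  padd E (Some (x1, y1)) (Some (x2, y2)) = chord_sum l x1 y1 x2.
Proof.
move=> h1 h2 [c1 c2] hn; case: paddP => // [ex ey|l' [c1' c2'] _].
  by move: hn; rewrite ex ey !eqxx.
suff -> : l' = l by [].
have [ex|nx] := eqVneq x1 x2.
  move: hn; rewrite ex eqxx /= => hn.
  by apply: (mulIf hn); rewrite c2 c2'.
have nx' : x2 - x1 != 0 by rewrite subr_eq0 eq_sym.
by apply: (mulIf nx'); rewrite -c1.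
Qed.

(** This is why the third intersection of the line lies on the curve, and why no
    further point of the line does. *)
Lemma line_cubic l x1 y1 x2 y2 x : oncurve x1 y1 -> chord l x1 y1 x2 y2 ->
  let y := y1 + l * (x - x1) in
  x ^+ 3 + a2 * x ^+ 2 + a4 * x + a6 - (y ^+ 2 + a1 * x * y + a3 * y) =
  (x - x1) * (x - x2) * (x - third_x l x1 x2).
Proof.
move=> h1 [c1 c2] y; rewrite /third_x /y.
have e2 : y2 = y1 + l * (x2 - x1) by rewrite -c1; ring.
have e4 : a4 = l * (y1 + y2 + a1 * x2 + a3)
    - (x1 ^+ 2 + x1 * x2 + x2 ^+ 2 + a2 * (x1 + x2) - a1 * y1).
  by rewrite c2; ring.
have e6 : a6 = y1 ^+ 2 + a1 * x1 * y1 + a3 * y1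
    - (x1 ^+ 3 + a2 * x1 ^+ 2 + a4 * x1) by rewrite h1; ring.
by rewrite e6 e4 e2; ring.
Qed.

Lemma oncurve_neg x y : oncurve x y -> oncurve x (- y - a1 * x - a3).
Proof. by rewrite /oncurve => <-; ring. Qed.

Lemma chord_third l x1 y1 x2 y2 : oncurve x1 y1 -> chord l x1 y1 x2 y2 ->
  let x3 := third_x l x1 x2 in oncurve x3 (y1 + l * (x3 - x1)).
Proof.
move=> h1 c x3; apply/esym/eqP; rewrite -subr_eq0; apply/eqP.
by rewrite (line_cubic _ h1 c) subrr mulr0.
Qed.

Lemma chord_sumE l x1 y1 x2 : chord_sum l x1 y1 x2 =
  pneg (Some (third_x l x1 x2, y1 + l * (third_x l x1 x2 - x1))).
Proof. by rewrite /chord_sum /=; congr Some; congr pair; ring. Qed.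

Lemma points_neg P : P \in points E -> pneg P \in points E.
Proof. by case: P => [[x y]|] // /oncurveP h; apply/oncurveP;
  exact: oncurve_neg. Qed.

Lemma pnegK : involutive pneg.
Proof. by case=> [[x y]|] //=; congr Some; congr pair; ring. Qed.

Lemma padd0l P : padd E None P = P. Proof. by case: E => *; case: P. Qed.

Lemma padd0r P : padd E P None = P.
Proof. by case: E => *; case: P => [[]|]. Qed.

Lemma points_padd P Q : P \in points E -> Q \in points E ->
  padd E P Q \in points E.
Proof.
case: P Q => [[x1 y1]|] [[x2 y2]|]; rewrite ?padd0l ?padd0r //.
move=> /oncurveP h1 /oncurveP h2; case: paddP => // l c _.
rewrite chord_sumE; apply: points_neg.
by apply/oncurveP; exact: chord_third h1 c.
Qed.

Lemma chord_sym l x1 y1 x2 y2 : oncurve x1 y1 -> oncurve x2 y2 ->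
  chord l x1 y1 x2 y2 -> chord l x2 y2 x1 y1.
Proof.
move=> h1 h2 [c1 c2]; have e2 : y2 = y1 + l * (x2 - x1) by rewrite -c1; ring.
split; first by rewrite e2; ring.
have e4 : a4 = l * (y1 + y2 + a1 * x2 + a3)
    - (x1 ^+ 2 + x1 * x2 + x2 ^+ 2 + a2 * (x1 + x2) - a1 * y1).
  by rewrite c2; ring.
by rewrite e4 e2; ring.
Qed.

Lemma paddC_on P Q : P \in points E -> Q \in points E ->
  padd E P Q = padd E Q P.
Proof.
case: P Q => [[x1 y1]|] [[x2 y2]|]; rewrite ?padd0l ?padd0r //.
move=> /oncurveP h1 /oncurveP h2; case: paddP => // [ex ey|l c hn].
  rewrite padd_affine -ex eqxx /=.
  suff -> : y2 + y1 + a1 * x1 + a3 = 0 by rewrite eqxx.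
  by rewrite ex -ey; ring.
have c' := chord_sym h1 h2 c; rewrite (padd_chord h2 h1 c').
  case: c => c _; have e2 : y2 = y1 + l * (x2 - x1) by rewrite -c; ring.
  rewrite !chord_sumE e2 /third_x; congr (pneg (Some _)); congr pair; ring.
move: hn; rewrite (eq_sym x2); have [->|//] := eqVneq x1 x2.
by rewrite (addrC y1).
Qed.

Lemma padd_negr P : padd E P (pneg P) = None.
Proof.
case: P => [[x y]|]; rewrite ?padd0l // /pneg padd_affine eqxx /=.
suff -> : y + (- y - a1 * x - a3) + a1 * x + a3 = 0 by rewrite eqxx.
by ring.
Qed.

Lemma chord_neg l x1 y1 x2 y2 : chord l x1 y1 x2 y2 ->
  chord (- l - a1) x1 (- y1 - a1 * x1 - a3) x2 (- y2 - a1 * x2 - a3).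
Proof.
case=> c1 c2; have e2 : y2 = y1 + l * (x2 - x1) by rewrite -c1; ring.
split; first by rewrite e2; ring.
have e4 : a4 = l * (y1 + y2 + a1 * x2 + a3)
    - (x1 ^+ 2 + x1 * x2 + x2 ^+ 2 + a2 * (x1 + x2) - a1 * y1).
  by rewrite c2; ring.
by rewrite e4 e2; ring.
Qed.

Lemma padd_oppD P Q : P \in points E -> Q \in points E ->
  pneg (padd E P Q) = padd E (pneg P) (pneg Q).
Proof.
case: P Q => [[x1 y1]|] [[x2 y2]|]; rewrite ?padd0l ?padd0r //.
move=> /oncurveP h1 /oncurveP h2; case: paddP => // [ex ey|l c hn].
  rewrite /pneg padd_affine -ex eqxx /=.
  suff -> : - y1 - a1 * x1 - a3 + (- y2 - a1 * x1 - a3) + a1 * x1 + a3 = 0.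
    by rewrite eqxx.
  by apply: oppr_inj; rewrite oppr0 -[RHS]ey ex; ring.
rewrite (padd_chord (oncurve_neg h1) (oncurve_neg h2) (chord_neg c)).
  by rewrite /chord_sum /third_x /=; congr Some; congr pair; ring.
move: hn; have [->|//] := eqVneq x1 x2; rewrite /= -oppr_eq0.
by apply: contraNneq => <-; apply/eqP; ring.
Qed.

(** Where both partial derivatives of the equation vanish, [a3], [a4], [a6] are
    functions of the other coefficients and of the point that make the
    discriminant vanish. *)
Lemma elliptic_smooth x y : oncurve x y -> 2 * y + a1 * x + a3 = 0 ->
  3 * x ^+ 2 + 2 * a2 * x + a4 - a1 * y != 0.
Proof.
move=> h hy; apply: contraTneq ellE => hx; rewrite /elliptic negbK.
have e3 : a3 = - (2 * y + a1 * x) by rewrite -[LHS]subr0 -hy; ring.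
have e4 : a4 = a1 * y - (3 * x ^+ 2 + 2 * a2 * x).
  by rewrite -[LHS]subr0 -hx; ring.
have e6 : a6 = y ^+ 2 + a1 * x * y + a3 * y
    - (x ^+ 3 + a2 * x ^+ 2 + a4 * x) by rewrite h; ring.
move: e3 e4 e6; rewrite /wdisc; case: E => /= b1 b2 b3 b4 b6 -> -> ->.
by apply/eqP; ring.
Qed.

Lemma chord_next l x1 y1 x2 y2 : oncurve x1 y1 -> chord l x1 y1 x2 y2 ->
  let x3 := third_x l x1 x2 in chord l x2 y2 x3 (y1 + l * (x3 - x1)).
Proof.
move=> h1 [c1 c2] x3; have e2 : y2 = y1 + l * (x2 - x1) by rewrite -c1; ring.
split; first by rewrite e2; ring.
have e4 : a4 = l * (y1 + y2 + a1 * x2 + a3)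
    - (x1 ^+ 2 + x1 * x2 + x2 ^+ 2 + a2 * (x1 + x2) - a1 * y1).
  by rewrite c2; ring.
by rewrite e4 e2 /x3 /third_x; ring.
Qed.

(** Collinearity is symmetric in the three points, so the line that gives
    [P + Q] also gives [Q - (P + Q) = - P]. *)
Lemma paddK_on P Q : P \in points E -> Q \in points E ->
  padd E (padd E P Q) (pneg Q) = P.
Proof.
case: P Q => [[x1 y1]|] [[x2 y2]|]; rewrite ?padd0l ?padd0r //; last first.
  by move=> *; rewrite padd_negr.
move=> hP hQ; have [h1 h2] : oncurve x1 y1 /\ oncurve x2 y2.
  by split; apply/oncurveP.
case: paddP => // [ex ey|l c hn].
  rewrite padd0l /pneg ex; congr Some; congr pair.
  by rewrite -[LHS]addr0 -[X in _ + X]ey; ring.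
rewrite chord_sumE -padd_oppD //; last first.
  by apply/oncurveP; exact: chord_third h1 c.
pose x3 := third_x l x1 x2; pose y3 := y1 + l * (x3 - x1).
have h3 : oncurve x3 y3 := chord_third h1 c.
have c' : chord l x2 y2 x3 y3 := chord_next h1 c.
have c3 := chord_sym h2 h3 c'.
have e1 : y1 = y2 + l * (x1 - x2).
  have -> : l * (x1 - x2) = - (l * (x2 - x1)) by ring.
  by case: c => <- _; ring.
have e3 : third_x l x3 x2 = x1 by rewrite /x3 /third_x; ring.
rewrite (padd_chord h3 h2 c3).
  by rewrite chord_sumE pnegK e3 /y3; congr Some; congr pair; ring.
have [ex /=|//] := eqVneq x3 x2.
(* if P + Q = Q, the line is tangent at the 2-torsion point Q *)
apply/eqP => ey; have e32 : y3 = y2.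
  by case: c' => + _; rewrite ex subrr mulr0 => /eqP; rewrite subr_eq0 => /eqP.
have hy : 2 * y2 + a1 * x2 + a3 = 0 by rewrite -ey e32; ring.
case/negP: (elliptic_smooth h2 hy).
case: c' => _; rewrite ex e32.
have -> : y2 + y2 + a1 * x2 + a3 = 0 by rewrite -hy; ring.
by rewrite mulr0 => /esym <-; apply/eqP; ring.
Qed.

Lemma pneg_eqP x1 y1 x2 y2 : oncurve x1 y1 -> oncurve x2 y2 ->
  Some (x1, y1) != Some (x2, y2) :> pt F ->
  Some (x1, y1) != pneg (Some (x2, y2)) -> x1 != x2.
Proof.
move=> h1 h2 n1 n2; apply/eqP => ex; have := curve_diff h1 h2.
rewrite ex subrr mul0r => /eqP; rewrite mulf_eq0 => /orP[|] /eqP h.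
  by case/negP: n1; rewrite ex -[y2](subrK y1) h add0r.
case/negP: n2; rewrite /= ex; apply/eqP; congr Some; congr pair.
by rewrite -[RHS]addr0 -h; ring.
Qed.

(** Under these hypotheses all the sums except perhaps [P + Q] are given by
    chords through points with distinct abscissas, and [generic_line_identity]
    applies after the shear. *)
Lemma padd_assoc_generic P Q R :
  P \in points E -> Q \in points E -> R \in points E ->
  [/\ P != None, Q != None & R != None] ->
  [/\ P != pneg Q, R != P, R != Q & R != pneg Q] ->
  [/\ R != padd E P Q, R != pneg (padd E P Q), P != padd E Q R
     & P != pneg (padd E Q R)] ->
  padd E (padd E P Q) R = padd E P (padd E Q R).
Proof.
case: P Q R => [[x1 y1]|] [[x2 y2]|] [[x3 y3]|] hP hQ hR []; rewrite ?eqxx //.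
move=> _ _ _ [nPQ nRP nRQ nRQ'].
have [h1 [h2 h3]] : oncurve x1 y1 /\ oncurve x2 y2 /\ oncurve x3 y3.
  by split; last split; apply/oncurveP.
have hS := points_padd hP hQ; have hU := points_padd hQ hR.
case: paddP hS => // [ex ey|l c hn].
  case/negP: nPQ; rewrite /= ex; apply/eqP; congr Some; congr pair.
  by rewrite -[RHS]addr0 -ey; ring.
have n32 := pneg_eqP h3 h2 nRQ nRQ'.
case: (paddP h2 h3) hU n32 => [->|n cn _]; first by rewrite eqxx.
rewrite [chord_sum n _ _ _]/chord_sum [chord_sum l _ _ _]/chord_sum.
set xS := third_x l _ _; set yS := (X in Some (xS, X)).
set xU := third_x n _ _; set yU := (X in Some (xU, X)).
move=> /oncurveP hU n32 /oncurveP hS [nRS nRS' nPU nPU'].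
have n3S := pneg_eqP h3 hS nRS nRS'; have n1U := pneg_eqP h1 hU nPU nPU'.
case: (paddP hS h3) n3S => [->|l2 c2 _]; first by rewrite eqxx.
move=> n3S; case: (paddP h1 hU) n1U => [->|k ck _ n1U]; first by rewrite eqxx.
rewrite !chord_sumE; congr pneg.
have e2 : y2 = y1 + l * (x2 - x1) by case: c => <- _; ring.
(* the line through P and Q does not contain R *)
have nline : y3 - (y1 + l * (x3 - x1)) != 0.
  apply: contra_neq nRP => /eqP; rewrite subr_eq0 => /eqP ey.
  have := line_cubic x3 h1 c; rewrite /= -ey -(h3 : _ = _) subrr => /esym/eqP.
  rewrite !mulf_eq0 !subr_eq0 (negPf n32) (negPf n3S) !orbF => /eqP ex.
  by rewrite ey ex subrr mulr0 addr0.
pose a := a1 + 2 * l; pose b := 2 * y1 + a1 * x1 + a3.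
pose p := x2 - x1; pose e := xS - x1; pose r := x3 - x1.
pose s := y3 - (y1 + l * (x3 - x1)).
have rU : (n - l) ^+ 2 + a * (n - l) + e - r = xU - x1.
  by rewrite /e /r /a /xU /xS /third_x; ring.
have rcurve : s * (s + a * r + b) = r * (r - p) * (r - e).
  have -> : r * (r - p) * (r - e) = (x3 - x1) * (x3 - x2) * (x3 - xS).
    by rewrite /r /p /e; ring.
  rewrite -(line_cubic x3 h1 c) -(h3 : _ = _) /s /a /b /r; ring.
have rl2 : (l2 - l) * (r - e) = s + a * e + b.
  have -> : r - e = x3 - xS by rewrite /r /e; ring.
  have [c21 _] := c2; rewrite mulrBl -c21 /s /a /b /e /yS; ring.
have rn : (n - l) * (r - p) = s.
  have -> : r - p = x3 - x2 by rewrite /r /p; ring.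
  have [cn1 _] := cn; rewrite mulrBl -cn1 /s e2; ring.
have rk : (k - l) * (xU - x1) =
    - (n - l) * (xU - x1 - p) - a * (xU - x1) - b.
  have [ck1 _] := ck; rewrite mulrBl -ck1 /yU /p /a /b e2; ring.
have [||||Ex Ey] := generic_line_identity nline _ _ rcurve rl2 rn _ _ (k := k
  - l).
- by rewrite subr_eq0; apply: contra n3S => /eqP re;
  rewrite -subr_eq0 -(subrr e) -{1}re /r /e; apply/eqP; ring.
- by rewrite subr_eq0; apply: contra n32 => /eqP rp;
  rewrite -subr_eq0 -(subrr p) -{1}rp /r /p; apply/eqP; ring.
- by rewrite rU subr_eq0 eq_sym.
- by rewrite rU.
have EX : third_x l2 xS x3 = third_x k x1 xU.
  have -> : third_x l2 xS x3 = (l2 - l) ^+ 2 + a * (l2 - l) + p - r + x1.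
    by rewrite /a /p /r /xS /third_x; ring.
  by rewrite Ex rU /a /p /e /xS /third_x; ring.
congr Some; congr pair => //.
rewrite -Ex in Ey; set X0 := (l2 - l) ^+ 2 + _ + p - r in Ex Ey.
have -> : third_x l2 xS x3 = X0 + x1.
  by rewrite /X0 /a /p /r /xS /third_x; ring.
have Ek : third_x k x1 xU = X0 + x1 by rewrite -EX /X0 /a /p /r /xS /third_x;
  ring.
have -> : yS = y3 - l2 * (x3 - xS) by case: c2 => <- _; ring.
rewrite Ek; transitivity (y1 + l * X0 + (k - l) * X0); last by ring.
by rewrite -Ey /r; ring.
Qed.

End WeierstrassLaw.

(** * The group of points of an elliptic curve *)

Record ellcurve (F : fieldType) :=
  EllCurve { ec_eqn :> weierstrass F; ec_elliptic : elliptic ec_eqn }.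

Record epoint (F : fieldType) (C : ellcurve F) :=
  EPoint { epval :> pt F; epointP : epval \in points C }.

HB.instance Definition _ (F : fieldType) (C : ellcurve F) :=
  [isSub for @epval F C].
HB.instance Definition _ (F : fieldType) (C : ellcurve F) :=
  [Choice of epoint C by <:].

Section EllipticGroup.
Variables (F : fieldType) (C : ellcurve F).
Implicit Types P Q R : epoint C.

Definition ep_add P Q :
  epoint C := EPoint (points_padd (epointP P) (epointP Q)).
Definition ep_opp P : epoint C := EPoint (points_neg (epointP P)).
Definition ep_zero : epoint C := @EPoint F C None isT.

Fact ep_addC : commutative ep_add.
Proof. by move=> P Q; apply/val_inj/paddC_on; apply: epointP. Qed.

Fact ep_add0 : left_id ep_zero ep_add.
Proof. by move=> P; apply/val_inj; exact: padd0l. Qed.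

Fact ep_subrr P : ep_add P (ep_opp P) = ep_zero.
Proof. by apply/val_inj; exact: padd_negr. Qed.

Fact ep_addA : associative ep_add.
Proof.
apply: (@assoc_of_generic _ _ ep_opp ep_zero).
- exact: ep_addC.
- exact: ep_add0.
- by move=> P; apply/val_inj; exact: pnegK.
- exact: ep_subrr.
- by move=> P Q; apply/val_inj; apply: padd_oppD; apply: epointP.
- by move=> P Q; apply/val_inj; apply: paddK_on (ec_elliptic C) _ _ _ _;
  apply: epointP.
move=> P Q R h1 h2 h3; apply/val_inj.
by apply: padd_assoc_generic => //; apply: epointP.
Qed.

Fact ep_addN : left_inverse ep_zero ep_opp ep_add.
Proof. by move=> P; rewrite ep_addC ep_subrr. Qed.

HB.instance Definition _ := GRing.isZmodule.Build (epoint C)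
  ep_addA ep_addC ep_add0 ep_addN.

Lemma epval_inj : injective (@epval F C). Proof. exact: val_inj. Qed.

Lemma epvalD P Q : epval (P + Q) = padd C P Q. Proof. by []. Qed.

Lemma epvalN P : epval (- P) = pneg C P. Proof. by []. Qed.

Lemma epvalMn P n : epval (P *+ n) = pmul C n P.
Proof. by elim: n => //= n IHn; rewrite mulrS epvalD IHn. Qed.

Lemma epoint_same_x P Q x y y' :
  epval P = Some (x, y) -> epval Q = Some (x, y') -> P = Q \/ P = - Q.
Proof.
move=> eP eQ; have := epointP P; have := epointP Q; rewrite eP eQ.
move=> /oncurveP hQ /oncurveP hP.
have [nPQ|nPQ] := eqVneq (epval P) (epval Q); [left|right];
  apply: epval_inj => //.
rewrite epvalN; apply/eqP; apply: contraTT isT => nPQ'.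
by move: nPQ nPQ'; rewrite eP eQ => n1 n2; have := pneg_eqP hP hQ n1 n2;
  rewrite eqxx.
Qed.
End EllipticGroup.

(** * Base change *)

Section BaseChange.
Variables (F L : fieldType) (f : {rmorphism F -> L}).

Lemma elliptic_map (E : weierstrass F) :
  elliptic (map_weierstrass f E) = elliptic E.
Proof.
case: E => a1 a2 a3 a4 a6; rewrite /elliptic /wdisc /map_weierstrass /=.
rewrite -(fmorph_eq0 f); congr (~~ (_ == 0)).
by ring.
Qed.

Lemma points_map (E : weierstrass F) P : P \in points E ->
  map_pt f P \in points (map_weierstrass f E).
Proof.
case: P => [[x y]|] // /oncurveP h; apply/oncurveP; rewrite /oncurve /=.
by rewrite -!(rmorphXn, rmorphM, rmorphD) h.
Qed.

Lemma map_pt_inj : injective (map_pt f).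
Proof.
case=> [[x y]|] [[x' y']|] //= [/fmorph_inj-> /fmorph_inj->] //.
Qed.

Lemma map_padd (E : weierstrass F) P Q :
  map_pt f (padd E P Q) =
  padd (map_weierstrass f E) (map_pt f P) (map_pt f Q).
Proof.
case: P Q => [[x1 y1]|] [[x2 y2]|]; rewrite ?padd0l ?padd0r //.
rewrite !padd_affine /= -!(rmorphM, rmorphD) (fmorph_eq0 f) (fmorph_eq f).
case: ifP => // _; rewrite /chord_sum /third_x /=.
by case: ifP => _; congr Some; congr pair;
  rewrite !(rmorph_nat, rmorphXn, fmorphV, rmorphB, rmorphN, rmorphD, rmorphM).
Qed.

(** The target curve is a parameter, so that both curves of a family can be
    given by the same formula rather than by literal images of coefficients. *)
Section EMap.
Variables (C : ellcurve F) (D : ellcurve L) (CD : map_weierstrass f C = D).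

Fact ep_map_subproof (P : epoint C) : map_pt f P \in points D.
Proof. by rewrite -CD; apply/points_map/epointP. Qed.

Definition ep_map (P : epoint C) : epoint D := EPoint (ep_map_subproof P).

Fact ep_map_is_zmod_morphism : zmod_morphism ep_map.
Proof.
move=> P Q; apply/val_inj => /=; rewrite map_padd CD; congr padd.
by case: (epval Q) => [[x y]|] //=; rewrite -CD /= !(rmorphB, rmorphN, rmorphM).
Qed.
HB.instance Definition _ :=
  GRing.isZmodMorphism.Build (epoint C) (epoint D) ep_map
    ep_map_is_zmod_morphism.

Lemma ep_map_inj : injective ep_map.
Proof. by move=> P Q /(congr1 val) /= /map_pt_inj /val_inj. Qed.
End EMap.
End BaseChange.

(** * The isogeny with kernel generated by (0, 0) *)

Definition tri (F : fieldType) (a c : F) := Weierstrass a 0 c 0 0.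
Definition vel (F : fieldType) (a c : F) :=
  Weierstrass a 0 c (- (5 * a * c)) (- (a ^+ 3 * c + 7 * c ^+ 2)).

Section VeluIdentities.
Variables (F : fieldType) (a c : F).
Implicit Types x y l m : F.

Definition velu_x x := x + a * c / x + c ^+ 2 / x ^+ 2.
Definition velu_y x y := y - c ^+ 2 * (2 * y + a * x + c) / x ^+ 3
  - a * c * (a * x + y) / x ^+ 2 - a * c ^+ 2 / x ^+ 2.

Lemma oncurve_tri x y :
  oncurve (tri a c) x y <-> y * (y + a * x + c) = x ^+ 3.
Proof.
rewrite /oncurve /= !mul0r !addr0.
suff -> : y ^+ 2 + a * x * y + c * y = y * (y + a * x + c) by [].
by ring.
Qed.

Lemma oncurve_vel x y : oncurve (vel a c) x y <->
  y * (y + a * x + c) = x ^+ 3 - 5 * a * c * x - (a ^+ 3 * c + 7 * c ^+ 2).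
Proof.
rewrite /oncurve /= mul0r addr0 mulNr.
suff -> : y ^+ 2 + a * x * y + c * y = y * (y + a * x + c) by [].
by ring.
Qed.

Lemma velu_oncurve x y : x != 0 -> y != 0 ->
  oncurve (tri a c) x y -> oncurve (vel a c) (velu_x x) (velu_y x y).
Proof.
move=> nx ny /oncurve_tri h; apply/oncurve_vel.
rewrite /velu_y /velu_x.
have -> : c = x ^+ 3 / y - y - a * x by rewrite -h; field.
by field; rewrite nx ny.
Qed.

(** The image of the line [y = l x + m] is the line [Y = L X + M] with the
    slope and intercept below, where [m (m + c)] is the product of the abscissas
    of the three points of the line. *)
Definition velu_slope l m := l + (l * c ^+ 2 - m * a * c) / (m * (m + c)).
Definition velu_icpt l m :=
  m - (c ^+ 2 * (2 * m + c) + (l * c ^+ 2 - m * a * c) * (l ^+ 2 + a * l))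
      / (m * (m + c)).

Lemma velu_line l m x : x != 0 -> m * (m + c) != 0 ->
  oncurve (tri a c) x (l * x + m) ->
  velu_y x (l * x + m) = velu_slope l m * velu_x x + velu_icpt l m.
Proof.
move=> nx D0 /oncurve_tri h.
pose N := l * c ^+ 2 - m * a * c; pose D := m * (m + c).
apply: (mulIf (mulf_neq0 (expf_neq0 3 nx) D0)).
have E : x ^+ 3 - (l * x + m) * (l * x + m + a * x + c) = 0 by rewrite h subrr.
apply/eqP; rewrite -subr_eq0; apply/eqP.
transitivity ((x ^+ 3 - (l * x + m) * (l * x + m + a * x + c)) *
   (c ^+ 2 * (2 * m + c) - N * x)); last by rewrite E mul0r.
rewrite /velu_slope /velu_icpt /velu_y /velu_x /N.
move: D0; rewrite mulf_eq0 negb_or => /andP[m0 mc0].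
by field; rewrite m0 mc0 nx.
Qed.

(** With [velu_vieta2]: if [x1], [x2], [x3] are the abscissas of the points of a
    line on the source, their images satisfy Vieta's relations for the image
    line on the target. *)
Lemma velu_vieta1 l m x1 x2 x3 : x1 != 0 -> x2 != 0 -> x3 != 0 ->
  x1 + x2 + x3 = l ^+ 2 + a * l ->
  x1 * x2 + x1 * x3 + x2 * x3 = - (2 * l * m + a * m + c * l) ->
  x1 * x2 * x3 = m * (m + c) ->
  velu_x x1 + velu_x x2 + velu_x x3 = velu_slope l m ^+ 2 + a * velu_slope l m.
Proof.
move=> n1 n2 n3 h1 h2 h3.
have D0 : m * (m + c) != 0 by rewrite -h3 !mulf_neq0.
transitivity ((x1 + x2 + x3)
  + a * c * ((x1 * x2 + x1 * x3 + x2 * x3) / (x1 * x2 * x3))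
  + c ^+ 2 * ((x1 * x2 + x1 * x3 + x2 * x3) ^+ 2
    - 2 * (x1 + x2 + x3) * (x1 * x2 * x3)) / (x1 * x2 * x3) ^+ 2).
  by rewrite /velu_x; field; rewrite n1 n2 n3.
move: D0; rewrite h1 h2 h3 /velu_slope mulf_eq0 negb_or => /andP[m0 mc0].
by field; rewrite m0 mc0.
Qed.

Lemma velu_vieta2 l m x1 x2 x3 : x1 != 0 -> x2 != 0 -> x3 != 0 ->
  x1 + x2 + x3 = l ^+ 2 + a * l ->
  x1 * x2 + x1 * x3 + x2 * x3 = - (2 * l * m + a * m + c * l) ->
  x1 * x2 * x3 = m * (m + c) ->
  let X1 := velu_x x1 in let X2 := velu_x x2 in let X3 := velu_x x3 in
  let L := velu_slope l m in let M := velu_icpt l m in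
  X1 * X2 + X1 * X3 + X2 * X3 = - (5 * a * c + 2 * L * M + a * M + c * L).
Proof.
move=> n1 n2 n3 h1 h2 h3 X1 X2 X3 L M.
have D0 : m * (m + c) != 0 by rewrite -h3 !mulf_neq0.
pose e1 := x1 + x2 + x3; pose e2 := x1 * x2 + x1 * x3 + x2 * x3.
pose e3 := x1 * x2 * x3.
transitivity (e2 + a * c * (e1 * e2 / e3 - 3)
  + c ^+ 2 * (e1 * (e2 ^+ 2 - 2 * e1 * e3) / e3 ^+ 2 - e2 / e3)
  + (a * c) ^+ 2 * e1 / e3 + a * c ^+ 3 * (e1 * e2 / e3 ^+ 2 - 3 / e3)
  + c ^+ 4 * (e1 ^+ 2 / e3 ^+ 2 - 2 * e2 / e3 ^+ 2)).
  by rewrite /X1 /X2 /X3 /velu_x /e1 /e2 /e3; field; rewrite n1 n2 n3.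
move: D0; rewrite /e1 /e2 /e3 h1 h2 h3 /L /M /velu_slope /velu_icpt.
rewrite mulf_eq0 negb_or => /andP[m0 mc0].
by field; rewrite m0 mc0.
Qed.
End VeluIdentities.

Definition velu_pt (F : fieldType) (a c : F) (P : pt F) : pt F :=
  if P is Some (x, y) then
    if x == 0 then None else Some (velu_x a c x, velu_y a c x y)
  else None.

Section ThreeIsogeny.
Variables (F : fieldType) (a c : F).

Lemma elliptic_tri : elliptic (tri a c) = (c != 0) && (a ^+ 3 - 27 * c != 0).
Proof.
rewrite /elliptic; have -> : wdisc (tri a c) = c ^+ 3 * (a ^+ 3 - 27 * c).
  by rewrite /wdisc /tri; ring.
by rewrite mulf_eq0 expf_eq0 /= negb_or.
Qed.

Lemma elliptic_vel : elliptic (vel a c) = elliptic (tri a c).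
Proof.
rewrite elliptic_tri /elliptic.
have -> : wdisc (vel a c) = c * (a ^+ 3 - 27 * c) ^+ 3.
  by rewrite /wdisc /vel; ring.
by rewrite mulf_eq0 expf_eq0 /= negb_or.
Qed.

Hypothesis ell : elliptic (tri a c).

Let c0 : c != 0. Proof. by move: ell; rewrite elliptic_tri => /andP[]. Qed.

Definition triC := EllCurve ell.
Definition velC := @EllCurve F (vel a c) (etrans elliptic_vel ell).
Implicit Types P Q R : epoint triC.

Lemma tri_neq0 x y : x != 0 -> oncurve (tri a c) x y ->
  y != 0 /\ y + a * x + c != 0.
Proof.
move=> nx /oncurve_tri h; have : x ^+ 3 != 0 by rewrite expf_neq0.
by rewrite -h mulf_eq0 negb_or => /andP[].
Qed.

Lemma velu_points P : velu_pt a c P \in points (vel a c).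
Proof.
case: P => [[[x y]|]] //= /oncurveP h; case: eqVneq => // nx.
by have [ny _] := tri_neq0 nx h; apply/oncurveP; apply: velu_oncurve.
Qed.

Definition phi P : epoint velC := @EPoint F velC _ (velu_points P).

Lemma phi_val P : epval (phi P) = velu_pt a c (epval P). Proof. by []. Qed.

Lemma velu_ptE x y : x != 0 ->
  velu_pt a c (Some (x, y)) = Some (velu_x a c x, velu_y a c x y).
Proof. by move=> nx; rewrite /= (negPf nx). Qed.

Fact T3_points : Some (0, 0) \in points (tri a c).
Proof. by apply/oncurveP/oncurve_tri; rewrite mul0r expr0n. Qed.

Definition T3 : epoint triC := @EPoint F triC _ T3_points.

Lemma epvalNT3 : epval (- T3) = Some (0, - c).
Proof. by rewrite epvalN /=; congr Some; congr pair; ring. Qed.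

Lemma T3_double : T3 + T3 = - T3.
Proof.
apply/val_inj; rewrite [LHS]/= [RHS]epvalNT3 /= !eqxx !mulr0 !addr0 !add0r /=.
rewrite (negPf c0).
by congr Some; congr pair; ring.
Qed.

Lemma T3_triple : T3 *+ 3 = 0.
Proof. by rewrite mulrS mulr2n T3_double subrr. Qed.

Lemma T3_neq0 : T3 != 0. Proof. by []. Qed.

Lemma x0_T3 P y : epval P = Some (0, y) -> P = T3 \/ P = - T3.
Proof.
move=> eP; have := epointP P; rewrite eP => /oncurveP /oncurve_tri /eqP.
rewrite mulr0 addr0 expr0n mulf_eq0 => /orP[] /eqP hy; [left|right].
  by apply/val_inj; rewrite /= eP hy.
apply/val_inj; rewrite [RHS]epvalNT3 /= eP; congr Some; congr pair.
by apply/eqP; rewrite -subr_eq0 opprK hy.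
Qed.

Lemma addT3 P x y : epval P = Some (x, y) -> x != 0 ->
  epval (P + T3) = Some (- c * y / x ^+ 2, - c ^+ 2 * y / x ^+ 3).
Proof.
move=> eP nx; have := epointP P; rewrite eP => /oncurveP h.
have [ny _] := tri_neq0 nx h; have hT := oncurveP _ _ _ T3_points.
rewrite epvalD eP; have ht := (iffLR (oncurve_tri a c x y) h).
have ec : c = x ^+ 3 / y - y - a * x by rewrite -ht; field.
rewrite [epval T3]/= (@padd_chord F (tri a c) (y / x)) ?nx //.
  rewrite chord_sumE /third_x /=; congr Some; congr pair; rewrite ec; field;
    by rewrite nx ny.
by split; rewrite /= ?ec; field; rewrite ?nx ?ny.
Qed.

Lemma subT3 P x y : epval P = Some (x, y) -> x != 0 ->
  epval (P - T3) = Some (c * x / y, - c * x ^+ 3 / y ^+ 2).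
Proof.
move=> eP nx; have := epointP P; rewrite eP => /oncurveP h.
have [ny _] := tri_neq0 nx h; have ht := (iffLR (oncurve_tri a c x y) h).
have ec : c = x ^+ 3 / y - y - a * x by rewrite -ht; field.
have -> : P - T3 = - (- P + T3) by rewrite opprD opprK.
have eN : epval (- P) = Some (x, - y - a * x - c) by rewrite epvalN eP.
rewrite epvalN (addT3 eN nx) /=; congr Some; congr pair; rewrite ec; field;
  by rewrite nx ny.
Qed.

Lemma phiN P : phi (- P) = - phi P.
Proof.
apply/val_inj; rewrite [LHS]/= [RHS]/=.
case: P => [[[x y]|]] //= _; case: eqVneq => //= nx; congr Some; congr pair.
by rewrite /velu_y /velu_x; field.
Qed.

Lemma phi0 : phi 0 = 0. Proof. exact/val_inj. Qed.

Lemma phiT : phi T3 = 0. Proof. by apply/val_inj; rewrite /= eqxx. Qed.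

Lemma phi_eq0 P : phi P = 0 -> [\/ P = 0, P = T3 | P = - T3].
Proof.
move=> /(congr1 val) /=; case eP: (epval P) => [[x y]|] /=; last first.
  by move=> _; constructor 1; apply/val_inj.
case: eqVneq => // x0 _; move: eP; rewrite x0 => /x0_T3[->|->].
  by constructor 2.
by constructor 3.
Qed.

Lemma phi_addT P : phi (P + T3) = phi P.
Proof.
case eP: (epval P) => [[x y]|]; last first.
  have -> : P = 0 by apply/val_inj.
  by rewrite add0r phi0 phiT.
have [x0|nx] := eqVneq x 0.
  move: eP; rewrite x0 => /x0_T3[->|->];
    last by rewrite addNr phiN phiT phi0 oppr0.
  by rewrite T3_double phiN phiT oppr0.
have := epointP P; rewrite eP => /oncurveP h.
have [ny _] := tri_neq0 nx h; have ht := (iffLR (oncurve_tri a c x y) h).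
apply: epval_inj; rewrite !phi_val (addT3 eP nx) eP /=.
rewrite !mulf_eq0 invr_eq0 expf_eq0 oppr_eq0 (negPf c0) (negPf ny) (negPf nx)
  /=.
have ec : c = x ^+ 3 / y - y - a * x by rewrite -ht; field.
have nc : x ^+ 3 - y ^+ 2 - a * x * y != 0.
  by rewrite (_ : _ - _ = y * c) ?mulf_neq0 // ec; field.
congr Some; congr pair; rewrite /velu_y /velu_x ec; field.
  by rewrite nx ny (_ : _ + _ = x ^+ 3 - y ^+ 2 - a * x * y) ?oppr_eq0 ?nc //;
    ring.
by rewrite nx ny (_ : _ + _ = x ^+ 3 - y ^+ 2 - a * x * y) ?oppr_eq0 ?nc //;
  ring.
Qed.

Lemma phi_addTn P n : phi (P + T3 *+ n) = phi P.
Proof.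
elim: n => [|n IHn]; first by rewrite addr0.
by rewrite mulrSr addrA phi_addT.
Qed.

Lemma T3n_cases n : [\/ T3 *+ n = 0, T3 *+ n = T3 | T3 *+ n = - T3].
Proof.
elim: n => [|n]; first by constructor 1.
rewrite mulrS => -[] ->; first by rewrite addr0; constructor 2.
  by rewrite T3_double; constructor 3.
by rewrite subrr; constructor 1.
Qed.

Lemma NT3n n : - (T3 *+ n) = T3 *+ (n + n).
Proof.
rewrite mulrnDr -mulrnDl T3_double.
by rewrite mulNrn.
Qed.

Lemma phi_eq0n P : phi P = 0 -> exists n, P = T3 *+ n.
Proof.
case/phi_eq0 => ->; [by exists 0|by exists 1|exists 2].
by rewrite mulr2n T3_double.
Qed.

(** Up to the factor [- c ^+ 2], the value of [2 y + a x + c] at a point of the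
    target is the product of its values at the three points of the fibre; so
    the 2-torsion points of the target come from those of the source. *)
Lemma velu_two_torsion x y : x != 0 -> oncurve (tri a c) x y ->
  let: (x1, y1) := (- c * y / x ^+ 2, - c ^+ 2 * y / x ^+ 3) in
  let: (x2, y2) := (c * x / y, - c * x ^+ 3 / y ^+ 2) in
  - c ^+ 2 * (2 * velu_y a c x y + a * velu_x a c x + c) =
  (2 * y + a * x + c) * (2 * y1 + a * x1 + c) * (2 * y2 + a * x2 + c).
Proof.
move=> nx h; have [ny _] := tri_neq0 nx h.
have ht := (iffLR (oncurve_tri a c x y) h).
have ec : c = x ^+ 3 / y - y - a * x by rewrite -ht; field.
by rewrite /velu_y /velu_x ec; field; rewrite nx ny.
Qed.

Lemma two_torsionP P x y : epval P = Some (x, y) ->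
  2 * y + a * x + c = 0 -> - P = P.
Proof.
move=> eP h; apply: epval_inj; rewrite epvalN eP /=; congr Some; congr pair.
by rewrite -[LHS]addr0 -h; ring.
Qed.

(** The three roots are the abscissas of [P], [P + T3] and [P - T3]. *)
Lemma velu_x_fibre x y z : x != 0 -> z != 0 -> oncurve (tri a c) x y ->
  velu_x a c z = velu_x a c x ->
  [\/ z = x, z = - c * y / x ^+ 2 | z = c * x / y].
Proof.
move=> nx nz h hX; have [ny _] := tri_neq0 nx h.
have ht := (iffLR (oncurve_tri a c x y) h).
have ec : c = x ^+ 3 / y - y - a * x by rewrite -ht; field.
have : (z - x) * (z - (- c * y / x ^+ 2)) * (z - c * x / y) = 0.
  have -> : 0 = z ^+ 2 * (velu_x a c z - velu_x a c x)
    by rewrite hX subrr mulr0.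
  by rewrite /velu_x ec; field; rewrite nx ny nz.
move/eqP; rewrite !mulf_eq0 !subr_eq0 => /orP[/orP[]|] /eqP ->.
- by constructor 1.
- by constructor 2.
by constructor 3.
Qed.

(** By [velu_x_fibre], [P] is [Q + T3 *+ m] up to sign.  The wrong sign makes
    the common image a 2-torsion point; then [velu_two_torsion] finds a
    2-torsion point in the fibre, and the sign can be absorbed by a
    multiple of [T3]. *)
Lemma phi_fibre P Q : phi P = phi Q -> exists n, P = Q + T3 *+ n.
Proof.
case eQ: (epval Q) => [[x y]|]; last first.
  have -> : Q = 0 by apply: epval_inj.
  by rewrite phi0 => /phi_eq0n[n ->]; exists n; rewrite add0r.
have [x0|nx] := eqVneq x 0.
  have [m ->] : exists m, Q = T3 *+ m.
    apply: phi_eq0n; apply: epval_inj; rewrite phi_val eQ /= x0 eqxx //.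
  rewrite -[T3 *+ m]add0r phi_addTn phi0 => /phi_eq0n[n ->].
  by exists (m + m + n)%N; rewrite add0r mulrnDr -NT3n addrA subrr add0r.
case eP: (epval P) => [[z w]|]; last first.
  by move=> /(congr1 (@epval _ _)); rewrite !phi_val eP eQ /= (negPf nx).
have [z0|nz] := eqVneq z 0.
  move=> /(congr1 (@epval _ _)); rewrite !phi_val eP eQ /= (negPf nx).
  by rewrite z0 eqxx.
move=> hphi; have := congr1 (@epval _ _) hphi.
rewrite !phi_val eP eQ /= (negPf nx) (negPf nz) => -[hX _].
have := epointP Q; rewrite eQ => /oncurveP hQ.
have eQT := addT3 eQ nx; have eQT' := subT3 eQ nx.
have [m] : exists m, P = Q + T3 *+ m \/ P = - (Q + T3 *+ m).
  case: (velu_x_fibre nx nz hQ hX) => ez; move: eP; rewrite ez => eP.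
  - by exists 0; rewrite addr0; apply: epoint_same_x eP eQ.
  - by exists 1; apply: epoint_same_x eP eQT.
  - by exists 2; rewrite mulr2n T3_double; apply: epoint_same_x eP eQT'.
case=> ePm; first by exists m.
have : - phi Q = phi Q by rewrite -[RHS]hphi ePm phiN phi_addTn.
move=> /(congr1 (@epval _ _)); rewrite epvalN phi_val eQ /= (negPf nx) => -[eY].
have := velu_two_torsion nx hQ.
set Y := velu_y _ _ _ _ in eY *; set X := velu_x _ _ _ in eY *.
have -> : 2 * Y + a * X + c = 0.
  by rewrite (_ : 2 * Y = Y + Y); [rewrite -{1}eY; ring|ring].
rewrite mulr0 => /esym/eqP; rewrite !mulf_eq0 -orbA => /or3P h2.
have [k] : exists k, - (Q + T3 *+ k) = Q + T3 *+ k.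
  case: h2 => /eqP; [move/(two_torsionP eQ)|move/(two_torsionP
    eQT)|move/(two_torsionP eQT')] => e.
  - by exists 0; rewrite addr0.
  - by exists 1.
  - by exists 2; rewrite mulr2n T3_double.
rewrite opprD => /(canRL (subrK _)); rewrite -addrA -mulrnDr => eN.
exists (k + k + (m + m))%N.
by rewrite ePm opprD eN NT3n -addrA -mulrnDr.
Qed.

(** The images of three collinear points lie on a line by [velu_line].  When two
    of these images coincide, that the line is the tangent there follows from
    Vieta's relations, which supply the second equation of [chord]. *)
Lemma phi_additive P Q : phi (P + Q) = phi P + phi Q.
Proof.
case eP: (epval P) => [[x1 y1]|]; last first.
  have -> : P = 0 by apply: epval_inj.
  by rewrite phi0 !add0r.
case eQ: (epval Q) => [[x2 y2]|]; last first.
  have -> : Q = 0 by apply: epval_inj.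
  by rewrite phi0 !addr0.
have [x10|n1] := eqVneq x1 0.
  have [n ->] : exists n, P = T3 *+ n.
    by apply: phi_eq0n; apply: epval_inj; rewrite phi_val eP /= x10 eqxx.
  by rewrite addrC phi_addTn -[T3 *+ n]add0r phi_addTn phi0 add0r.
have [x20|n2] := eqVneq x2 0.
  have [n ->] : exists n, Q = T3 *+ n.
    by apply: phi_eq0n; apply: epval_inj; rewrite phi_val eQ /= x20 eqxx.
  by rewrite phi_addTn -[T3 *+ n]add0r phi_addTn phi0 addr0.
have phiTn n : phi (T3 *+ n) = 0 by rewrite -[T3 *+ n]add0r phi_addTn phi0.
have [hopp|nopp] := eqVneq (phi P) (- phi Q).
  have [n ->] : exists n, P = - Q + T3 *+ n by apply: phi_fibre; rewrite phiN.
  by rewrite addrAC addNr add0r phi_addTn phiN phiTn addNr.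
have nR : phi (P + Q) != 0.
  apply: contra_neq nopp => /phi_eq0n[n /(canRL (addrK _)) ->].
  by rewrite addrC phi_addTn phiN.
have := epointP P; have := epointP Q; rewrite eP eQ.
move=> /oncurveP h2 /oncurveP h1.
case eR: (epval (P + Q)) nR => [[x3 y3]|]; last first.
  by have -> : P + Q = 0 by [apply: epval_inj]; rewrite phi0 eqxx.
move=> nR; have n3 : x3 != 0.
  by apply: contra_neq nR => x30; apply: epval_inj;
    rewrite phi_val eR /= x30 eqxx.
apply: epval_inj; rewrite epvalD !phi_val eR eP eQ !velu_ptE //.
have := nopp; rewrite -(inj_eq (@epval_inj _ _)) epvalN !phi_val eP eQ.
rewrite !velu_ptE // => nopp'.
move: eR; rewrite epvalD eP eQ; case: paddP => // l cc hn.
rewrite chord_sumE /= => -[ex3 ey3].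
have [c1 c2] := cc; set m := y1 - l * x1.
have ey1 : y1 = l * x1 + m by rewrite /m; ring.
have ey2 : y2 = l * x2 + m by rewrite /m -[y2](subrK y1) c1; ring.
have h3 : oncurve triC x3 (l * x3 + m).
  have := chord_third h1 cc; rewrite /= ex3.
  by have -> : y1 + l * (x3 - x1) = l * x3 + m by rewrite /m; ring.
have e1 : x1 + x2 + x3 = l ^+ 2 + a * l by rewrite -ex3 /third_x /=; ring.
have e2 : x1 * x2 + x1 * x3 + x2 * x3 = - (2 * l * m + a * m + c * l).
  have e3' : x3 = l ^+ 2 + a * l - x1 - x2 by rewrite -e1; ring.
  rewrite e3'; move: c2 => /= c2.
  have c2' : x1 ^+ 2 + x1 * x2 + x2 ^+ 2 = l * (y1 + y2 + a * x2 + c) + a * y1.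
    by rewrite c2; ring.
  transitivity ((x1 + x2) * (l ^+ 2 + a * l) - (x1 ^+ 2 + x1 * x2 + x2 ^+ 2)).
    by ring.
  by rewrite c2' ey1 ey2; ring.
have e3 : x1 * x2 * x3 = m * (m + c).
  have := line_cubic 0 h1 cc; rewrite /= -/(third_x _ _ _ _) ex3 => H.
  apply: oppr_inj; transitivity ((0 - x1) * (0 - x2) * (0 - x3)); first by ring.
  by rewrite -H /m; ring.
have D0 : m * (m + c) != 0 by rewrite -e3 !mulf_neq0.
have g1 : oncurve (vel a c) (velu_x a c x1) (velu_y a c x1 y1).
  by apply: velu_oncurve => //; case: (tri_neq0 n1 h1).
have g2 : oncurve (vel a c) (velu_x a c x2) (velu_y a c x2 y2).
  by apply: velu_oncurve => //; case: (tri_neq0 n2 h2).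
set L := velu_slope a c l m; pose M := velu_icpt a c l m.
have lP : velu_y a c x1 y1 = L * velu_x a c x1 + M.
  by rewrite ey1; apply: velu_line => //; rewrite -ey1.
have lQ : velu_y a c x2 y2 = L * velu_x a c x2 + M.
  by rewrite ey2; apply: velu_line => //; rewrite -ey2.
have lR : velu_y a c x3 (l * x3 + m) = L * velu_x a c x3 + M.
  exact: velu_line.
have E1 := velu_vieta1 n1 n2 n3 e1 e2 e3.
have E2 := velu_vieta2 n1 n2 n3 e1 e2 e3.
rewrite /= -/L -/M in E1 E2.
have E3 : third_x (vel a c) L (velu_x a c x1) (velu_x a c x2) = velu_x a c x3.
  by rewrite /third_x /= -E1; ring.
have cL : chord (vel a c) L (velu_x a c x1) (velu_y a c x1 y1)
    (velu_x a c x2) (velu_y a c x2 y2).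
  split; first by rewrite lP lQ; ring.
  have EQ : velu_x a c x1 ^+ 2 + velu_x a c x1 * velu_x a c x2
      + velu_x a c x2 ^+ 2 = (velu_x a c x1 + velu_x a c x2) * (L ^+ 2 + a * L)
      + (5 * a * c + 2 * L * M + a * M + c * L).
    by rewrite -E1 -[X in _ = _ + X]opprK -E2; ring.
  by rewrite EQ lP lQ /=; ring.
rewrite [RHS](padd_chord g1 g2 cL); last first.
  have [eX /=|//] := eqVneq (velu_x a c x1).
  apply: contraNneq nopp' => e; rewrite /= eX; apply/eqP.
  congr Some; congr pair; rewrite -[RHS]addr0 -e; ring.
rewrite chord_sumE E3 /=; congr Some; congr pair.
have -> : velu_y a c x1 y1 + L * (velu_x a c x3 - velu_x a c x1)
    = L * velu_x a c x3 + M by rewrite lP; ring.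
rewrite -lR -ey3 ex3; have -> : y1 + l * (x3 - x1) = l * x3 + m.
  by rewrite /m; ring.
by rewrite /velu_y /velu_x; field.
Qed.

HB.instance Definition _ := GRing.isNmodMorphism.Build _ _ phi (conj phi0
  phi_additive).
End ThreeIsogeny.

Lemma map_velu_pt (F L : fieldType) (f : {rmorphism F -> L}) a c P :
  map_pt f (velu_pt a c P) = velu_pt (f a) (f c) (map_pt f P).
Proof.
case: P => [[x y]|] //=; rewrite (fmorph_eq0 f); case: eqVneq => //= nx.
rewrite /velu_x /velu_y; congr Some; congr pair;
  by rewrite !(rmorph_nat, rmorphXn, fmorphV, rmorphB, rmorphN, rmorphD,
    rmorphM).
Qed.

Lemma map_tri (F L : fieldType) (f : {rmorphism F -> L}) a c :
  map_weierstrass f (tri a c) = tri (f a) (f c).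
Proof. by rewrite /map_weierstrass /= rmorph0. Qed.

Lemma map_vel (F L : fieldType) (f : {rmorphism F -> L}) a c :
  map_weierstrass f (vel a c) = vel (f a) (f c).
Proof.
rewrite /map_weierstrass /= rmorph0 /vel.
by rewrite !(rmorph_nat, rmorphXn, rmorphN, rmorphD, rmorphM).
Qed.

(** The abscissa [z] of a preimage is a root of
    [z ^ 3 - X z ^ 2 + a c z + c ^ 2]; a point with this abscissa is then sent
    to the given point or to its opposite. *)
Lemma phi_surjective (F : closedFieldType) (a c : F) (ell : elliptic (tri a c))
  (S : epoint (velC ell)) : exists R : epoint (triC ell), phi R = S.
Proof.
case eS: (epval S) => [[X Y]|]; last first.
  by exists 0; rewrite phi0; apply: epval_inj.
have [c0 _] := andP (etrans (esym (elliptic_tri a c)) ell).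
have [z] := @GRing.solve_monicpoly F 3 (nth 0 [:: - c ^+ 2; - (a * c); X]) isT.
rewrite !big_ord_recl big_ord0 /= => hz.
have nz : z != 0.
  apply: contra_neq c0 => z0; move: hz;
    rewrite z0 !expr0n /= !mulr0 mulr1 !addr0.
  by move/esym/eqP; rewrite oppr_eq0 expf_eq0 /= => /eqP.
have hX : velu_x a c z = X.
  apply: (mulIf (expf_neq0 2 nz)); transitivity (z ^+ 3 + a * c * z + c ^+ 2).
    by rewrite /velu_x; field.
  by rewrite hz /bump /=; ring.
have [y] := @GRing.solve_monicpoly F 2 (nth 0 [:: z ^+ 3; - (a * z + c)]) isT.
rewrite !big_ord_recl big_ord0 /= => hy.
have hR : Some (z, y) \in points (triC ell).
  apply/oncurveP/oncurve_tri; transitivity (y ^+ 2 + (a * z + c) * y);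
    first by ring.
  by rewrite hy /bump /=; ring.
pose R : epoint (triC ell) := EPoint hR.
have eR : epval (phi R) = Some (X, velu_y a c z y).
  by rewrite phi_val velu_ptE // hX.
case: (epoint_same_x eR eS) => h; [exists R|exists (- R)] => //.
by rewrite phiN h opprK.
Qed.

(** * Frobenius and the index over a finite field *)

Definition power_map (L : fieldType) (q : nat) of [pchar L].-nat q :=
  fun x : L => x ^+ q.

Section PowerMap.
Variables (L : fieldType) (q : nat) (hq : [pchar L].-nat q).
Fact power_map_is_zmod_morphism : zmod_morphism (power_map hq).
Proof.
move=> x y; rewrite /power_map exprDn_pchar //; congr (_ + _).
apply/eqP; rewrite -subr_eq0 opprK -exprDn_pchar // addNr expr0n.
by case: q hq.
Qed.
Fact power_map_is_monoid_morphism : monoid_morphism (power_map hq).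
Proof. by split=> [|x y]; rewrite /power_map ?expr1n ?exprMn. Qed.
HB.instance Definition _ := GRing.isZmodMorphism.Build L L (power_map hq)
  power_map_is_zmod_morphism.
HB.instance Definition _ := GRing.isMonoidMorphism.Build L L (power_map hq)
  power_map_is_monoid_morphism.
End PowerMap.

Lemma card_pnat_pchar (k : finFieldType) (L : fieldType)
  (iota : {rmorphism k -> L}) : [pchar L].-nat #|k|.
Proof.
have [p p_pr pk] := finPcharP k.
rewrite (card_pprimeChar pk) pnatX; apply/orP; left.
by rewrite pnatE //; apply: rmorph_pchar pk.
Qed.

(** The [#|k|] elements of [k] are all the roots of [X ^ #|k| - X]. *)
Lemma frob_fixed (k : finFieldType) (L : fieldType)
  (iota : {rmorphism k -> L}) x : x ^+ #|k| = x -> exists z, x = iota z.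
Proof.
move=> hx; have := congr1 (fun p => (map_poly iota p).[x]) (finField_genPoly k).
rewrite rmorphB /= map_polyXn map_polyX hornerD hornerN hornerXn hornerX.
rewrite hx subrr rmorph_prod horner_prod => /esym/eqP /prodf_eq0[z _].
rewrite rmorphB /= map_polyX map_polyC hornerXsubC subr_eq0 => /eqP->.
by exists z.
Qed.

Section FrobeniusTranslate.
Variables (k : finFieldType) (L : closedFieldType) (iota : {rmorphism k -> L}).
Local Notation q := #|k|.
Local Notation frob := (power_map (card_pnat_pchar iota)).

Lemma frob_iota z : frob (iota z) = iota z.
Proof. by rewrite /power_map -rmorphXn expf_card. Qed.

Variables (a c : k) (ellL : elliptic (tri (iota a) (iota c))).
Let a' := iota a.
Let c' := iota c.
Local Notation C := (triC ellL).

Fact frob_tri : map_weierstrass frob C = C.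
Proof. by rewrite map_tri /= !frob_iota. Qed.

Fact frob_vel : map_weierstrass frob (velC ellL) = velC ellL.
Proof. by rewrite map_vel /= !frob_iota. Qed.

Let q_gt1 : (1 < q)%N := card_finNzRing_gt1 k.
Let q0 : q%:R = 0 :> L.
Proof.
have [p p_pr pk] := finPcharP k.
have e := card_pprimeChar pk; have := rmorph_pchar iota pk.
rewrite inE => /andP[_ /eqP p0].
have := card_finNzRing_gt1 k; rewrite e.
by case: (logn p q) => [|n _]; rewrite ?expn0 // expnS natrM p0 mul0r.
Qed.
Let c0 : c' != 0.
Proof. by have [] := andP (etrans (esym (elliptic_tri a' c')) ellL). Qed.
Let d0 : a' ^+ 3 - 27 * c' != 0.
Proof. by have [] := andP (etrans (esym (elliptic_tri a' c')) ellL). Qed.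

(** The non-zero roots of this polynomial are the abscissas of the points [R]
    with [x(Frob R) = x(R + T3)]: this equation reads [x ^ q = - c y / x ^ 2],
    and [y] is eliminated with the equation of the curve. *)
Let f : {poly L} := 'X^((q + q).+1) - (a' * c') *: 'X^q - c' ^+ 2 *: 'X^(q.-1)
  - (c' ^+ 2)%:P.

Let size_f : size f = (q + q).+2.
Proof.
rewrite /f -!addrA size_polyDl size_polyXn // -!opprD size_polyN.
apply: leq_ltn_trans (_ : q.+1 < _)%N; last by rewrite ltnS ltnS; move: q_gt1;
  lia.
apply: leq_trans (size_polyD _ _) _; rewrite geq_max.
apply/andP; split.
  by apply: leq_trans (size_scale_leq _ _) _; rewrite size_polyXn.
apply: leq_trans (size_polyD _ _) _; rewrite geq_max.
rewrite (leq_trans (size_polyC_leq1 _)) // andbT.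
by apply: leq_trans (size_scale_leq _ _) _; rewrite size_polyXn; lia.
Qed.

Let f_at x : f.[x] =
  x ^+ (q + q).+1 - a' * c' * x ^+ q - c' ^+ 2 * x ^+ q.-1 - c' ^+ 2.
Proof. by rewrite /f !hornerE. Qed.

Let f'_at x : x * f^`().[x] = x ^+ (q + q).+1 + c' ^+ 2 * x ^+ q.-1.
Proof.
rewrite /f !derivB !derivZ derivC !derivXn subr0 !hornerE.
rewrite !hornerMn !hornerE.
have e0 (y : L) : y *+ q = 0 by rewrite -mulr_natr q0 mulr0.
have e1 (y : L) : y *+ q.-1 = - y.
  by apply: (addrI y); rewrite -mulrS prednK ?e0 ?subrr // ltnW.
rewrite mulrS mulrnDr !e0 e1 !mulr0 subr0 !addr0 mulrN opprK /=.
rewrite mulrDr -exprS; congr (_ + _); rewrite mulrCA -exprS.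
by case: q (q_gt1) => [|[|n]].
Qed.

Let f_neq0 x : root f x -> x != 0.
Proof.
apply: contraTneq => ->; rewrite rootE f_at !expr0n /=.
case: q (q_gt1) => [|[|n]] // _; rewrite !mulr0 !subr0 sub0r oppr_eq0.
by rewrite expf_eq0 (negPf c0).
Qed.

(** A double root is the abscissa of a point with [y = c], and then the
    Frobenius-conjugate equation forces [a ^ 3 = 27 c]. *)
Let f_simple x : root f x -> f^`().[x] != 0.
Proof.
move=> fx; have nx := f_neq0 fx; apply: contraNneq d0 => f'x.
have [w ew] : exists w, w = x ^+ q by exists (x ^+ q).
have nw : w != 0 by rewrite ew expf_neq0.
have xq : x * x ^+ q.-1 = w by rewrite ew -exprS prednK // ltnW.
have e2q : x ^+ (q + q).+1 = x * (w * w) by rewrite ew exprS exprD.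
have := f'_at x; rewrite f'x mulr0; move: fx; rewrite rootE f_at => /eqP.
rewrite -ew e2q; move: xq; move: (x ^+ q.-1) => v xq hf hf'.
have hw : w * x ^+ 2 = - c' ^+ 2.
  apply/(mulfI nw)/eqP; rewrite -subr_eq0; apply/eqP.
  transitivity (x * (x * (w * w) + c' ^+ 2 * v) + c' ^+ 2 * (w - x * v)).
    by ring.
  by rewrite -hf' xq subrr !mulr0 addr0.
have hx : x ^+ 3 = a' * c' * x + 2 * c' ^+ 2.
  have h0 : x ^+ 3 * (x * (w * w) - a' * c' * w - c' ^+ 2 * v - c' ^+ 2) = 0.
    by rewrite hf mulr0.
  apply: (mulfI (expf_neq0 2 c0)); rewrite -[LHS]addr0 -h0.
  transitivity ((w * x ^+ 2) * (w * x ^+ 2) - a' * c' * x * (w * x ^+ 2)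
    - c' ^+ 2 * (x * v * x ^+ 2)); first by ring.
  by rewrite xq !hw; ring.
have hx2 : a' * x = - 3 * c'.
  have := congr1 frob hx; rewrite (rmorphXn frob) (rmorphD frob).
  rewrite !(rmorphM frob) (rmorph_nat frob).
  rewrite /= /a' /c' !frob_iota -/a' -/c' -[frob x]ew => hwq.
  have h6 : x ^+ 6 * (w ^+ 3 - a' * c' * w - 2 * c' ^+ 2) = 0.
    by rewrite hwq; ring.
  have h6' : (w * x ^+ 2) ^+ 3 - a' * c' * (w * x ^+ 2) * (x ^+ 3 * x)
      - 2 * c' ^+ 2 * (x ^+ 3) ^+ 2 = 0 by rewrite -h6; ring.
  have : - c' ^+ 4 * (a' * x + 3 * c') ^+ 2 = 0.
    by rewrite -h6' hw hx; ring.
  move/eqP; rewrite mulf_eq0 oppr_eq0 !expf_eq0 (negPf c0) /= addr_eq0 =>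
    /eqP->.
  by ring.
have hx3 : x ^+ 3 = - c' ^+ 2 by rewrite hx -mulrA mulrCA hx2; ring.
apply/eqP/(mulIf (expf_neq0 3 nx)); rewrite mul0r.
transitivity ((a' * x) ^+ 3 - 27 * c' * x ^+ 3); first by ring.
by rewrite hx2 hx3; ring.
Qed.

Let f_roots : exists2 r : seq L, uniq r & size r = (q + q).+1 /\ all (root f) r.
Proof.
have [r fr] := closed_field_poly_normal f.
have lf : lead_coef f != 0 by rewrite lead_coef_eq0 -size_poly_gt0 size_f.
exists r; last split.
- rewrite -separable_prod_XsubC.
  have : coprimep f f^`().
    by apply: Pdiv.ClosedField.root_coprimep => x; apply: f_simple.
  by rewrite unlock fr derivZ coprimepZl // coprimepZr // -fr.
- by have := size_f; rewrite fr size_scale // size_prod_XsubC; case.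
- by apply/allP => z zr; rewrite fr rootZ // root_prod_XsubC.
Qed.

(** Each root of [f] is the abscissa of a point with [Frob R = R + T3] or
    [Frob R = - (R + T3)].  In the second case [l = y / x] is fixed by
    Frobenius, so lies in [k], and [x] is a root of the quadratic polynomial cut
    out on the curve by the line [y = l x]. *)
Lemma exists_frob_translate :
  exists R : epoint C, ep_map frob_tri R = R + T3 ellL.
Proof.
apply: contrapT => noR.
have [r r_uniq [r_size /allP r_root]] := f_roots.
pose g := \prod_(w : k) ('X^2 - (iota w ^+ 2 + a' * iota w) *:
  'X - (c' * iota w)%:P).
have g_size (w : k) :
    size ('X^2 - (iota w ^+ 2 + a' * iota w) *: 'X - (c' * iota w)%:P) = 3.
  rewrite -addrA size_polyDl size_polyXn // -opprD size_polyN.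
  apply: leq_ltn_trans (_ : 2 < _)%N => //.
  apply: leq_trans (size_polyD _ _) _; rewrite geq_max.
  rewrite (leq_trans (size_scale_leq _ _)) ?size_polyX //.
  by rewrite (leq_trans (size_polyC_leq1 _)).
(* f has 2 q + 1 distinct roots, one more than the degree of g *)
have size_g : size g = (q + q).+1.
  rewrite size_prod => [|w _]; last by rewrite -size_poly_gt0 g_size.
  rewrite (eq_bigr (fun=> 3)) => [|w _]; last exact: g_size.
  by rewrite sum_nat_const cardE /= -cardE; lia.
suff /(max_poly_roots _) : all (root g) r.
  move=> /(_ _ r_uniq); rewrite size_g r_size -size_poly_gt0 size_g ltnn.
  by move=> /(_ isT).
apply/allP => z /r_root fz; have nz := f_neq0 fz.
move: (fz); rewrite rootE f_at => /eqP.
have [w ew] : exists w, w = z ^+ q by exists (z ^+ q).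
have zq : z * z ^+ q.-1 = w by rewrite ew -exprS prednK // ltnW.
have -> : z ^+ (q + q).+1 = z * (w * w) by rewrite ew exprS exprD.
rewrite -ew; move: zq; move: (z ^+ q.-1) => v zq hf.
have [y ey] : exists y, c' * y = - (z ^+ 2 * w).
  by exists (- (z ^+ 2 * w) / c'); rewrite mulrC divfK.
have hy : y * (y + a' * z + c') = z ^+ 3.
  apply: (mulfI (expf_neq0 2 c0)).
  transitivity (c' * y * (c' * y + a' * c' * z + c' ^+ 2)); first by ring.
  rewrite ey -[RHS]addr0 -(mulr0 (z ^+ 3)) -hf -zq; ring.
have hR : Some (z, y) \in points C by apply/oncurveP/oncurve_tri.
pose R : epoint C := EPoint hR.
have eR : epval R = Some (z, y) by [].
have ny : y != 0 by have [] := tri_neq0 nz (oncurveP _ _ _ hR).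
have eFr : epval (ep_map frob_tri R) = Some (w, frob y) by rewrite /= ew.
have wE : - c' * y / z ^+ 2 = w
  by rewrite mulNr ey opprK mulrAC divff ?mul1r ?expf_neq0.
have eRT := addT3 eR nz; rewrite wE in eRT.
case: (epoint_same_x eFr eRT) => [h|h]; first by case: noR; exists R.
have := congr1 (@epval _ _) h; rewrite eFr epvalN eRT /= => -[yq].
have hl : frob (y / z) = y / z.
  have nw : w != 0 by rewrite ew expf_neq0.
  rewrite (rmorphM frob) (fmorphV frob) /= -[frob z]ew.
  apply: (mulIf nw); rewrite divfK // mulrAC; apply: (mulIf nz);
    rewrite divfK //.
  rewrite yq -wE; apply/eqP; rewrite -subr_eq0; apply/eqP.
  transitivity (c' * (y * (y + a' * z + c') - z ^+ 3) / z ^+ 2).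
    by field.
  by rewrite hy subrr mulr0 mul0r.
have [l el] := frob_fixed iota hl.
rewrite rootE /g horner_prod (bigD1 l) //= !hornerE -el.
have -> : z ^+ 2 - ((y / z) ^+ 2 + a' * (y / z)) * z - c' * (y / z)
    = (z ^+ 3 - y * (y + a' * z + c')) / z by field.
by rewrite hy subrr mul0r mul0r.
Qed.

End FrobeniusTranslate.

Section IndexDivisible.
Variables (k : finFieldType) (L : closedFieldType) (iota : {rmorphism k -> L}).
Variables (a c : k) (ell : elliptic (tri a c)).

Let ellL : elliptic (tri (iota a) (iota c)).
Proof. by rewrite -map_tri elliptic_map. Qed.

Local Notation C := (triC ell).
Local Notation E := (velC ell).
Local Notation CL := (triC ellL).
Local Notation EL := (velC ellL).
Local Notation T := (T3 ellL).
Let inclC : epoint C -> epoint CL := @ep_map _ _ iota C CL (map_tri iota a c).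
Let inclE : epoint E -> epoint EL := @ep_map _ _ iota E EL (map_vel iota a c).
Let FrC : epoint CL -> epoint CL := ep_map (frob_tri ellL).
Let FrE : epoint EL -> epoint EL := ep_map (frob_vel ellL).

Let inclED : {morph inclE : x y / x + y}. Proof. exact: raddfD. Qed.
Let FrCD : {morph FrC : x y / x + y}. Proof. exact: raddfD. Qed.

Let phi_incl Q : phi (inclC Q) = inclE (phi Q).
Proof. by apply: epval_inj => /=; rewrite map_velu_pt. Qed.

Let phi_Fr R : phi (FrC R) = FrE (phi R).
Proof. by apply: epval_inj => /=; rewrite map_velu_pt /= !frob_iota. Qed.

Let Fr_incl S : FrE (inclE S) = inclE S.
Proof.
by apply: epval_inj => /=; case: (epval S) => [[x y]|] //=; rewrite !frob_iota.
Qed.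

Let Fr_inclC S : FrC (inclC S) = inclC S.
Proof.
by apply: epval_inj => /=; case: (epval S) => [[x y]|] //=; rewrite !frob_iota.
Qed.

Let FrT n : FrC (T *+ n) = T *+ n.
Proof.
have FT : FrC T = T by apply: epval_inj; rewrite /= rmorph0.
by rewrite -[RHS](congr1 (fun t => t *+ n) FT); exact: raddfMn.
Qed.

(** [kum j S] says that Frobenius moves the points of the fibre over [S] by
    [j] times [T3]: it is the connecting map from [E(k)] to [Z/3] of the
    isogeny. *)
Let kum (j : nat) (S : epoint E) : Prop :=
  exists R, phi R = inclE S /\ FrC R = R + T *+ j.

Let Tmod n : T *+ n = T *+ (n %% 3).
Proof. by rewrite {1}(divn_eq n 3) mulrnDr mulnC mulrnA T3_triple mul0rn
  add0r. Qed.

Let T_inj i j : (i < 3)%N -> (j < 3)%N -> T *+ i = T *+ j -> i = j.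
Proof.
have T0 := T3_neq0 ellL.
have T2 : - T != 0 by rewrite oppr_eq0.
have T3' : T != - T.
  by rewrite -T3_double -subr_eq0 opprD addrA subrr sub0r.
case: i => [|[|[|//]]] _; case: j => [|[|[|//]]] _ //;
  rewrite ?mulr0n ?mulr1n ?mulr2n ?T3_double => /eqP;
  by rewrite ?(eq_sym 0) ?(eq_sym (- T) T) (negPf T0, negPf T2, negPf T3').
Qed.

Let kum_total S : exists2 j, (j < 3)%N & kum j S.
Proof.
have [R eR] := phi_surjective (inclE S).
have [n hn] : exists n, FrC R = R + T *+ n.
  by apply: phi_fibre; rewrite phi_Fr eR Fr_incl.
by exists (n %% 3)%N; [rewrite ltn_mod|exists R; rewrite -Tmod].
Qed.

Let kum_uniq i j S : (i < 3)%N -> (j < 3)%N -> kum i S -> kum j S -> i = j.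
Proof.
move=> hi hj [R [eR FR]] [R' [eR' FR']]; apply: T_inj => //.
have [n hn] : exists n, R' = R + T *+ n by apply: phi_fibre; rewrite eR' eR.
move: FR'; rewrite hn FrCD FR FrT -!addrA => /addrI.
by rewrite addrC => /addrI.
Qed.

Let kumD i j S S' : kum i S -> kum j S' -> kum (i + j) (S + S').
Proof.
move=> [R [eR FR]] [R' [eR' FR']]; exists (R + R'); split.
  by rewrite inclED -eR -eR' raddfD.
by rewrite FrCD FR FR' mulrnDr addrACA.
Qed.

Let kum_mod j S : kum j S -> kum (j %% 3) S.
Proof. by case=> R [eR FR]; exists R; rewrite -Tmod. Qed.

Let kum_phi Q : kum 0 (phi Q).
Proof. by exists (inclC Q); rewrite phi_incl Fr_inclC addr0. Qed.

(** The image of a point with [Frob R = R + T3] is fixed by Frobenius, hence has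
    coordinates in [k]. *)
Let kum_onto : exists S, kum 1 S.
Proof.
have [R FR] : exists R, FrC R = R + T := exists_frob_translate ellL.
have fixR : FrE (phi R) = phi R by rewrite -phi_Fr FR phi_addT.
suff [S eS] : exists S, inclE S = phi R by exists S, R.
case eR: (epval (phi R)) => [[x y]|]; last first.
  by exists 0; apply: epval_inj; rewrite eR.
have := congr1 (@epval _ _) fixR; rewrite /= [velu_pt _ _ _]eR /= => -[fx fy].
have [x' ex] := frob_fixed iota fx; have [y' ey] := frob_fixed iota fy.
have hS : Some (x', y') \in points E.
  apply/oncurveP/oncurve_vel; apply: (fmorph_inj iota).
  have := epointP (phi R); rewrite eR => /oncurveP /oncurve_vel; rewrite ex ey.
  by rewrite !(rmorph_nat, rmorphXn, rmorphN, rmorphD, rmorphM).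
by exists (EPoint hS); apply: epval_inj; rewrite eR /= ex ey.
Qed.

Variable Q : epoint C.
Local Notation P := (phi Q).
Let orb (S : epoint E) :
  {set pt k} := [set R in orbit (padd E P) (epval S)]%SET.

Let orbP (S S' : epoint E) :
  reflect (exists n, S' = P *+ n + S) (epval S' \in orb S).
Proof.
have it n (U : epoint E) : iter n (padd E P) (epval U) = epval (P *+ n + U).
  elim: n => [|n IHn]; first by rewrite mulr0n add0r.
  by rewrite iterS IHn -epvalD addrA -mulrS.
rewrite /orb inE -fconnect_orbit; apply: (iffP idP) => [h|[n ->]].
  exists (findex (padd E P) (epval S) (epval S')); apply: epval_inj.
  by rewrite -it iter_findex.
by rewrite -it; exact: fconnect_iter.
Qed.

Let orb_lift (S : epoint E) x : x \in orb S -> exists S' : epoint E, x =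
  epval S'.
Proof.
rewrite inE -fconnect_orbit => /iter_findex <-.
elim: (findex _ _ _) => [|n [S' e]]; first by exists S.
by exists (P + S'); rewrite iterS e.
Qed.

Let kum_orb S S' j : epval S' \in orb S -> kum j S -> kum j S'.
Proof.
case/orbP => n -> kS; have kn : kum 0 (P *+ n).
  elim: n => [|n IHn]; last by rewrite mulrS; apply: (kumD (kum_phi Q) IHn).
  by exists 0; rewrite phi0 mulr0n !addr0 /inclE /FrC !raddf0.
exact: (kumD kn kS).
Qed.

(** The cosets counted by [point_index]; [cls] is the value on a coset of the
    map to [Z/3], and translation by a point of class 1 permutes the classes
    cyclically. *)
Let Orb : {set {set pt k}} :=
  [set [set R in orbit (padd E P) x]%SET | x in points E]%SET.

Let OrbP A : reflect (exists S, A = orb S) (A \in Orb).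
Proof.
apply: (iffP imsetP) => [[x xE ->]|[S ->]]; first by exists (@EPoint _ E x xE).
by exists (epval S) => //; exact: (epointP S).
Qed.

Let has_kum (A : {set pt k}) j := `[< exists2 S, epval S \in A & kum j S >].
Let cls (A : {set pt k}) : 'I_3 := odflt ord0 [pick j : 'I_3 | has_kum A j].

Let orb_refl S : epval S \in orb S.
Proof. by apply/orbP; exists 0; rewrite mulr0n add0r. Qed.

Let cls_orb S (j : 'I_3) : kum j S -> cls (orb S) = j.
Proof.
move=> kS; rewrite /cls; case: pickP => [i /asboolP[S' S'S kS']|/(_ j)] /=.
  by apply/val_inj/(kum_uniq (ltn_ord i) (ltn_ord j) kS'); apply: kum_orb kS.
by move/asboolP => []; exists S => //; exact: orb_refl.
Qed.

Let translate (S : epoint E) (A : {set pt k}) : {set pt k} :=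
  [set padd E S x | x in A]%SET.

Let translate_orb S S' : translate S (orb S') = orb (S + S').
Proof.
apply/setP => x; apply/imsetP/idP => [[y yS ->]|xS].
  have [U eU] := orb_lift yS; move: yS; rewrite eU => /orbP[n ->].
  by rewrite -epvalD; apply/orbP; exists n; rewrite addrCA.
have [U eU] := orb_lift xS; move: xS; rewrite eU => /orbP[n ->].
exists (epval (P *+ n + S')); first by apply/orbP; exists n.
by rewrite -epvalD addrCA.
Qed.

Let cls_le (i j : 'I_3) : j = ((i + 1) %% 3)%N :> nat ->
  (#|[set A in Orb | cls A == i]%SET| <= #|[set A in Orb | cls A == j]%SET|)%N.
Proof.
move=> eij; have [S1 k1] := kum_onto.
have inj : {in [set A in Orb | cls A == i]%SET &, injective (translate S1)}.
  move=> A B; rewrite !inE => /andP[/OrbP[S ->] _] /andP[/OrbP[S' ->] _].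
  by move/(congr1 (translate (- S1))); rewrite !translate_orb !addKr.
rewrite -(card_in_imset inj); apply: subset_leq_card;
  apply/fintype.subsetP => B /imsetP[A].
rewrite !inE => /andP[/OrbP[S ->] /eqP clsS] ->; rewrite translate_orb.
apply/andP; split; first by apply/OrbP; exists (S1 + S).
have [l hl kl] := kum_total S; have eli := cls_orb (j := Ordinal hl) kl.
apply/eqP/cls_orb; rewrite eij addnC; apply: kum_mod; apply: kumD => //.
by rewrite -clsS eli.
Qed.

Lemma three_dvd_point_index : (3 %| point_index (vel a c) (epval P))%N.
Proof.
have -> : point_index (vel a c) (epval P) = #|Orb| by [].
have e (i : 'I_3) : #|[set A in Orb | cls A == i]%SET| =
    #|[set A in Orb | cls A == ord0]%SET|.
  have h01 := @cls_le ord0 (@Ordinal 3 1 isT) erefl.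
  have h12 := @cls_le (@Ordinal 3 1 isT) (@Ordinal 3 2 isT) erefl.
  have h20 := @cls_le (@Ordinal 3 2 isT) ord0 erefl.
  have i012 : [\/ i = ord0, i = @Ordinal 3 1 isT | i = @Ordinal 3 2 isT].
    by case: i => [[|[|[|//]]] hi];
      [constructor 1|constructor 2|constructor 3]; apply/val_inj.
  by case: i012 => -> //; apply/eqP; rewrite eqn_leq; apply/andP; split=> //;
    [exact: leq_trans h12 h20|exact: leq_trans h01 h12].
rewrite -sum1_card (partition_big cls predT) //=.
rewrite (eq_bigr (fun=> #|[set A in Orb | cls A == ord0]%SET|)) => [|i _].
  by rewrite sum_nat_const card_ord dvdn_mulr.
rewrite -(e i) -sum1_card; apply: eq_bigl => A; by rewrite inE.
Qed.
End IndexDivisible.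

Theorem three_dvd_velu_index (k : finFieldType) (a c : k)
  (ell : elliptic (tri a c)) (Q : epoint (triC ell)) :
  (3 %| point_index (vel a c) (epval (phi Q)))%N.
Proof.
have [L [iota _]] := countable_algebraic_closure k.
exact: (three_dvd_point_index iota Q).
Qed.

(** * Traces of cube roots and cubes in number fields *)

Lemma monic_dvd_irreducible_exp (F : fieldType) (p q : {poly F}) n :
  irreducible_poly p -> p \is monic -> q \is monic -> q %| p ^+ n ->
  exists m, q = p ^+ m.
Proof.
move=> irr_p mon_p; elim: n q => [|n IHn] q mon_q.
  rewrite expr0 dvdp1 size_poly_eq1 => q1; exists 0; apply/eqP.
  by rewrite expr0 -eqp_monic ?monic1.
have [pq|npq] := boolP (p %| q).
  have [u eq_q] := dvdpP _ _ pq; rewrite eq_q.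
  rewrite exprSr dvdp_mul2r ?monic_neq0 // => u_pn.
  have [|m ->] := IHn _ _ u_pn; last by exists m.+1; rewrite exprSr.
  by move: mon_q; rewrite eq_q monicMr.
rewrite exprS Gauss_dvdpr; first exact: IHn.
by rewrite coprimep_sym irreducible_poly_coprime.
Qed.

Import passmx.

Section CubeRootTrace.
Variables (K : fieldExtType rat).
Local Notation d := (\dim {:K}).

Definition mulmat (x : K) : 'M[rat]_d :=
  mxof (vbasis {:K}) (vbasis {:K}) (amulr x).

Let basK := vbasisP {:K}.

Lemma mulmatM x y : mulmat (x * y) = mulmat x *m mulmat y.
Proof.
rewrite -(mxof_comp _ _ basK); congr mxof; apply/lfunP => u.
by rewrite comp_lfunE !lfunE /= mulrA.
Qed.

Lemma mulmatZ (k : rat) x : mulmat (k *: x) = k *: mulmat x.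
Proof. by rewrite /mulmat !linearZ. Qed.

Lemma mulmat1 : mulmat 1 = 1%:M.
Proof.
rewrite -(mxof1 (basis_free basK)); congr mxof; apply/lfunP => u.
by rewrite !lfunE /= mulr1.
Qed.

Definition ktrace x := \tr (mulmat x).

Lemma ktrace_is_linear : linear_for *%R ktrace.
Proof. by move=> k x y; rewrite /ktrace /mulmat !linearP. Qed.
HB.instance Definition _ := GRing.isLinear.Build rat K rat _ ktrace
  ktrace_is_linear.

Lemma ktrace1 : ktrace 1 != 0.
Proof.
rewrite /ktrace mulmat1 mxtrace_scalar -[_ *+ _]/(d%:R) pnatr_eq0.
by rewrite -lt0n adim_gt0.
Qed.

(** If [c] is a cube root of a rational [r] that is not a cube, then [X ^ 3 - r]
    is irreducible, so the characteristic polynomial of multiplication by [c]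
    is a power of it, a polynomial in [X ^ 3]. *)
Lemma ktrace_cube_root (c : K) (r : rat) :
  c ^+ 3 = r *: 1 -> (forall x : rat, x ^+ 3 != r) -> ktrace c = 0.
Proof.
move=> hc hr; pose p : {poly rat} := 'X^3 - r%:P.
have p_monic : p \is monic by rewrite /p monicXnsubC.
have size_p : size p = 4 by rewrite /p size_XnsubC.
have irr_p : irreducible_poly p.
  apply: cubic_irreducible; first by rewrite size_p.
  by move=> x; rewrite rootE /p !hornerE subr_eq0.
pose A := mulmat c; pose X : 'M[{poly rat}]_d := 'X%:M.
pose A' := map_mx polyC A.
have A3 : A' *m A' *m A' = (r%:P)%:M.
  rewrite /A' -!map_mxM /= -/A /A -!mulmatM -mulrA -expr2 -exprS hc mulmatZ
    mulmat1.
  by rewrite scalemx1 map_scalar_mx.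
have dvd : char_poly A %| p ^+ d.
  have -> : p ^+ d = \det ((p)%:M : 'M[{poly rat}]_d) by rewrite det_scalar.
  have -> : (p%:M : 'M[{poly rat}]_d) =
      char_poly_mx A *m (('X^2)%:M + 'X *: A' + A' *m A').
    rewrite /char_poly_mx -/A' mulmxBl !mulmxDr !mul_scalar_mx.
    rewrite mul_mx_scalar -!scalemxAr mulmxA A3.
    rewrite !scalerA -expr2 scale_scalar_mx -exprS /p raddfB /=.
    by rewrite -(addrA 'X^3%:M) addrKA.
  by rewrite det_mulmx dvdp_mulIl.
have [m chi] := monic_dvd_irreducible_exp irr_p p_monic (char_poly_monic A) dvd.
have d3 : (d = 3 * m)%N.
  have := size_exp p m; rewrite -chi size_char_poly size_p /= => ->.
  by rewrite mulnC.
have d_gt0 : (0 < d)%N by apply: adim_gt0.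
have := char_poly_trace A d_gt0; rewrite chi.
have -> : p ^+ m = ('X - r%:P) ^+ m \Po 'X^3.
  by rewrite rmorphXn /= comp_polyB comp_polyX comp_polyC.
rewrite coef_comp_poly_Xn // ifF; first by move/eqP;
  rewrite eq_sym oppr_eq0 => /eqP.
by rewrite d3; case: m {chi} d3 d_gt0 => [|m]; lia.
Qed.
End CubeRootTrace.

Definition is_cube (F : fieldType) (x : F) : Prop := exists y, x = y ^+ 3.

(** Pairwise inequivalent cube roots are linearly independent: dividing a linear
    relation by one of them and taking traces isolates its coefficient. *)
Lemma cube_classes_bound (K : fieldExtType rat) (rs : seq rat) :
  {in rs, forall r, r != 0 /\ is_cube (r%:A : K)} ->
  pairwise (fun x y => ~~ `[< is_cube (x / y) >]) rs ->
  (size rs <= \dim {:K})%N.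
Proof.
move=> rsK rs_ncube.
have [s hs] : exists s : rat -> K, {in rs, forall r, s r ^+ 3 = r%:A}.
  have /choice[s hs] : forall r, exists y : K, r \in rs -> y ^+ 3 = r%:A.
    by move=> r; case: (boolP (r \in rs)) => [/rsK[_ [y ey]]|_];
      [exists y|exists 0].
  by exists s.
pose S := map_tuple s (in_tuple rs).
suff fS : free S.
  have <- : \dim <<S>> = size rs by rewrite (eqP fS) size_tuple.
  by apply: dimvS; exact: subvf.
apply/freeP => k hk i.
have rsi (j : 'I_(size rs)) : rs`_j \in rs by exact: mem_nth.
have Sj (j : 'I_(size rs)) : S`_j = s rs`_j by rewrite (nth_map 0).
have s0 r : r \in rs -> s r != 0.
  move=> rr; have [r0 _] := rsK _ rr; apply: contra_neq r0 => sr0.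
  have := hs _ rr; rewrite sr0 expr0n => /esym/eqP.
  by rewrite scaler_eq0 oner_eq0 orbF => /eqP.
have := congr1 (fun x => ktrace (x * (s rs`_i)^-1)) hk.
rewrite mul0r linear0 mulr_suml raddf_sum (bigD1 i) //= big1 ?addr0 => [|j ji].
  rewrite -scalerAl Sj divff ?s0 // linearZ /= => /eqP.
  by rewrite mulf_eq0 (negPf (ktrace1 K)) orbF => /eqP.
rewrite -scalerAl linearZ /= (@ktrace_cube_root _ _ (rs`_j / rs`_i)) ?mulr0 //.
  rewrite Sj exprMn exprVn !hs //.
  by rewrite -(fmorph_div (in_alg K)).
move=> x; apply/eqP => hx; have /(pairwiseP 0) pw := rs_ncube.
have [hij|hij|/val_inj eij] := ltngtP i j; last by rewrite eij eqxx in ji.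
  have /asboolP[] := pw i j (ltn_ord i) (ltn_ord j) hij.
  by exists x^-1; rewrite exprVn hx invf_div.
have /asboolP[] := pw j i (ltn_ord j) (ltn_ord i) hij.
by exists x.
Qed.

Lemma rat_cube_mul_den (x : rat) : exists (r : int) (c : rat),
  x = r%:~R * c ^+ 3 /\ (x != 0 -> r != 0).
Proof.
exists (numq x * denq x ^+ 2), (denq x)%:~R^-1; split.
  have d0 : (denq x)%:~R != 0 :> rat by rewrite intr_eq0 denq_neq0.
  by rewrite -{1}(divq_num_den x) rmorphM rmorphXn /=; field.
by move=> x0; rewrite mulf_neq0 ?numq_eq0 // expf_neq0 // denq_neq0.
Qed.

(** By [cube_classes_bound] there is a maximal family of pairwise inequivalent
    rationals that become cubes in [K]; [N] is the product of integers
    representing its classes. *)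
Lemma cube_classes_finite (K : fieldExtType rat) : exists2 N : nat, (0 < N)%N &
  forall x : rat, x != 0 -> is_cube (x%:A : K) ->
  exists (r : int) (c : rat), [/\ r != 0, (r %| N%:Z)%Z & x = r%:~R * c ^+ 3].
Proof.
pose fam (rs : seq rat) := {in rs, forall r, r != 0 /\ is_cube (r%:A : K)} /\
  pairwise (fun x y => ~~ `[< is_cube (x / y) >]) rs.
pose has_fam n := `[< exists rs, size rs = n /\ fam rs >].
have fam0 : exists n, has_fam n by exists 0; apply/asboolP; exists [::].
have bound n : has_fam n -> (n <= \dim {:K})%N.
  by move=> /asboolP[rs [<- [h1 h2]]]; apply: cube_classes_bound.
have [n /asboolP[rs [size_rs [rsK rs_nc]]] nmax] := ex_maxnP fam0 bound.
have /choice[g hg] : forall r : rat, exists r' : int, exists c : rat,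
    r = r'%:~R * c ^+ 3 /\ (r != 0 -> r' != 0).
  by move=> r; have [r' [c h]] := rat_cube_mul_den r; exists r', c.
exists (\prod_(r <- rs) `|g r|)%N.
  rewrite big_seq; apply: prodn_cond_gt0 => r /rsK[r0 _].
  by rewrite absz_gt0; have [c [_ ->]] := hg r.
move=> x x0 xK.
have [[r [rr [d xr]]]|no] := EM (exists r, r \in rs /\ is_cube (x / r)).
  have [r0 _] := rsK _ rr; have [c [er /(_ r0) gr0]] := hg r.
  exists (g r), (c * d); split => //.
    by rewrite dvdzE /= (big_rem r) //= dvdn_mulr.
  by rewrite -[x](divfK r0) xr {1}er exprMn; ring.
have /nmax : has_fam n.+1; last by rewrite ltnn.
apply/asboolP; exists (x :: rs); split; first by rewrite /= size_rs.
split; first by move=> r; rewrite inE => /orP[/eqP->|/rsK].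
rewrite pairwise_cons rs_nc andbT; apply/allP => r rr; apply/asboolP => xr.
by apply: no; exists r.
Qed.

(** * Parameters for which t, b, bt and b/t are not cubes *)

Lemma coprime_cube_ratio (A q w p : nat) :
  (A * q ^ 3 = w * p ^ 3)%N -> coprime A w -> coprime p q -> A = (p ^ 3)%N.
Proof.
move=> e cAw cpq; apply/eqP; rewrite eqn_dvd; apply/andP; split.
  by rewrite -(Gauss_dvdr _ cAw) -e dvdn_mulr.
have c3 : coprime (p ^ 3) (q ^ 3) by rewrite coprimeXl // coprimeXr.
by rewrite -(Gauss_dvdl _ c3) e dvdn_mull.
Qed.

Lemma cube_of_coprime_ratio (A u r : int) (c : rat) : u != 0 ->
  A%:~R / u%:~R = r%:~R * c ^+ 3 -> coprimez A (u * r) ->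
  exists v : nat, (`|A| = v ^ 3)%N.
Proof.
move=> u0 e cop; exists `|numq c|%N.
apply: (@coprime_cube_ratio _ `|denq c|%N `|(u * r)%R|%N) => //; last first.
  exact: coprime_num_den.
have q0 : (denq c)%:~R != 0 :> rat by rewrite intr_eq0 denq_neq0.
have u0' : u%:~R != 0 :> rat by rewrite intr_eq0.
rewrite -!abszX -!abszM; congr absz; apply/eqP; rewrite -(eqr_int rat).
rewrite !(rmorphXn, rmorphM) /=; apply/eqP.
transitivity (A%:~R / u%:~R * (u%:~R * (denq c)%:~R ^+ 3) : rat);
  first by field.
by rewrite e -{1}(divq_num_den c); field.
Qed.

Lemma not_cube_between (m A v : nat) :
  (m ^ 3 < A)%N -> (A < m.+1 ^ 3)%N -> A <> (v ^ 3)%N.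
Proof.
by move=> h1 h2 e; move: h1 h2;
  rewrite e !ltn_exp2r // ltnS => h /(leq_trans h); rewrite ltnn.
Qed.

(** Up to sign, [num_t d] and [num_b d] are the numerators of [t] and [b]. *)
Definition num_t (d : nat) : nat := (d ^ 3 + 1)%N.
Definition num_b (d : nat) : nat := (num_t d ^ 2 + num_t d * d - d ^ 2)%N.
Definition tpar (d : nat) : rat := (num_t d)%:R / d%:R.

Lemma num_bE d : (num_b d)%:Z =
  (num_t d)%:Z ^+ 2 + (num_t d)%:Z * d - d%:Z ^+ 2.
Proof.
rewrite /num_b /num_t;
  have : (d ^ 2 <= (d ^ 3 + 1) ^ 2 + (d ^ 3 + 1) * d)%N by nia.
lia.
Qed.

Lemma num_t_not_cube d v : (0 < d)%N -> num_t d <> (v ^ 3)%N.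
Proof. by move=> d0; apply: (@not_cube_between d); rewrite /num_t; nia. Qed.

(** With [n = d ^ 3 + 1] one has
    [n ^ 2 + n d - d ^ 2 = d ^ 6 + d ^ 4 + 2 d ^ 3 - d ^ 2 + d + 1], which is
    between the cubes of [d ^ 2] and [d ^ 2 + 1]. *)
Lemma num_b_not_cube d v : (0 < d)%N -> num_b d <> (v ^ 3)%N.
Proof.
move=> d0; apply: (@not_cube_between (d ^ 2)%N);
 rewrite -ltz_nat num_bE /num_t; nia.
Qed.

Lemma coprime_num_t_d d : coprime (num_t d) d.
Proof.
rewrite /num_t addn1; apply: (coprime_dvdr _ (coprimeSn (d ^ 3))).
exact: dvdn_exp.
Qed.

Lemma num_b_eq d : (num_b d + d ^ 2 = num_t d * (num_t d + d))%N.
Proof. by rewrite /num_b /num_t; nia. Qed.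

Lemma coprime_num_b_t d : coprime (num_b d) (num_t d).
Proof.
have c2 : coprime (num_t d) (d ^ 2) by rewrite coprimeXr ?coprime_num_t_d.
rewrite /coprime -dvdn1 -(eqP c2) dvdn_gcd dvdn_gcdr /=.
by rewrite -(dvdn_addr _ (dvdn_gcdl (num_b d) (num_t d))) num_b_eq dvdn_mulr
  ?dvdn_gcdr.
Qed.

Lemma coprime_num_b_d d : coprime (num_b d) d.
Proof.
have c1 := coprime_num_t_d d; set g := gcdn (num_b d) d.
have gd : (g %| d)%N := dvdn_gcdr _ _.
have gn : coprime g (num_t d) by rewrite coprime_sym; apply: coprime_dvdr gd c1.
have : (g %| num_t d * (num_t d + d))%N.
  by rewrite -num_b_eq dvdn_add ?dvdn_gcdl // dvdn_exp.
rewrite Gauss_dvdr // dvdn_addl // => gn'.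
by rewrite /coprime -dvdn1 -(eqP c1) dvdn_gcd gn' gd.
Qed.

Lemma bpar_tpar d : (0 < d)%N ->
  [/\ bpar (tpar d) = - (num_b d)%:R / (num_t d * d)%:R,
      bpar (tpar d) * tpar d = - (num_b d)%:R / (d ^ 2)%:R
    & bpar (tpar d) / tpar d = - (num_b d)%:R / (num_t d ^ 2)%:R].
Proof.
move=> d0; have d0' : d%:R != 0 :> rat by rewrite pnatr_eq0 -lt0n.
have n0 : (num_t d)%:R != 0 :> rat by rewrite pnatr_eq0 /num_t addn1.
have e : (num_b d)%:R =
  (num_t d)%:R ^+ 2 + (num_t d)%:R * d%:R - d%:R ^+ 2 :> rat.
  have := congr1 (intr : int -> rat) (num_bE d).
  by rewrite rmorphB rmorphD !(rmorphXn, rmorphM).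
by split; rewrite /bpar /tpar !natrM ?natrX e; field; rewrite ?n0 ?d0'.
Qed.

(** If [A / u] becomes a cube in [K], then it is [r c ^ 3] with [r] a divisor of
    [N], hence of [d].  As [A] is prime to [u d], this makes [A] itself a cube;
    but [A] is [num_t d] or [- num_b d]. *)
Lemma noncube_tpar (K : fieldExtType rat) : exists2 N : nat, (0 < N)%N &
  forall d, (0 < d)%N -> (N %| d)%N ->
  let t := tpar d in let b := bpar t in
  [/\ ~ is_cube (t%:A : K), ~ is_cube (b%:A : K), ~ is_cube ((b * t)%:A : K)
    & ~ is_cube ((b / t)%:A : K)].
Proof.
have [N N0 hN] := cube_classes_finite K; exists N => // d d0 Nd t b.
have gen (A u : int) : u != 0 -> coprimez A (u * d%:Z) ->
    (forall v, `|A|%N <> (v ^ 3)%N) -> ~ is_cube ((A%:~R / u%:~R : rat)%:A : K).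
  move=> u0 cop ncube h.
  have x0 : A%:~R / u%:~R != 0 :> rat.
    rewrite mulf_neq0 ?invr_eq0 ?intr_eq0 //; apply/eqP => A0.
    by apply: (ncube 0); rewrite A0.
  have [r [c [r0 rN e]]] := hN _ x0 h.
  have [v ev] : exists v : nat, (`|A| = v ^ 3)%N.
    apply: cube_of_coprime_ratio u0 e _.
    move: cop; rewrite !coprimezMr => /andP[-> /=].
    rewrite !coprimezE; apply: coprime_dvdr; rewrite -dvdzE.
    by apply: (dvdz_trans rN); rewrite dvdzE.
  exact: ncube ev.
have [e1 e2 e3] := bpar_tpar d0; rewrite -/t -/b in e1 e2 e3.
have d0' : d%:Z != 0 by rewrite eqz_nat -lt0n.
have n0 : (num_t d)%:Z != 0 by rewrite /num_t addn1.
have cnd := coprime_num_t_d d; have cbd := coprime_num_b_d d.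
have cbn := coprime_num_b_t d.
have ncb v : `|- (num_b d)%:Z|%N <> (v ^ 3)%N by rewrite abszN;
  apply: num_b_not_cube.
have E u : - (num_b d)%:R / u%:R = (- (num_b d)%:Z)%:~R / u%:~R :> rat.
  by rewrite rmorphN.
have cb u : coprime (num_b d) (u * d) ->
  coprimez (- (num_b d)%:Z) (u%:Z * d%:Z).
  by rewrite coprimezE abszN -PoszM.
split.
- apply: (gen (num_t d)%:Z d%:Z) => //; last by move=> v; apply: num_t_not_cube.
  by rewrite coprimezE -PoszM coprimeMr cnd.
- rewrite e1 E; apply: gen => //; first by rewrite PoszM mulf_neq0.
  by apply: cb; rewrite !coprimeMr cbn cbd.
- rewrite e2 E; apply: gen => //; first by rewrite eqz_nat -lt0n expn_gt0 d0.
  by apply: cb; rewrite coprimeMr coprimeXr ?cbd.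
- rewrite e3 E; apply: gen => //;
  first by rewrite eqz_nat -lt0n expn_gt0 /num_t addn1.
  by apply: cb; rewrite coprimeMr coprimeXr ?cbd ?cbn.
Qed.

(** * Points of infinite order *)

Section TwoAdic.
Local Notation par := (intr : int -> 'F_2).
Implicit Types (x b : rat) (A B D M : int).

(** [val2 s x] says that the 2-adic valuation of [x] is [- 2 s]. *)
Definition val2 s x := exists A D, [/\ par A = 1, par D = 1
  & x * 4 ^+ s * D%:~R = A%:~R].

Lemma odd_neq0 A : par A = 1 -> A%:~R != 0 :> rat.
Proof. by move=> h; rewrite intr_eq0; apply/eqP => A0; move: h; rewrite A0. Qed.

Let two0 : 2 = 0 :> 'F_2. Proof. exact/val_inj. Qed.

Let even_pow n : (0 < n)%N -> par (2 ^+ n) = 0.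
Proof. by case: n => // n _;
  rewrite exprS rmorphM /= -[par 2]/(2) two0 mul0r. Qed.

Lemma val2_inj s s' x : val2 s x -> val2 s' x -> s = s'.
Proof.
wlog lt_ss' : s s' / (s < s')%N => [IH h h'|].
  by case: (ltngtP s s') => // hlt; [exact: IH h h'|symmetry; exact: IH h' h].
move=> [A [D [oA oD e]]] [A' [D' [oA' oD' e']]].
have E : A' * D = A * (2 ^+ (2 * (s' - s))) * D'.
  apply/eqP; rewrite -(eqr_int rat) !rmorphM rmorphXn /= exprM; apply/eqP.
  rewrite -e -e' -{1}(subnK (ltnW lt_ss')) exprD.
  by rewrite (_ : (2%:~R : rat) ^+ 2 = 4) //; ring.
have := congr1 par E; rewrite !rmorphM /= oA oA' oD oD' even_pow; last by lia.
by rewrite mulr0 mul0r mulr1 => /eqP; rewrite oner_eq0.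
Qed.

(** [num / den] is the abscissa of the double of a point of [vel 1 b].  Here
    [val2 (e + j) x] means that the valuation of [x] is at most twice that of
    [b], the latter being [- e] with [e > 1]; hence [x ^ 4] and [4 x ^ 3] are
    the terms of least valuation.  After clearing denominators, [N'] and [D']
    are [num] and [den / 4]: their first terms are odd and the others are
    multiples of the even integers [Q1] and [Q4]. *)
Lemma val2_double x b B M e j : (1 < e)%N -> par B = 1 -> par M = 1 ->
  b * 2 ^+ e * M%:~R = B%:~R -> val2 (e + j) x ->
  let den := 4 * x ^+ 3 + x ^+ 2 - 18 * b * x - 27 * b ^+ 2 - 4 * b in
  let num := x ^+ 4 + 9 * b * x ^+ 2 + 2 * (27 * b ^+ 2 + 4 * b) * x + b
    + 27 * b ^+ 2 in
  den != 0 /\ forall x', x' * den = num -> val2 (e + j.+1) x'.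
Proof.
move=> e1 oB oM eb [A [D [oA oD eA]]] den num.
have hM := odd_neq0 oM; have hD := odd_neq0 oD.
have [Q1 dQ1] : exists Q1 : int, Q1 = 2 ^+ (e + 2 * j) by eexists.
have [Q4 dQ4] : exists Q4 : int, Q4 = 4 ^+ (e + j).-1 by eexists.
have o1 : par Q1 = 0 by rewrite dQ1 even_pow //; lia.
have o4 : par Q4 = 0.
  by rewrite dQ4 (_ : 4 = 2 ^+ 2) // -exprM even_pow //; lia.
have [Q dQ] : exists Q : int, Q = 4 * Q4 by eexists.
have QE : Q%:~R = 4 ^+ (e + j) :> rat.
  rewrite dQ dQ4 -exprS prednK ?rmorphXn //; lia.
have Q1E : Q%:~R = 2 ^+ e * Q1%:~R :> rat.
  rewrite QE dQ1 rmorphXn -exprD (_ : 4 = 2 ^+ 2) // -exprM; congr (_ ^+ _);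
    lia.
pose N' : int := A ^+ 4 * M ^+ 2 + Q1 * (9 * B * Q * A ^+ 2 * D ^+ 2 * M
  + 2 * (27 * B ^+ 2 * Q1 * Q + 4 * B * M * Q ^+ 2) * A * D ^+ 3
  + (B * M * Q ^+ 3 + 27 * B ^+ 2 * Q1 * Q ^+ 2) * D ^+ 4).
pose D' : int := A ^+ 3 * M ^+ 2 + Q4 * (A ^+ 2 * D * M ^+ 2
  - 18 * B * Q1 * A * D ^+ 2 * M - 27 * B ^+ 2 * Q1 ^+ 2 * D ^+ 3)
  - Q1 * (B * M * Q ^+ 2 * D ^+ 3).
have oN' : par N' = 1.
  rewrite /N' rmorphD /= [X in _ + X]rmorphM /= o1 mul0r addr0.
  by rewrite !(rmorphXn, rmorphM) /= oA oM !expr1n mulr1.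
have oD' : par D' = 1.
  rewrite /D' rmorphB rmorphD /= [X in _ + X - _]rmorphM [X in _ - X]rmorphM /=.
  by rewrite o1 o4 !mul0r addr0 subr0 !(rmorphXn,
    rmorphM) /= oA oM !expr1n mulr1.
have hQ : Q%:~R != 0 :> rat by rewrite QE expf_neq0.
have xE : x = A%:~R / (Q%:~R * D%:~R) by rewrite -eA -QE; field; rewrite hD hQ.
have h2 : 2 ^+ e != 0 :> rat by rewrite expf_neq0.
have hQ1 : Q1%:~R != 0 :> rat.
  by apply: contraNneq hQ => q0; rewrite Q1E q0 mulr0.
have bE : b = B%:~R * Q1%:~R / (Q%:~R * M%:~R).
  by rewrite -eb Q1E; field; rewrite hM h2 hQ1.
have EN : (Q%:~R * D%:~R) ^+ 4 * M%:~R ^+ 2 * (x ^+ 4 + 9 * b * x ^+ 2 + 2 *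
  (27 * b ^+ 2 + 4 * b) * x + b + 27 * b ^+ 2) = N'%:~R.
  rewrite /N' !(rmorphXn, rmorphB, rmorphD, rmorphM) /= xE bE; field.
  by rewrite hM hQ hD.
have hQ4 : Q4%:~R != 0 :> rat.
  by apply: contraNneq hQ => q0; rewrite dQ rmorphM /= q0 mulr0.
have ED : (Q%:~R * D%:~R) ^+ 3 * M%:~R ^+ 2 * (4 * x ^+ 3 + x ^+ 2 - 18 * b *
  x - 27 * b ^+ 2 - 4 * b) = 4 * D'%:~R.
  rewrite /D' !(rmorphXn, rmorphB, rmorphD, rmorphM) /= xE bE.
  have -> : Q%:~R = 4 * Q4%:~R :> rat by rewrite dQ rmorphM.
  by field; rewrite hM hQ4 hD.
split; first by apply: contraTneq (odd_neq0 oD') => d0; move: ED;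
  rewrite -/den d0 mulr0 => /esym/eqP; rewrite mulf_eq0 /= => ->.
move=> x' hx; exists N', (D * D'); split => //;
  first by rewrite rmorphM /= oD oD' mulr1.
have := congr1 ( *%R ((Q%:~R * D%:~R) ^+ 4 * M%:~R ^+ 2)) hx;
  rewrite [in RHS]/num EN => <-.
transitivity (x' * (Q%:~R * D%:~R) * (4 * D'%:~R)).
  by rewrite addnS exprSr -QE rmorphM; ring.
by rewrite -ED /den; ring.
Qed.
End TwoAdic.

Lemma pigeonhole_multiples (G : zmodType) (P : G) n (f : nat -> nat) :
  (0 < n)%N -> P *+ n = 0 -> exists i j, i <> j /\ P *+ f i = P *+ f j.
Proof.
move=> n0 Pn; have mod m : P *+ m = P *+ (m %% n).
  by rewrite {1}(divn_eq m n) mulrnDr mulnC mulrnA Pn mul0rn add0r.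
pose g (i : 'I_n.+1) : 'I_n := Ordinal (ltn_pmod (f i) n0).
have /injectivePn[i [j ij /(congr1 val) /= gij]] : ~~ injectiveb g.
  apply/negP => /injectiveP /leq_card; rewrite !card_ord ltnn //.
exists i, j; split; first by move=> e; case/eqP: ij; apply: val_inj.
by rewrite mod gij -mod.
Qed.

Lemma double_x (F : fieldType) (b : F) (ell : elliptic (vel 1 b))
    (P : epoint (EllCurve ell)) x y : epval P = Some (x, y) ->
  4 * x ^+ 3 + x ^+ 2 - 18 * b * x - 27 * b ^+ 2 - 4 * b != 0 ->
  exists x' y', epval (P + P) = Some (x', y') /\
   x' * (4 * x ^+ 3 + x ^+ 2 - 18 * b * x - 27 * b ^+ 2 - 4 * b) =
    x ^+ 4 + 9 * b * x ^+ 2 + 2 * (27 * b ^+ 2 + 4 * b) * x + b + 27 * b ^+ 2.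
Proof.
move=> eP hden; have := epointP P; rewrite eP => /oncurveP h.
have hy := iffLR (oncurve_vel 1 b x y) h.
have eden : (2 * y + x + b) ^+ 2 =
    4 * x ^+ 3 + x ^+ 2 - 18 * b * x - 27 * b ^+ 2 - 4 * b.
  transitivity (4 * (y * (y + 1 * x + b)) + (x + b) ^+ 2); first by ring.
  by rewrite hy; ring.
have hden1 : 2 * y + x + b != 0 by rewrite -eden expf_eq0 in hden.
rewrite epvalD eP; case: paddP => //= [_ e|l c _].
  by case/eqP: hden1; rewrite -[RHS]e; ring.
exists (third_x (vel 1 b) l x x),
  (- (l + 1) * third_x (vel 1 b) l x x - (y - l * x) - b); split => //.
case: c => _ /=; rewrite -eden /third_x /= => c2.
have c3 : l * (2 * y + x + b) = 3 * x ^+ 2 - 5 * b - y by rewrite -[RHS]addr0;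
  transitivity (l * (y + y + 1 * x + b)); [ring|rewrite c2; ring].
transitivity ((l * (2 * y + x + b)) ^+ 2 + (l * (2 * y + x + b)) * (2 * y + x
  + b) - 2 * x * (2 * y + x + b) ^+ 2); first by ring.
rewrite c3 eden.
transitivity ((3 * x ^+ 2 - 5 * b) ^+ 2 + (3 * x ^+ 2 - 5 * b) * (x + b)
  - y * (y + 1 * x + b)
  - 2 * x * (4 * x ^+ 3 + x ^+ 2 - 18 * b * x - 27 * b ^+ 2 - 4 * b)).
  by ring.
by rewrite hy; ring.
Qed.

(** Doubling lowers the 2-adic valuation of the abscissa by 2, so the points
    [P *+ 2 ^ j] are pairwise distinct. *)
Lemma val2_nontorsion (b : rat) (B M : int) (e : nat) (ell : elliptic (vel 1 b))
    (P : epoint (EllCurve ell)) x y n :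
  (1 < e)%N -> (B%:~R : 'F_2) = 1 -> (M%:~R : 'F_2) = 1 ->
  b * 2 ^+ e * M%:~R = B%:~R -> epval P = Some (x, y) -> val2 e x ->
  (0 < n)%N -> P *+ n != 0.
Proof.
move=> e1 oB oM eb eP vx n0.
have mult j : exists x' y', epval (P *+ (2 ^ j)) = Some (x',
  y') /\ val2 (e + j) x'.
  elim: j => [|j [x1 [y1 [e1' v1]]]]; first by exists x, y; rewrite addn0.
  have [den0 vnext] := val2_double e1 oB oM eb v1.
  have [x2 [y2 [e2 hx2]]] := double_x e1' den0.
  exists x2, y2; rewrite expnS mulnC mulrnA mulr2n; split => //.
  exact: vnext.
apply/eqP => Pn; have [i [j [nij eij]]] := pigeonhole_multiples (expn 2) n0 Pn.
have [x1 [y1 [e1' v1]]] := mult i; have [x2 [y2 [e2' v2]]] := mult j.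
move: e1'; rewrite eij e2' => -[ex _]; apply: nij.
by apply: (@addnI e); apply: val2_inj v1 _; rewrite -ex.
Qed.

Lemma Ecurve_vel (F : fieldType) (b : F) : Ecurve b = vel 1 b.
Proof. by rewrite /Ecurve /vel; congr Weierstrass; ring. Qed.

Lemma bpar_oncurve (F : fieldType) (t : F) : t != 0 ->
  Some (1, t) \in points (tri 1 (bpar t)).
Proof. by move=> t0; apply/oncurveP/oncurve_tri; rewrite /bpar; field. Qed.

Lemma special_point_velu (F : fieldType) (t : F) : t != 0 ->
  special_point t = velu_pt 1 (bpar t) (Some (1, t)).
Proof.
move=> t0; rewrite velu_ptE ?oner_eq0 // /special_point /velu_x /velu_y /bpar.
by congr Some; congr pair; field; rewrite oner_eq0 t0.
Qed.

Lemma elliptic_tri_lt0 (R : realFieldType) (b : R) :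
  b < 0 -> elliptic (tri 1 b).
Proof.
move=> hb; rewrite elliptic_tri lt_eqF //= expr1n subr_eq0 eq_sym lt_eqF //.
by apply: lt_trans ltr01; rewrite pmulr_rlt0.
Qed.

Section Tpar.
Variables (d : nat) (d0 : (0 < d)%N).

Let dQ : d%:R != 0 :> rat. Proof. by rewrite pnatr_eq0 -lt0n. Qed.
Let nQ : (num_t d)%:R != 0 :> rat.
Proof. by rewrite pnatr_eq0 /num_t addn1. Qed.

Lemma tpar_neq0 : tpar d != 0.
Proof. by rewrite mulf_neq0 ?invr_eq0. Qed.

Lemma bpar_tpar_lt0 : bpar (tpar d) < 0.
Proof.
have [-> _ _] := bpar_tpar d0; rewrite mulNr oppr_lt0.
apply: divr_gt0; rewrite ltr0n.
  by rewrite lt0n; apply/eqP; apply: (@num_b_not_cube d 0).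
by rewrite muln_gt0 d0 /num_t addn1.
Qed.

Lemma elliptic_tpar : elliptic (tri 1 (bpar (tpar d))).
Proof. exact: elliptic_tri_lt0 bpar_tpar_lt0. Qed.

Hypothesis d4 : (4 %| d)%N.

Lemma tpar_nontorsion (ell : elliptic (vel 1 (bpar (tpar d))))
    (P : epoint (EllCurve ell)) n :
  epval P = special_point (tpar d) -> (0 < n)%N -> P *+ n != 0.
Proof.
set t := tpar d; set b := bpar t; rewrite special_point_velu ?tpar_neq0 // -/b.
rewrite velu_ptE ?oner_eq0 // => eP; have t0 := tpar_neq0; rewrite -/t in t0.
(* v2 b = - e, and x (phi (1, t)) = 1 + b + b ^ 2 has valuation - 2 e *)
pose e := logn 2 d; pose m := (d %/ 2 ^ e)%N.
have dE : d = (m * 2 ^ e)%N by rewrite divnK // pfactor_dvdnn.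
have e1 : (1 < e)%N by rewrite /e -pfactor_dvdn.
have odd_m : odd m.
  have := pfactor_coprime (isT : prime 2) d0; case=> m' cm' em'.
  suff -> : m = m' by rewrite -coprime2n.
  by rewrite /m {1}em' mulnK // expn_gt0.
have even_d : ~~ odd d by rewrite dE oddM oddX negb_and orbC; case: (e) e1.
have par_odd k : odd k -> ((k%:Z)%:~R : 'F_2) = 1.
  by move=> ok; apply/val_inj; rewrite /= -pmulrn Zp_nat /= modn2 ok.
have odd_n : odd (num_t d) by rewrite /num_t oddD oddX (negPf even_d).
have odd_b : odd (num_b d).
  have := congr1 odd (num_b_eq d).
  by rewrite oddD oddX (negPf even_d) addbF oddM oddD odd_n (negPf even_d).
have [M dM] : exists M : int, M = (num_t d * m)%N by eexists.
have [B dB] : exists B : int, B = - (num_b d)%:Z by eexists.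
have oM : (M%:~R : 'F_2) = 1 by rewrite dM par_odd // oddM odd_n odd_m.
have oB : (B%:~R : 'F_2) = 1.
  by rewrite dB rmorphN /= par_odd //; apply/val_inj.
have dE' : d%:R = m%:R * 2 ^+ e :> rat by rewrite {1}dE natrM natrX.
have h2 : 2 ^+ e != 0 :> rat by rewrite expf_neq0.
have hm : m%:R != 0 :> rat by apply: contraNneq dQ => m0; rewrite dE' m0 mul0r.
have bE : b = B%:~R / ((num_t d)%:R * m%:R * 2 ^+ e).
  have [eb0 _ _] := bpar_tpar d0.
  by rewrite /b /t eb0 (natrM rat) dE' mulrA dB rmorphN.
have ME : M%:~R = (num_t d)%:R * m%:R :> rat by rewrite dM -natrM.
have eb : b * 2 ^+ e * M%:~R = B%:~R.
  by rewrite bE ME; field; rewrite hm h2 nQ.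
apply: (val2_nontorsion e1 oB oM eb eP).
exists (4 ^+ e * M ^+ 2 + B * 2 ^+ e * M + B ^+ 2), (M ^+ 2).
have p0 : (2%:~R : 'F_2) = 0 by apply/val_inj.
have p2 : ((2 ^+ e)%:~R : 'F_2) = 0.
  by rewrite rmorphXn /= p0 expr0n; case: (e) e1.
have p4 : ((4 ^+ e)%:~R : 'F_2) = 0.
  have -> : 4 ^+ e = 2 ^+ e * 2 ^+ e :> int by rewrite -exprMn.
  by rewrite rmorphM /= p2 mul0r.
split.
- rewrite 2!rmorphD [X in X + _ + _]rmorphM [X in _ + X + _]rmorphM /= p4.
  rewrite [X in _ + X * _ + _]rmorphM /= p2 mul0r mulr0 mul0r !add0r.
  by rewrite rmorphXn /= oB expr1n.
- by rewrite rmorphXn /= oM expr1n.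
have hM : M%:~R != 0 :> rat by rewrite ME mulf_neq0.
have -> : b = B%:~R / (2 ^+ e * M%:~R) by rewrite -eb; field; rewrite h2 hM.
have e4 : 4 ^+ e = 2 ^+ e * 2 ^+ e :> rat by rewrite -exprMn.
have -> : (4 ^+ e * M ^+ 2 + B * 2 ^+ e * M + B ^+ 2)%:~R =
    4 ^+ e * M%:~R ^+ 2 + B%:~R * 2 ^+ e * M%:~R + B%:~R ^+ 2 :> rat.
  by rewrite !(rmorphD _ (_ + _), rmorphD _ (_ * _)) !(rmorphXn, rmorphM).
rewrite rmorphXn /= e4 /velu_x.
by field; rewrite h2 hM.
Qed.
End Tpar.

(** * Finiteness of the primes dividing an integer *)

Lemma infinite_injection (T : pointedType) (A : set T) : ~ finite_set A ->
  exists f : nat -> T, (forall i, A (f i)) /\ injective f.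
Proof.
move=> /infiniteP/pcard_leP[f]; exists f; split=> [i|i j].
  exact: 'funS_f.
by apply: 'inj_f; rewrite in_setT.
Qed.

Section PrimesAbove.
Variable K : fieldExtType rat.
Local Notation OK := (@ring_of_integers K).
Local Notation toK := (intr : int -> K).

Lemma OK_int (z : int) : OK z%:~R.
Proof. exact: (integral_id toK). Qed.

Lemma OK_mul x y : OK x -> OK y -> OK (x * y).
Proof. exact: integral_mul. Qed.

Lemma OK_horner (p : {poly int}) x : OK x -> OK (map_poly toK p).[x].
Proof.
move=> hx; apply: integral_horner => //.
by apply/integral_poly => i; rewrite coef_map; exact: integral_id.
Qed.

Lemma prime_of_int p l (z : int) : prime_of p -> prime l -> p (l%:R : K) ->
  p z%:~R -> (l%:Z %| z)%Z.
Proof.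
move=> hp pr_l pl pz; apply: contrapT => /negP nlz.
have cop : coprimez l%:Z z by rewrite coprimezE /= prime_coprime // -dvdzE.
have /coprimezP[[u v] /= uv] := cop.
apply: (prime_proper hp).
rewrite -[1]/(1%:~R) -uv rmorphD !rmorphM /=; apply: (prime_add hp).
  by apply: (prime_mul hp) => //; exact: OK_int.
by apply: (prime_mul hp) => //; exact: OK_int.
Qed.

(** Primes above the same rational prime are maximal ideals, so no inclusion
    between two of them is strict.  For [x] in the larger prime [p'], let an
    integral equation of [x] descend: its constant term is in [p'], hence a
    multiple of [l] and in [p], and if [x] is not in [p] the quotient by [x] is
    again a monic polynomial whose value lies in [p]. *)
Lemma prime_of_maximal p p' l : prime_of p -> prime_of p' -> prime l ->
  p (l%:R : K) -> p' l%:R -> p `<=` p' -> p' `<=` p.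
Proof.
move=> hp hp' pr_l pl pl' sub x p'x; apply: contrapT => npx.
have Ox := prime_sub hp' p'x.
have {Ox} [P0 mon_P0 root_P0] := Ox.
have : p (map_poly toK P0).[x] by rewrite (rootP root_P0); exact: prime_0.
elim/poly_ind: P0 mon_P0 {root_P0} => [|Q c IHQ] mon; first by move: mon;
  rewrite monicE lead_coef0 eq_sym oner_eq0.
rewrite rmorphD rmorphM /= map_polyX map_polyC hornerD hornerM hornerX hornerC
  => pQ.
have Ox := prime_sub hp' p'x.
have OQ := OK_horner Q Ox.
have [Q0|Qn0] := eqVneq Q 0.
  move: mon pQ; rewrite Q0 mul0r add0r monicE lead_coefC => /eqP->.
  by rewrite rmorph0 horner0 mul0r add0r; exact: prime_proper.
have pc : p (toK c).
  have p'c : p' (toK c).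
    have -> : toK c = ((map_poly toK Q).[x] * x + toK c) + (- 1)%:~R *
      ((map_poly toK Q).[x] * x).
      by rewrite mulN1r; ring.
    apply: (prime_add hp'); first exact: sub.
    by apply: (prime_mul hp'); [exact: OK_int|apply: (prime_mul hp')].
  have /dvdzP[z ->] := prime_of_int hp' pr_l pl' p'c.
  by rewrite rmorphM; apply: (prime_mul hp) => //; exact: OK_int.
have pQx : p ((map_poly toK Q).[x] * x).
  have -> : (map_poly toK Q).[x] * x =
    ((map_poly toK Q).[x] * x + toK c) + (- 1)%:~R * toK c.
    by rewrite mulN1r; ring.
  apply: (prime_add hp) => //.
  by apply: (prime_mul hp) => //; exact: OK_int.
have [pQ'|//] := prime_prime hp OQ Ox pQx.
apply: IHQ pQ'.
by move: mon; rewrite !monicE lead_coefDl ?lead_coefMX // size_polyC size_mulX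
  // ; case: (c == 0); rewrite ltnS // size_poly_gt0.
Qed.
End PrimesAbove.

Lemma rat_common_den n (k : 'I_n -> rat) :
  exists (D : rat) (z : 'I_n -> int), D != 0 /\ forall i, (z i)%:~R = k i * D.
Proof.
exists (\prod_j (denq (k j))%:~R), (fun i =>
  numq (k i) * \prod_(j | j != i) denq (k j)).
split; first by apply/prodf_neq0 => j _; rewrite intr_eq0 denq_neq0.
move=> i; rewrite rmorphM rmorph_prod [in RHS](bigD1 i) //= mulrA;
  congr (_ * _).
by rewrite -{2}(divq_num_den (k i)) divfK // intr_eq0 denq_neq0.
Qed.

Section FinitelyManyPrimes.
Variable K : fieldExtType rat.
Local Notation OK := (@ring_of_integers K).

Lemma prime_of_prod p n (y : 'I_n -> K) (P : pred 'I_n) : prime_of p ->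
  (forall i, P i -> OK (y i) /\ ~ p (y i)) ->
  OK (\prod_(i | P i) y i) /\ ~ p (\prod_(i | P i) y i).
Proof.
move=> hp hy; apply: (big_ind (fun x => OK x /\ ~ p x)) => //.
  by split; [exact: (integral1 (intr : int -> K))|exact: prime_proper].
move=> u v [Ou pu] [Ov pv]; split; first exact: OK_mul.
by move=> /(prime_prime hp Ou Ov) [].
Qed.

(** Elements that lie in all but one of a family of primes above [l] are
    linearly independent, so there are at most [\dim K] such primes. *)
Lemma finite_primes_above l : prime l ->
  finite_set [set p : set K | prime_of p /\ p l%:R].
Proof.
move=> pr_l; apply: contrapT => /infinite_injection[f [fA f_inj]].
pose n := (\dim {:K}).+1.
have fp i : prime_of (f i) := (fA i).1.
have fl i : f i l%:R := (fA i).2.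
have /choice[y hy] : forall ij : 'I_n * 'I_n, exists y, ij.1 != ij.2 ->
    f ij.1 y /\ ~ f ij.2 y.
  case=> i j /=; have [_|nij] := eqVneq i j; first by exists 0.
  apply: contrapT => no; case/eqP: nij; apply/val_inj/f_inj.
  have sub : f i `<=` f j.
    by move=> x fx; apply: contrapT => nfx; apply: no; exists x.
  by apply/seteqP; split => //;
    exact: prime_of_maximal (fp _) (fp _) pr_l (fl _) (fl _) sub.
pose x (i : 'I_n) := \prod_(j | j != i) y (j, i).
have x_out (i : 'I_n) : ~ f i (x i).
  apply: (proj2 (prime_of_prod (fp i) _)) => j ji.
  have [h1 h2] := hy (j, i) ji; split => //.
  exact: prime_sub (fp j) _ h1.
have xO (i : 'I_n) : OK (x i).
  apply: (proj1 (prime_of_prod (fp i) _)) => j ji.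
  have [h1 h2] := hy (j, i) ji; split => //.
  exact: prime_sub (fp j) _ h1.
have x_in (i j : 'I_n) : i != j -> f j (x i).
  move=> ij; rewrite /x (bigD1 j) 1?eq_sym //= mulrC; apply: (prime_mul (fp j)).
    apply: (proj1 (prime_of_prod (fp i) _)) => m /andP[mi _].
    have [h1 h2] := hy (m, i) mi; split => //.
    exact: prime_sub (fp m) _ h1.
  by have [] := hy (j, i); rewrite 1?eq_sym.
(* integral relations between the x i are divisible by every power of l *)
have divl (z : 'I_n -> int) : \sum_i (z i)%:~R * x i = 0 ->
    forall i, (l%:Z %| z i)%Z.
  move=> rel i; apply: (prime_of_int (fp i)) => //.
  have : f i ((z i)%:~R * x i).
    move: rel; rewrite (bigD1 i) //= => /(canRL (addrK _)) ->.
    rewrite sub0r -mulN1r; apply: (prime_mul (fp i)).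
      by have := OK_int K (-1).
    apply: (big_ind (f i)); [exact: prime_0|exact: prime_add|].
    by move=> j ji; apply: (prime_mul (fp i)); [exact: OK_int|exact: x_in].
  by move=> h; case: (prime_prime (fp i) (OK_int K _) (xO i) h) => [|/x_out].
have l0 : l%:Z != 0 by rewrite eqz_nat -lt0n prime_gt0.
have lK : l%:R != 0 :> K.
  rewrite -(rmorph_nat (in_alg K)) fmorph_eq0.
  by rewrite pnatr_eq0 -lt0n prime_gt0.
have divlm m : forall z : 'I_n -> int, \sum_i (z i)%:~R * x i = 0 ->
    forall i, ((l ^ m)%:Z %| z i)%Z.
  elim: m => [|m IHm] z rel i; first by rewrite expn0 dvd1z.
  have /choice[w zw] : forall i, exists w, z i = w * l%:Z.
    by move=> j; apply/dvdzP; exact: divl.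
  have relw : \sum_i (w i)%:~R * x i = 0.
    apply: (mulfI lK); rewrite mulr0 -[RHS]rel mulr_sumr; apply: eq_bigr => j _.
    by rewrite zw rmorphM /= mulrA (mulrC l%:R).
  by rewrite zw expnSr PoszM dvdz_mul2r ?l0 //; exact: IHm.
have z_eq0 (z : 'I_n -> int) : \sum_i (z i)%:~R * x i = 0 -> forall i, z i = 0.
  move=> rel i; apply/eqP; rewrite -absz_eq0; apply: contraT;
    rewrite -lt0n => zi.
  have := divlm `|z i|%N z rel i; rewrite dvdzE /= => /(dvdn_leq zi).
  by rewrite leqNgt ltn_expl // prime_gt1.
pose X : n.-tuple K := [tuple x i | i < n].
suff fX : free X.
  have : (size X <= \dim {:K})%N by rewrite -(eqP fX); apply: dimvS;
    exact: subvf.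
  by rewrite size_tuple ltnn.
apply/freeP => k relk i.
have [D [z [D0 hz]]] := rat_common_den k.
suff : z i = 0.
  by move/(congr1 (intr : int -> rat)); rewrite hz => /eqP;
    rewrite mulf_eq0 (negPf D0) orbF => /eqP.
apply: z_eq0; transitivity (D *: \sum_(j < n) k j *: X`_j).
  rewrite scaler_sumr; apply: eq_bigr => j _.
  rewrite scalerA (mulrC D) -hz -tnth_nth tnth_mktuple.
  by rewrite -mulr_algl -(rmorph_int (in_alg K)).
by rewrite relk scaler0.
Qed.

Lemma finite_primes_dividing N : (0 < N)%N ->
  finite_set [set p : set K | prime_of p /\ p N%:R].
Proof.
move=> N0; pose S := \bigcup_(l in [set` primes N]) [set p :
  set K | prime_of p /\ p l%:R].
have finS : finite_set S.
  apply: bigcup_finite => // l /=; rewrite mem_primes => /andP[pr_l _].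
  exact: finite_primes_above.
apply: sub_finite_set finS => p [hp pN].
suff [l lN pl] : exists2 l, l \in primes N & p l%:R by exists l.
have [m] := ubnP N; elim: m N N0 pN {S} => // m IHm N N0 pN Nm.
have [N1|Ngt1] := leqP N 1.
  have N_1 : N = 1%N by apply/eqP; rewrite eqn_leq N1.
  by case: (prime_proper hp); rewrite N_1 in pN.
have pr := pdiv_prime Ngt1; have dv := pdiv_dvd N.
have OKn n : OK n%:R by exact: (integral_nat (intr : int -> K)).
have : p ((N %/ pdiv N)%:R * (pdiv N)%:R) by rewrite -natrM divnK.
case/(prime_prime hp (OKn _) (OKn _)) => [pq|pl]; last first.
  by exists (pdiv N) => //; rewrite mem_primes pr N0.
have q0 : (0 < N %/ pdiv N)%N by rewrite divn_gt0 ?pdiv_gt0 // pdiv_leq.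
have [|l lq pl] := IHm _ q0 pq.
  by rewrite ltnS in Nm; apply: leq_trans Nm; rewrite ltn_Pdiv ?prime_gt1.
exists l => //; move: lq; rewrite !mem_primes N0 q0 => /and3P[-> _ lq] /=.
by apply: dvdn_trans lq (dvdn_div dv).
Qed.
End FinitelyManyPrimes.

(** * The special point is not a triple *)

(** On the source curve the ordinate of [R *+ 3] is a cube: it is the function
    with divisor [3 T3 - 3 O] pulled back by multiplication by 3.  Its cube root
    is a function of the image of [R] under the isogeny. *)
Lemma triple_y_cube (F : fieldType) (b x y l m : F) :
  x != 0 -> oncurve (tri 1 b) x y ->
  2 * y + x + b != 0 -> l * (2 * y + x + b) = 3 * x ^+ 2 - y ->
  let x2 := l ^+ 2 + l - x - x in
  let y2 := - (l + 1) * x2 - (y - l * x) - b in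
  x2 - x != 0 -> m * (x2 - x) = y2 - y ->
  let x3 := m ^+ 2 + m - x - x2 in
  let y3 := - (m + 1) * x3 - (y - m * x) - b in
  3 * velu_x 1 b x + 1 != 0 /\
  y3 = ((velu_y 1 b x y - 4 * b) / (3 * velu_x 1 b x + 1)) ^+ 3.
Proof.
move=> nx hc; have [ny _] := tri_neq0 nx hc.
have hy := iffLR (oncurve_tri 1 b x y) hc.
have [lam nlam ey] : exists2 lam, lam != 0 & y = lam * x.
  by exists (y / x); rewrite ?divfK // mulf_neq0 ?invr_eq0.
have eb : b = x * (x - lam ^+ 2 - lam) / lam.
  transitivity ((x ^+ 3 - y * (y + 1 * x)) / y); first by rewrite -hy; field.
  by rewrite ey; field; rewrite nlam nx.
move=> eta0 hl x2 y2 nx2 hm x3 y3.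
have el : l = (3 * x ^+ 2 - y) / (2 * y + x + b) by rewrite -hl mulfK.
have em : m = (y2 - y) / (x2 - x) by rewrite -hm mulfK.
have eta' : x + lam ^+ 2 != 0.
  apply: contraNneq eta0 => e; rewrite ey eb; apply/eqP.
  transitivity (x * (x + lam ^+ 2) / lam); first by field.
  by rewrite e mulr0 mul0r.
pose D := 3 * x ^+ 2 - 3 * lam ^+ 2 * x - 3 * lam * x + 3 * lam ^+ 3
  + lam ^+ 2 + 3 * lam ^+ 4.
have eta1 : 2 * y + x + b = x * (x + lam ^+ 2) / lam by rewrite ey eb; field.
have el' : l = lam * (3 * x - lam) / (x + lam ^+ 2).
  by rewrite el eta1 ey; field; rewrite eta' nlam nx.
have ex2 : x2 - x = - (x * D) / (x + lam ^+ 2) ^+ 2.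
  by rewrite /x2 el' /D; field.
have nD : D != 0 by apply: contraNneq nx2 => D0;
  rewrite ex2 D0 mulr0 oppr0 mul0r.
have eX : 3 * velu_x 1 b x + 1 = D / lam ^+ 2.
  by rewrite /velu_x eb /D; field; rewrite nx nlam.
split; first by rewrite eX mulf_neq0 ?invr_eq0 ?expf_neq0.
rewrite eX /y3 /x3 em ex2 /y2 (_ : x2 = x - (x * D) / (x + lam ^+ 2) ^+ 2);
  last first.
  by rewrite -mulNr -ex2; ring.
rewrite el' /velu_y eb ey; move: nD; rewrite /D => nD.
by field; rewrite nlam nD nx eta' oppr_eq0 mulf_neq0.
Qed.

Lemma triple_cube (F : fieldType) (b : F) (ell : elliptic (tri 1 b))
    (R : epoint (triC ell)) :
  phi R != 0 -> R *+ 2 != 0 -> R *+ 3 != 0 ->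
  exists X Y x3, [/\ epval (phi R) = Some (X, Y), 3 * X + 1 != 0 &
    epval (R *+ 3) = Some (x3, ((Y - 4 * b) / (3 * X + 1)) ^+ 3)].
Proof.
move=> phiR R2 R3; case eR: (epval R) => [[x y]|]; last first.
  by case/eqP: R2; rewrite (_ : R = 0) ?mul0rn //; apply: epval_inj.
have nx : x != 0.
  by apply: contra_neq phiR => x0; apply: epval_inj;
    rewrite phi_val eR /= x0 eqxx.
have := epointP R; rewrite eR => /oncurveP h.
have eRR := epvalD R R; rewrite eR in eRR.
case: paddP eRR => // [_ _ e|l cc hn e2]; first by case/eqP: R2;
  exact: epval_inj.
have hl : l * (2 * y + x + b) = 3 * x ^+ 2 - y.
  by case: cc => _ /= cc; transitivity (l * (y + y + 1 * x + b));
    [ring|rewrite cc; ring].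
have eta0 : 2 * y + x + b != 0.
  by move: hn; rewrite eqxx /=; apply: contraNneq => e; rewrite -[0]e;
    apply/eqP; ring.
have := epointP (R + R); rewrite e2 => /oncurveP h2.
have e3 : epval (R *+ 3) = padd (triC ell) (epval R) (epval (R + R))
  by rewrite mulrS mulr2n.
have nx2 : third_x (triC ell) l x x - x != 0.
  rewrite subr_eq0; apply/eqP => ex; move: e2; rewrite /chord_sum ex => e2.
  case: (epoint_same_x e2 eR) => [e|e].
    have R0 : R = 0 by apply: (addrI R); rewrite e addr0.
    by case/eqP: R2; rewrite R0 mul0rn.
  by case/eqP: R3; rewrite mulrS mulr2n e subrr.
move: e3; rewrite eR e2.
rewrite /chord_sum; set x2 := third_x _ _ _ _ in nx2 h2 *.
set y2 := (X in Some (x2, X)) in h2 *.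
case: (paddP h h2) => // [_ _ e|m cm _ e]; first by case/eqP: R3;
  exact: epval_inj.
have hm : m * (x2 - x) = y2 - y by case: cm.
have ex2 : x2 = l ^+ 2 + l - x - x by rewrite /x2 /third_x /=; ring.
have ey2 : y2 = - (l + 1) * (l ^+ 2 + l - x - x) - (y - l * x) - b.
  by rewrite -ex2 /y2 /=.
rewrite ex2 ey2 in hm nx2.
have [X0 Y0] := triple_y_cube nx h eta0 hl nx2 hm.
exists (velu_x 1 b x), (velu_y 1 b x y), (third_x (triC ell) m x x2).
split => //; first by rewrite phi_val eR velu_ptE.
have E3 : third_x (triC ell) m x x2 = m ^+ 2 + m - x - (l ^+ 2 + l - x - x).
  by rewrite /third_x /= ex2; ring.
by rewrite -Y0 -E3 e.
Qed.

(** The preimages of [P] have ordinates [t], [- b ^ 2 t] and [- b / t ^ 2].  The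
    last two are cubes if and only if [b / t] and [b t] are, respectively. *)
Lemma not_triple (K : fieldType) (L : closedFieldType) (iota : {rmorphism K ->
  L})
    (t : K) (ell : elliptic (tri 1 (bpar t))) (P R : epoint (velC ell)) :
  let b := bpar t in t != 0 ->
  ~ is_cube t -> ~ is_cube (b * t) -> ~ is_cube (b / t) ->
  epval P = special_point t -> (forall n, (0 < n)%N -> P *+ n != 0) ->
  P <> R *+ 3.
Proof.
move=> b t0 ct cbt cbdt eP tors PR.
have b0 : b != 0 by have [] := andP (etrans (esym (elliptic_tri 1 b)) ell).
have ellL : elliptic (tri 1 (iota b)).
  by rewrite -(rmorph1 iota) -map_tri elliptic_map.
have mV : map_weierstrass iota (velC ell) = velC ellL.
  by rewrite map_vel rmorph1.
pose inc : epoint (velC ell) -> epoint (velC ellL) := ep_map mV.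
have incMn S n : inc (S *+ n) = inc S *+ n by exact: raddfMn.
have inc_inj : injective inc by exact: ep_map_inj.
have inc0 : inc 0 = 0 by exact: raddf0.
have [R' eR'] := phi_surjective (inc R).
have Rn n : (0 < n)%N -> R' *+ n != 0.
  move=> n0; apply: contra_neq (tors _ n0) => e.
  have : inc (R *+ n) = 0 by rewrite incMn -eR' -raddfMn e raddf0.
  by rewrite -inc0 => /inc_inj e'; rewrite PR -mulrnA mulnC mulrnA e' mul0rn.
have phiR : phi R' != 0.
  apply: contra_neq (tors 1 isT); rewrite eR' -inc0 => /inc_inj R0.
  by rewrite PR R0 !mul0rn.
have [X [Y [x3 [eXY nX e3]]]] := triple_cube phiR (Rn 2 isT) (Rn 3 isT).
have hQ : Some (1, iota t) \in points (triC ellL).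
  have := points_map iota (bpar_oncurve t0).
  by rewrite map_tri /= rmorph1.
pose Q : epoint (triC ellL) := EPoint hQ.
have [n eS] : exists n, R' *+ 3 = Q + T3 ellL *+ n.
  apply: phi_fibre; rewrite raddfMn /= eR' -incMn -PR; apply: epval_inj.
  by rewrite phi_val /= eP special_point_velu // map_velu_pt /= rmorph1.
(* the cube root (Y - 4 b) / (3 X + 1) is defined over K *)
have [g eg] : exists g, (Y - 4 * iota b) / (3 * X + 1) = iota g.
  move: eXY; rewrite eR' /=; case: (epval R) => [[X0 Y0]|] //= [<- <-].
  exists ((Y0 - 4 * b) / (3 * X0 + 1)).
  by rewrite [RHS]fmorph_div; congr (_ / _); ring.
have eQ : epval Q = Some (1, iota t) by [].
move: e3; rewrite eS eg.
case: (T3n_cases ellL n) => ->.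
- rewrite addr0 eQ => -[_ e]; apply: ct; exists g; apply: (fmorph_inj iota).
  by rewrite rmorphXn.
- rewrite (addT3 eQ (oner_neq0 _)) => -[_ e]; apply: cbdt; exists (- b / g).
  have eg3 : g ^+ 3 = - (b ^+ 2 * t).
    apply: (fmorph_inj iota); rewrite rmorphXn -e /=.
    by field; rewrite ?oner_eq0.
  have g0 : g != 0.
    apply/eqP => g0; move/eqP: eg3; rewrite g0 expr0n eq_sym oppr_eq0.
    by rewrite mulf_eq0 expf_eq0 (negPf b0) (negPf t0).
  have -> : (- b / g) ^+ 3 = - b ^+ 3 / g ^+ 3 by field.
  by rewrite eg3; field; rewrite t0 oppr_eq0 mulf_neq0 // expf_neq0.
rewrite (subT3 eQ (oner_neq0 _)) => -[_ e]; apply: cbt; exists (- (g * t)).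
have eg3 : g ^+ 3 = - (b / t ^+ 2).
  apply: (fmorph_inj iota); rewrite rmorphXn -e /=.
  by field; rewrite ?fmorph_eq0 ?t0 ?oner_eq0.
have -> : (- (g * t)) ^+ 3 = - (g ^+ 3 * t ^+ 3) by ring.
by rewrite eg3; field.
Qed.

(** * Incomplete rational 3-torsion *)

(** The point below is a flex with tangent of slope [3 u].  Modulo [u ^ 3 = b]
    its abscissa [w] satisfies [w - 3 w ^ 2 + 18 b = (1 - 27 b) u], so [u] is in
    [K] if [w] is. *)
Lemma not_condB (K : fieldType) (L : closedFieldType)
    (iota : {rmorphism K -> L}) (b : K) :
  elliptic (tri 1 b) -> ~ is_cube b -> ~ condB iota (vel 1 b).
Proof.
move=> ell cb B; apply: cb.
have [b0 d0] := andP (etrans (esym (elliptic_tri 1 b)) ell).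
rewrite expr1n in d0.
have ellL : elliptic (tri 1 (iota b)).
  by rewrite -(rmorph1 iota) -map_tri elliptic_map.
have [u] := @GRing.solve_monicpoly L 3 (nth 0 [:: iota b]) isT.
rewrite !big_ord_recl big_ord0 /= expr0 !mulr1 !mul0r !addr0 => hu.
have mV : map_weierstrass iota (vel 1 b) = velC ellL by rewrite map_vel rmorph1.
have u0 : u != 0.
  by apply: contraNneq b0 => u0; move/eqP: hu;
    rewrite u0 expr0n /= eq_sym fmorph_eq0.
have du : 1 + 3 * u + 9 * u ^+ 2 != 0.
  apply: contraNneq d0 => e; rewrite -(fmorph_eq0 iota); apply/eqP.
  transitivity ((1 - 3 * u) * (1 + 3 * u + 9 * u ^+ 2));
    last by rewrite e mulr0.
  have -> : iota (1 - 27 * b) = 1 - 27 * iota b by ring.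
  by rewrite -hu; ring.
have hW : oncurve (velC ellL) (u + 3 * u ^+ 2) (4 * u ^+ 3).
  by apply/oncurve_vel; rewrite -hu; ring.
have WE : Some (u + 3 * u ^+ 2, 4 * u ^+ 3) \in points (velC ellL)
  by apply/oncurveP.
pose W : epoint (velC ellL) := EPoint WE.
have WW : W + W = - W.
  apply: epval_inj; rewrite epvalD epvalN /=.
  rewrite [LHS](@padd_chord _ (velC ellL) (3 * u)) //.
  - by rewrite /chord_sum /third_x /=; congr Some; congr pair; rewrite -?hu;
    ring.
  - by split; rewrite /= -?hu; ring.
  apply/orP; right; rewrite /= -hu.
  by rewrite (_ : _ + _ = u * (1 + 3 * u + 9 * u ^+ 2)) ?mulf_neq0 //; ring.
have hB1 : epval W \in points (map_weierstrass iota (vel 1 b)).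
  by rewrite mV; exact: WE.
have hB2 : pmul (map_weierstrass iota (vel 1 b)) 3 (epval W) = None.
  by rewrite mV -epvalMn mulrS mulr2n WW subrr.
have [[[w v]|] _ //= [ew _]] := B _ hB1 hB2.
exists ((w - 3 * w ^+ 2 + 18 * b) / (1 - 27 * b)); apply: (fmorph_inj iota).
have d0' : 1 - 27 * iota b != 0.
  by rewrite (_ : _ - _ = iota (1 - 27 * b)) ?fmorph_eq0 //; ring.
rewrite rmorphXn -[in LHS]hu; congr (_ ^+ 3); apply: (mulIf d0').
have -> : iota ((w - 3 * w ^+ 2 + 18 * b) / (1 - 27 * b)) =
   (iota w - 3 * iota w ^+ 2 + 18 * iota b) / (1 - 27 * iota b).
  by rewrite fmorph_div; congr (_ / _); ring.
by rewrite divfK // -ew -hu; ring.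
Qed.

(** * The isogeny by homogeneous forms *)

Section VeluForms.
Variables (K L : fieldType) (iota : {rmorphism K -> L}) (c : K).

Let X : {mpoly K[3]} := 'X_(@Ordinal 3 0 isT).
Let Y : {mpoly K[3]} := 'X_(@Ordinal 3 1 isT).
Let Z : {mpoly K[3]} := 'X_(@Ordinal 3 2 isT).

(** Homogeneous forms giving the isogeny on the whole curve: the equation
    [x ^ 3 = y z (y + x + c z)] has been used to cancel the common factor [z]
    of the obvious forms of degree 4, which all vanish at infinity. *)
Definition velu_forms (i : 'I_3) : {mpoly K[3]} := nth 0
  [:: X * Y * (Y + X + c *: Z) + c *: (X * X * Z) + c ^+ 2 *: (X * Z * Z);
      Y * Y * (Y + X + c *: Z) - c ^+ 2 *: (Z * Z * (Y + Y + X + c *: Z))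
      - c *: (Z * X * (X + Y)) - c ^+ 2 *: (Z * Z * X);
      Z * Y * (Y + X + c *: Z)] i.

Lemma velu_forms_homog i : velu_forms i \is 3.-homog.
Proof.
have hX : X \is 1.-homog by rewrite /X dhomogX; exact/eqP/mdeg1.
have hY : Y \is 1.-homog by rewrite /Y dhomogX; exact/eqP/mdeg1.
have hZ : Z \is 1.-homog by rewrite /Z dhomogX; exact/eqP/mdeg1.
have hM p q r : p \is 1.-homog -> q \is 1.-homog -> r \is 1.-homog ->
    (p * q * r : {mpoly K[3]}) \is 3.-homog.
  by move=> hp hq hr; apply: (dhomogM (dhomogM hp hq) hr).
have hL : Y + X + c *: Z \is 1.-homog by rewrite !rpredD // rpredZ.
have hL' : Y + Y + X + c *: Z \is 1.-homog by rewrite !rpredD // rpredZ.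
have hXY : X + Y \is 1.-homog by rewrite rpredD.
case: i => [[|[|[|//]]] ?]; rewrite /velu_forms /=.
- by rewrite !rpredD ?rpredZ ?hM.
- by rewrite !rpredB ?rpredZ ?hM // rpredD.
by rewrite hM.
Qed.

Lemma velu_forms_eval v i :
  (map_mpoly iota (velu_forms i)).@[v] = nth 0
  (let x := v (@Ordinal 3 0 isT) in let y := v (@Ordinal 3 1 isT) in
   let z := v (@Ordinal 3 2 isT) in let e := iota c in
   [:: x * y * (y + x + e * z) + e * (x * x * z) + e ^+ 2 * (x * z * z);
       y * y * (y + x + e * z) - e ^+ 2 * (z * z * (y + y + x + e * z))
         - e * (z * x * (x + y)) - e ^+ 2 * (z * z * x);
       z * y * (y + x + e * z)]) i.
Proof.
pose ev p := (map_mpoly iota p).@[v].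
have evX j : ev 'X_j = v j by rewrite /ev map_mpolyX mevalXU.
have evD p q : ev (p + q) = ev p + ev q by rewrite /ev rmorphD /= mevalD.
have evB p q : ev (p - q) = ev p - ev q by rewrite /ev rmorphB /= mevalB.
have evM p q : ev (p * q) = ev p * ev q by rewrite /ev rmorphM /= mevalM.
have evZ e p : ev (e *: p) = iota e * ev p by rewrite /ev map_mpolyZ mevalZ.
rewrite -/(ev _); case: i => [[|[|[|//]]] ?]; rewrite /velu_forms /=;
  by rewrite !(evB, evD, evM, evZ) !evX ?rmorphXn.
Qed.
End VeluForms.

Section ConditionC.
Variables (K : fieldType) (L : closedFieldType) (iota : {rmorphism K -> L}).
Variables (b t : K) (t0 : t != 0) (bt : b = bpar t) (ell : elliptic (tri 1 b)).

Let ellL : elliptic (tri 1 (iota b)).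
Proof. by rewrite -(rmorph1 iota) -map_tri elliptic_map. Qed.

Let mT : map_weierstrass iota (tri 1 b) = tri 1 (iota b).
Proof. by rewrite map_tri rmorph1. Qed.

Let mV : map_weierstrass iota (vel 1 b) = vel 1 (iota b).
Proof. by rewrite map_vel rmorph1. Qed.

Lemma proportional_vec3 (v w : 'I_3 -> L) (e : L) : e != 0 ->
  v (@Ordinal 3 0 isT) = e * w (@Ordinal 3 0 isT) ->
  v (@Ordinal 3 1 isT) = e * w (@Ordinal 3 1 isT) ->
  v (@Ordinal 3 2 isT) = e * w (@Ordinal 3 2 isT) -> proportional v w.
Proof.
move=> e0 h0 h1 h2; exists e => // i.
have [||] : [\/ i = @Ordinal 3 0 isT, i = @Ordinal 3 1 isT | i =
  @Ordinal 3 2 isT].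
  by case: i => [[|[|[|//]]] ?]; [constructor 1|constructor 2|constructor 3];
    apply/val_inj.
- by move->.
- by move->.
by move->.
Qed.

Let velu_forms_prop Q : Q \in points (tri 1 (iota b)) ->
  proportional (forms_at iota (velu_forms b) Q) (hcoord (velu_pt 1 (iota b) Q)).
Proof.
have [c0 _] := andP (etrans (esym (elliptic_tri 1 (iota b))) ellL).
case: Q => [[x y]|] hQ; last first.
  apply: (@proportional_vec3 _ _ 1);
    rewrite ?oner_eq0 // /forms_at velu_forms_eval /hcoord /=; ring.
have h := oncurveP _ _ _ hQ; have hy := iffLR (oncurve_tri 1 (iota b) x y) h.
have [x0|nx] := eqVneq x 0.
  have hy0 : y * (y + iota b) = 0 by move: hy; rewrite x0 mulr0 addr0 expr0n.
  rewrite /= x0 eqxx.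
  pose e := - (iota b ^+ 2 * (2 * y + iota b)).
  apply: (@proportional_vec3 _ _ e).
  - rewrite oppr_eq0 mulf_neq0 ?expf_neq0 //; move/eqP: hy0; rewrite mulf_eq0.
    case/orP => /eqP y0; first by rewrite y0 mulr0 add0r.
    have -> : 2 * y + iota b = y + (y + iota b) by ring.
    by rewrite y0 addr0; move/eqP: y0; rewrite addr_eq0 => /eqP->;
      rewrite oppr_eq0.
  - by rewrite /forms_at velu_forms_eval /hcoord /=; ring.
  - rewrite /forms_at velu_forms_eval /hcoord /= /e.
    transitivity (y * (y * (y + iota b)) - iota b ^+ 2 * (2 * y + iota b)).
      by ring.
    by rewrite hy0; ring.
  - rewrite /forms_at velu_forms_eval /hcoord /=.
    by transitivity (y * (y + iota b)); [ring|rewrite hy0 mulr0].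
apply: (@proportional_vec3 _ _ (x ^+ 3)); first by rewrite expf_neq0.
- rewrite /forms_at velu_forms_eval velu_ptE // /hcoord /= /velu_x.
  transitivity (x * (y * (y + 1 * x + iota b)) + iota b * x ^+ 2
    + iota b ^+ 2 * x); first by ring.
  by rewrite hy; field.
- rewrite /forms_at velu_forms_eval velu_ptE // /hcoord /= /velu_y.
  transitivity (y * (y * (y + 1 * x + iota b))
    - iota b ^+ 2 * (2 * y + x + iota b) - iota b * x * (x + y)
    - iota b ^+ 2 * x); first by ring.
  by rewrite hy; field.
rewrite /forms_at velu_forms_eval velu_ptE // /hcoord /= mulr1 -hy.
by ring.
Qed.

Lemma velu_isogeny : isogeny iota (tri 1 b) (vel 1 b) (velu_pt 1 (iota b)).
Proof.
split => //; rewrite ?mT ?mV.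
- by move=> Q hQ; exact: (epointP (phi (@EPoint _ (triC ellL) Q hQ))).
- exists (Some (1, iota t)); last by rewrite velu_ptE ?oner_eq0.
  by have := points_map iota (bpar_oncurve t0); rewrite -bt mT /= rmorph1.
move=> Q hQ; exists 3, (velu_forms b); split; first exact: velu_forms_homog.
  have [e e0 hv] := velu_forms_prop hQ.
  case eQ: (velu_pt 1 (iota b) Q) => [[x y]|]; rewrite eQ in hv.
    by exists (@Ordinal 3 2 isT); rewrite hv /hcoord /= mulr1.
  by exists (@Ordinal 3 1 isT); rewrite hv /hcoord /= mulr1.
by move=> R hR _; exact: velu_forms_prop.
Qed.

Lemma velu_condC : condC iota (vel 1 b) (special_point t).
Proof.
exists (tri 1 b), (velu_pt 1 (iota b)), (Some (0, 0)); split => //.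
- exact: velu_isogeny.
- split; first exact: (epointP (T3 ell)).
  have pm n : pmul (tri 1 b) n (Some (0, 0)) = epval (T3 ell *+ n)
    by rewrite epvalMn.
  split => // [|m /andP[m0 m3]]; first by rewrite pm T3_triple.
  rewrite pm; case: m m0 m3 => [|[|[|//]]] // _ _.
  by rewrite mulr2n T3_double epvalNT3.
- move=> Q; rewrite mT => hQ; pose Q' := @EPoint L (triC ellL) Q hQ.
  pose inc : epoint (triC ell) -> epoint (triC ellL) :=
    @ep_map _ _ iota (triC ell) (triC ellL) mT.
  have incT n : inc (T3 ell *+ n) = T3 ellL *+ n.
    have incT1 : inc (T3 ell) = T3 ellL by apply: epval_inj;
      rewrite /= !rmorph0.
    by rewrite -incT1; exact: raddfMn.
  have val n : map_pt iota (pmul (tri 1 b) n (Some (0, 0))) =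
    epval (T3 ellL *+ n).
    by rewrite -incT -[RHS]/(map_pt iota (epval (T3 ell *+ n))) epvalMn.
  split=> [h|[n]].
    have [n e] : exists n, Q' = T3 ellL *+ n by apply: phi_eq0n;
      apply: epval_inj.
    by exists n; rewrite val -e.
  rewrite val => ->; have : phi (T3 ellL *+ n) = 0
    by rewrite raddfMn /= phiT mul0rn.
  by move/(congr1 (@epval _ _)).
exists (Some (1, t)); first by rewrite bt bpar_oncurve.
by rewrite special_point_velu // -bt map_velu_pt rmorph1.
Qed.
End ConditionC.

(** * Local imprimitivity *)

Lemma rho_int (K : fieldExtType rat) (p : set K) (k : finFieldType)
  (rho : K -> k) (z : int) : residue_field p rho -> rho z%:~R = z%:~R.
Proof.
case=> r1 rD _ _ _; have OKi := @OK_int K.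
have r0 : rho 0 = 0.
  by apply: (addrI (rho 0)); rewrite addr0 -rD ?addr0 //; exact: (OKi 0).
have rN (m : nat) : rho m%:R = m%:R.
  elim: m => // m IHm; rewrite mulrS rD ?r1 ?IHm -?mulrS //.
    exact: (OKi 1).
  exact: (OKi m).
case: z => m; first exact: rN.
rewrite NegzE !rmorphN; apply: (addrI (rho m.+1%:R)).
rewrite -rD; [|exact: (OKi m.+1)|by have := OKi (- m.+1%:Z); rewrite rmorphN].
by rewrite subrr r0 rN subrr.
Qed.

Section GoodReduction.
Variables (K : fieldExtType rat) (h B n d : int) (t : K).
Hypothesis hE : h = n * d.
Hypothesis BE : B = - (n ^+ 2 + n * d - d ^+ 2).
Hypothesis dK : d%:~R != 0 :> K.
Hypothesis nK : n%:~R != 0 :> K.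
Hypothesis tE : t = n%:~R / d%:~R.
Local Notation OK := (@ring_of_integers K).
Local Notation b := (bpar t).

Let hK : h%:~R != 0 :> K. Proof. by rewrite hE rmorphM mulf_neq0. Qed.
Let bE : b = B%:~R / h%:~R.
Proof.
rewrite BE hE rmorphN rmorphB rmorphD !(rmorphXn, rmorphM) /= /bpar tE.
by field; rewrite nK dK.
Qed.

(** Scaling the coordinates by [h ^ 2] and [h ^ 3] turns [vel 1 (B / h)] into
    [vel h (B h ^ 2)], a member of the same family with integer parameters; so
    the isogeny reduces modulo every prime that does not contain the
    discriminant. *)
Definition int_model : chvar K := Chvar (h%:~R)^-1 0 0 0.

Lemma int_modelE :
  chvar_curve int_model (Ecurve b) = vel h%:~R (B%:~R * h%:~R ^+ 2).
Proof.
rewrite bE /vel /int_model /chvar_curve /=; move: hK;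
  move: (h%:~R : K) (B%:~R : K).
move=> h' B' h0; by congr Weierstrass; field; rewrite h0 oner_eq0.
Qed.

Definition disc_int : int :=
  B * h ^+ 2 * (h ^+ 3 - 27 * (B * h ^+ 2)) ^+ 3.

Lemma wdisc_vel_int (R : fieldType) :
  wdisc (vel (h%:~R : R) (B%:~R * h%:~R ^+ 2)) = disc_int%:~R.
Proof.
have -> : disc_int%:~R =
  B%:~R * h%:~R ^+ 2 * (h%:~R ^+ 3 - 27 * (B%:~R * h%:~R ^+ 2)) ^+ 3 :> R.
  by rewrite /disc_int; ring.
by rewrite /wdisc /vel; ring.
Qed.

Let a4 : int := - (5 * h * (B * h ^+ 2)).
Let a6 : int := - (h ^+ 3 * (B * h ^+ 2) + 7 * (B * h ^+ 2) ^+ 2).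

Let vel_int (R : fieldType) : vel (h%:~R : R) (B%:~R * h%:~R ^+ 2) =
  Weierstrass h%:~R 0%:~R (B * h ^+ 2)%:~R a4%:~R a6%:~R.
Proof. by rewrite /vel /a4 /a6; congr Weierstrass; ring. Qed.

Let X : int := h ^+ 2 + h * B + B ^+ 2.
Let Y : int := h ^+ 2 * n ^+ 2 - B ^+ 2 * (2 * n ^+ 2 + h + B)
  - B * (h ^+ 2 + h * n ^+ 2) - h * B ^+ 2.

Let point_int : chvar_pt int_model (special_point t) = Some (X%:~R, Y%:~R).
Proof.
have t0 : t != 0 by rewrite tE mulf_neq0 ?invr_eq0.
rewrite special_point_velu // velu_ptE ?oner_eq0 // /= subr0 mul0r !subr0.
have hE' : h%:~R = n%:~R * d%:~R :> K by rewrite hE rmorphM.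
congr Some; congr pair; rewrite /velu_x /velu_y bE /X /Y.
  have -> : (h ^+ 2 + h * B + B ^+ 2)%:~R =
    h%:~R ^+ 2 + h%:~R * B%:~R + B%:~R ^+ 2 :> K.
    by ring.
  by move: hK; move: (h%:~R : K) (B%:~R : K) => h' B' h0; field;
    rewrite h0 oner_eq0.
have -> : (h ^+ 2 * n ^+ 2 - B ^+ 2 * (2 * n ^+ 2 + h + B)
  - B * (h ^+ 2 + h * n ^+ 2) - h * B ^+ 2)%:~R =
    h%:~R ^+ 2 * n%:~R ^+ 2 - B%:~R ^+ 2 * (2 * n%:~R ^+ 2 + h%:~R + B%:~R)
  - B%:~R * (h%:~R ^+ 2 + h%:~R * n%:~R ^+ 2) - h%:~R * B%:~R ^+ 2 :> K.
  by ring.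
move: nK dK; rewrite tE hE';
  move: (n%:~R : K) (d%:~R : K) (B%:~R : K) => n' d' B' n0 d0'.
by field; rewrite n0 d0' oner_eq0.
Qed.

(** Both coordinates of the scaled special point are given by Velu's formulas
    over any field where [h] is not zero, so its reduction is the image of a
    point with coordinates in the residue field. *)
Let reduced_point (k : fieldType) : (h%:~R : k) != 0 ->
  (X%:~R = velu_x (h%:~R : k) (B%:~R * h%:~R ^+ 2) (h%:~R ^+ 2)) /\
  (Y%:~R = velu_y (h%:~R : k) (B%:~R * h%:~R ^+ 2) (h%:~R ^+ 2)
     (h%:~R ^+ 2 * n%:~R ^+ 2)).
Proof.
move=> h0.
have -> : X%:~R = h%:~R ^+ 2 + h%:~R * B%:~R + B%:~R ^+ 2 :> k by rewrite /X;
  ring.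
have -> : Y%:~R = h%:~R ^+ 2 * n%:~R ^+ 2 - B%:~R ^+ 2 * (2 * n%:~R ^+ 2 +
  h%:~R + B%:~R)
  - B%:~R * (h%:~R ^+ 2 + h%:~R * n%:~R ^+ 2) - h%:~R * B%:~R ^+ 2 :> k.
  by rewrite /Y; ring.
move: h0; rewrite /velu_x /velu_y; move: (h%:~R : k) (B%:~R : k) (n%:~R : k).
by move=> h' B' n' h0; split; field; rewrite h0.
Qed.

Let reduced_oncurve (k : fieldType) :
  oncurve (tri (h%:~R : k) (B%:~R * h%:~R ^+ 2)) (h%:~R ^+ 2)
    (h%:~R ^+ 2 * n%:~R ^+ 2).
Proof.
apply/oncurve_tri.
have -> : B%:~R = - (n%:~R ^+ 2 + n%:~R * d%:~R - d%:~R ^+ 2) :> k.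
  by rewrite BE; ring.
have -> : h%:~R = n%:~R * d%:~R :> k by rewrite hE; ring.
by ring.
Qed.

Lemma divides_index_away (p : set K) : prime_of p -> ~ p disc_int%:~R ->
  divides_index_at 3 (Ecurve b) (special_point t) p.
Proof.
move=> hp pdisc k rho hrho; have ri z := rho_int z hrho.
have OKi := @OK_int K.
have discE : wdisc (vel (h%:~R : k) (B%:~R * h%:~R ^+ 2)) != 0.
  rewrite wdisc_vel_int -ri; apply/eqP => /(residue_ker hrho (OKi _)).
  exact: pdisc.
have ell : elliptic (tri (h%:~R : k) (B%:~R * h%:~R ^+ 2)).
  by rewrite -elliptic_vel.
have h0 : (h%:~R : k) != 0.
  have [] := andP (etrans (esym (elliptic_tri _ _)) ell).
  by rewrite mulf_eq0 expf_eq0 negb_or => /andP[].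
have hQ : Some (h%:~R ^+ 2, h%:~R ^+ 2 * n%:~R ^+ 2) \in points (triC ell).
  by apply/oncurveP; exact: reduced_oncurve.
pose Q : epoint (triC ell) := EPoint hQ.
have eP : epval (phi Q) = Some (X%:~R, Y%:~R).
  have [-> ->] := reduced_point h0.
  by rewrite phi_val velu_ptE // expf_neq0.
exists int_model, (Some (X%:~R, Y%:~R)); split.
- rewrite /good_model int_modelE wdisc_vel_int vel_int; split => //;
  last by split; exact: OKi.
  by rewrite /= invr_eq0.
- exists (hcoord (chvar_pt int_model (special_point t))).
  rewrite point_int; split.
  + by exists 1; rewrite ?oner_eq0 // => i; rewrite mul1r.
  + case=> [[|[|[|//]]] ?] /=; [exact: OKi|exact: OKi|exact: (OKi 1)].
  + by exists (@Ordinal 3 2 isT) => /=; exact: prime_proper hp.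
  exists 1; rewrite ?oner_eq0 // => i; rewrite mul1r.
  by case: i => [[|[|[|//]]] ?] /=; rewrite ?ri //; exact: (ri 1).
rewrite int_modelE vel_int /map_weierstrass /= !ri -vel_int -eP.
exact: three_dvd_velu_index.
Qed.

Lemma locally_3_imprimitive : disc_int != 0 ->
  locally_imprimitive 3 (Ecurve b) (special_point t).
Proof.
move=> disc0; apply: sub_finite_set (finite_primes_dividing K (_ :
  0 < `|disc_int|)%N).
  move=> p /= [hp _ ndiv]; split => //; apply: contrapT => npd; apply: ndiv.
  apply: divides_index_away => // pd; apply: npd.
  rewrite -[_%:R]/((`|disc_int|%N)%:Z%:~R) abszEsign rmorphM /=.
  by apply: (prime_mul hp) => //; exact: OK_int.
by rewrite absz_gt0.
Qed.
End GoodReduction.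

(** * Infinitely many parameters *)

Lemma tpar_inj d d' : (0 < d)%N -> (0 < d')%N -> tpar d = tpar d' -> d = d'.
Proof.
move=> d0 d0'; rewrite /tpar => /eqP; rewrite eqr_div; last 2 first.
- by rewrite pnatr_eq0 -lt0n.
- by rewrite pnatr_eq0 -lt0n.
rewrite -!natrM eqr_nat => /eqP e.
apply/eqP; rewrite eqn_dvd; apply/andP; split.
  by rewrite -(Gauss_dvdr (n := num_t d)) 1?coprime_sym ?coprime_num_t_d // e
    dvdn_mull.
by rewrite -(Gauss_dvdr (n := num_t d')) 1?coprime_sym ?coprime_num_t_d // -e
  dvdn_mull.
Qed.

Lemma elliptic_bpar (F : fieldType) (x : F) : x != 0 -> 1 - x - x ^+ 2 != 0 ->
  x - 27 * (1 - x - x ^+ 2) != 0 -> elliptic (tri 1 (bpar x)).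
Proof.
move=> x0 q1 q2; rewrite elliptic_tri /bpar mulf_neq0 ?invr_eq0 //= expr1n.
have -> : 1 - 27 * ((1 - x - x ^+ 2) / x) = (x - 27 * (1 - x - x ^+ 2)) / x
  by field.
by rewrite mulf_neq0 ?invr_eq0.
Qed.

Lemma elliptic_generic (K : fieldType) : 27 != 0 :> K ->
  elliptic (Ecurve (bpar (tofrac 'X : {fraction {poly K}}))).
Proof.
move=> h27; rewrite Ecurve_vel elliptic_vel.
set x : {fraction {poly K}} := tofrac 'X.
have x0 : x != 0 by rewrite tofrac_eq0 polyX_eq0.
have p1 : 1 - 'X - 'X ^+ 2 != 0 :> {poly K}.
  apply/eqP => /(congr1 (fun p : {poly K} => p.[0])).
  by rewrite !hornerE expr0n /= !subr0 => /eqP; rewrite oner_eq0.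
have p2 : 'X - 27%:R * (1 - 'X - 'X ^+ 2) != 0 :> {poly K}.
  apply/eqP => /(congr1 (fun p : {poly K} => p.[0])).
  rewrite -[27%:R]polyC_natr !hornerE expr0n /= !subr0 mulr1 => /eqP.
  by rewrite oppr_eq0 (negPf h27).
have q1 : 1 - x - x ^+ 2 != 0.
  have -> : 1 - x - x ^+ 2 = tofrac (1 - 'X - 'X ^+ 2).
    by rewrite !rmorphB rmorph1 rmorphXn.
  by rewrite tofrac_eq0.
have q2 : x - 27 * (1 - x - x ^+ 2) != 0.
  have -> : x - 27 * (1 - x - x ^+ 2) =
    tofrac ('X - 27%:R * (1 - 'X - 'X ^+ 2)).
    by rewrite rmorphB rmorphM rmorph_nat !rmorphB rmorph1 rmorphXn.
  by rewrite tofrac_eq0.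
exact (elliptic_bpar x0 q1 q2).
Qed.

Lemma map_special_point (F L : fieldType) (f : {rmorphism F -> L}) t : t != 0 ->
  map_pt f (special_point t) = special_point (f t).
Proof.
move=> t0; rewrite !special_point_velu ?fmorph_eq0 // map_velu_pt /= rmorph1.
by rewrite /bpar fmorph_div !rmorphB rmorph1 rmorphXn.
Qed.

Lemma map_bpar (F L : fieldType) (f : {rmorphism F -> L}) t :
  f (bpar t) = bpar (f t).
Proof. by rewrite /bpar fmorph_div !rmorphB rmorph1 rmorphXn. Qed.

Lemma disc_int_tpar_neq0 d : (0 < d)%N ->
  disc_int ((num_t d)%:Z * d%:Z) (- (num_b d)%:Z) != 0.
Proof.
move=> d0; have b0 : (0 < num_b d)%N.
  by rewrite lt0n; apply/eqP; apply: (@num_b_not_cube d 0).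
have n0 : (0 < num_t d)%N by rewrite /num_t addn1.
rewrite /disc_int -PoszM; set h := (num_t d * d)%N.
have h0 : (0 < h)%N by rewrite muln_gt0 n0.
have -> : h%:Z ^+ 3 - 27 * (- (num_b d)%:Z * h%:Z ^+ 2) =
  h%:Z ^+ 2 * (h%:Z + 27 * (num_b d)%:Z) by ring.
rewrite !mulf_neq0 ?expf_neq0 ?oppr_eq0 ?mulf_neq0 ?expf_neq0 //; lia.
Qed.

Theorem theorem6p2 (K : fieldExtType rat) (Kbar : closedFieldType)
    (iota : {rmorphism K -> Kbar}) (Kbar_algebraic : integralRange iota) :
  elliptic (Ecurve (bpar (tofrac 'X : {fraction {poly K}}))) /\
  infinite_set [set t : K |
    [/\ t != 0,
        elliptic (Ecurve (bpar t)),
        special_point t \in points (Ecurve (bpar t))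
      & nontrivial_locally_3_imprimitive iota (Ecurve (bpar t))
          (special_point t)]].
Proof.
split.
  by apply: elliptic_generic; rewrite -(rmorph_nat (in_alg K)) fmorph_eq0.
have [N N0 hN] := noncube_tpar K.
pose D k : nat := (4 * N * k.+1)%N.
have D0 k : (0 < D k)%N by rewrite !muln_gt0 N0.
pose f k : K := (tpar (D k))%:A.
have f_inj : injective f.
  move=> i j /(fmorph_inj (in_alg K)) /(tpar_inj (D0 i) (D0 j)) /eqP.
  by rewrite eqn_pmul2l ?muln_gt0 ?N0 // => /eqP[].
move=> fin; apply: infinite_nat; have := finite_preimage (in2W f_inj) fin.
congr (finite_set _); apply/seteqP; split => // k _ /=.
set d := D k; set t := f k; have d0 := D0 k; have t0 := tpar_neq0 (D0 k).
have dN : (N %| d)%N by rewrite /d /D -mulnA mulnCA dvdn_mulr.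
have d4 : (4 %| d)%N by rewrite /d /D -mulnA dvdn_mulr.
have tK : t != 0 by rewrite /t /f -[_%:A]/(in_alg K _) fmorph_eq0.
have bt : bpar t = in_alg K (bpar (tpar d)) by rewrite map_bpar.
have ell : elliptic (tri 1 (bpar t)).
  by rewrite bt -(rmorph1 (in_alg K)) -map_tri elliptic_map elliptic_tpar.
have ellv : elliptic (vel 1 (bpar t)) by rewrite elliptic_vel.
pose Q : epoint (triC ell) := @EPoint _ (triC ell) _ (bpar_oncurve tK).
have eP : epval (phi Q) = special_point t by rewrite special_point_velu.
have P_on : special_point t \in points (vel 1 (bpar t)).
  by rewrite -eP; exact: (epointP (phi Q)).
have ellq : elliptic (vel 1 (bpar (tpar d)))
  by rewrite elliptic_vel elliptic_tpar.
have Pq_on : special_point (tpar d) \in points (vel 1 (bpar (tpar d))).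
  by rewrite special_point_velu //;
    exact: (epointP (phi (@EPoint _ (triC (elliptic_tpar d0)) _ (bpar_oncurve
    t0)))).
pose Pq := @EPoint _ (EllCurve ellq) _ Pq_on.
have mV : map_weierstrass (in_alg K) (EllCurve ellq) = velC ell.
  by rewrite map_vel rmorph1; congr vel; exact: esym bt.
have P_inc : phi Q = @ep_map _ _ (in_alg K) (EllCurve ellq) (velC ell) mV Pq.
  by apply: epval_inj; rewrite eP;
    exact: esym (map_special_point (in_alg K) t0).
have P_nt n : (0 < n)%N -> phi Q *+ n != 0.
  move=> n0; have := tpar_nontorsion d0 d4 (P := Pq) (n := n) erefl n0.
  apply: contra_neq; rewrite P_inc -raddfMn -(raddf0 (ep_map mV)).
  exact: ep_map_inj.
have [ct cb cbt cbdt] := hN d d0 dN.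
rewrite Ecurve_vel; split => //; split.
- split => // -[n n0]; rewrite -eP -(@epvalMn _ (velC ell)) => e.
  by case/eqP: (P_nt n n0); apply: epval_inj.
- have nz (m : nat) : (0 < m)%N -> (m%:Z)%:~R != 0 :> K.
    by rewrite -(rmorph_int (in_alg K)) fmorph_eq0 intr_eq0 eqz_nat -lt0n.
  rewrite -Ecurve_vel.
  apply: (@locally_3_imprimitive _ ((num_t d)%:Z * d%:Z) (- (num_b d)%:Z)
    (num_t d) d).
  + by [].
  + by rewrite num_bE.
  + exact: nz.
  + by apply: nz; rewrite /num_t addn1.
  + by rewrite /t /f -/d -[LHS]/(in_alg K _) fmorph_div !rmorph_nat.
  exact: disc_int_tpar_neq0.
- exact: (velu_condC iota tK erefl ell).
- move=> [_ [R RE eR]].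
  have cubeK (x : rat) (y : K) : in_alg K x = y -> ~ is_cube (x%:A : K) ->
    ~ is_cube y.
    by move=> <-.
  apply: (@not_triple K Kbar iota t ell (phi Q) (@EPoint _ (velC ell) R RE))
    => //.
  + by apply: cubeK cbt; rewrite rmorphM /= bt.
  + by apply: cubeK cbdt; rewrite fmorph_div /= bt.
  by apply: epval_inj; rewrite eP epvalMn.
- by apply: not_condB => //; rewrite bt.
Qed.
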